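(* Let $n\ge 2$. For every $\varepsilon>0$ there are, on the sphere $S^{2n-1}$, a real-analytic Riemannian metric $g$ of cohomogeneity $1$ and a real-analytic Killing vector field $X$ of unit length on $(S^{2n-1},g)$ with closed integral curves, such that: 1) all sectional curvatures of $(S^{2n-1},g)$ differ from $1$ by at most $\varepsilon$; 2) $L/l>1/\varepsilon$, where $L$ and $l$ are respectively the maximal and the minimal lengths of integral curves of the field $X$.
   Context: A Killing vector field on a Riemannian manifold $(M,g)$ is a smooth vector field $X$ with $L_Xg=0$. A Riemannian manifold $M$ has cohomogeneity $1$ if some compact Lie group $G$ acts smoothly and isometrically on $M$ so that the orbit space $M/G$ is one-dimensional. The length of a closed integral curve is its length as a simple closed curve. *)

(* Defs.v *)
From HB Require Import structures.
From mathcomp Require Import all_boot all_order all_algebra.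
From mathcomp Require Import all_classical all_reals all_analysis.
From mathcomp Require Import ring.

Set Implicit Arguments.
Unset Strict Implicit.
Unset Printing Implicit Defensive.

Import Order.TTheory GRing.Theory Num.Theory.
Import numFieldNormedType.Exports.

Local Open Scope classical_set_scope.
Local Open Scope ring_scope.
Local Open Scope quotient_scope.

(** ** Calculus in coordinates *)

Definition partial (R : realType) (d : nat) (W : normedModType R)
    (i : 'I_d) (f : 'rV[R]_d -> W) : 'rV[R]_d -> W :=
  fun u => 'D_(delta_mx 0 i) f u.

(* C^oo on the open set U: all iterated partial derivatives (indexed by the
   word s) exist and are continuous on U. *)
Definition smooth_on (R : realType) (d : nat) (W : normedModType R)
    (U : set 'rV[R]_d) (f : 'rV[R]_d -> W) : Prop :=
  forall (s : seq 'I_d) (u : 'rV[R]_d), U u ->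
    let h := foldr (@partial R d W) f s in
    {for u, continuous h} /\ (forall i : 'I_d, derivable h u (delta_mx 0 i)).

(* Absolutely convergent multi-variable power series on a neighbourhood of a;
   the norm on 'rV is the sup norm, so the neighbourhood is a cube.  The
   multi-indices are exhausted by the cubes [0, N)^d. *)
Definition real_analytic_at (R : realType) (d : nat)
    (f : 'rV[R]_d -> R) (a : 'rV[R]_d) : Prop :=
  exists (c : {ffun 'I_d -> nat} -> R) (r : R), 0 < r /\
    forall y : 'rV[R]_d, `|y - a| < r ->
      let term (k : {ffun 'I_d -> nat}) :=
        c k * \prod_(i < d) (y 0 i - a 0 i) ^+ k i in
      let idx (N : nat) (k : {ffun 'I_d -> 'I_N}) : {ffun 'I_d -> nat} :=
        [ffun i => val (k i)] in
      cvgn (fun N : nat => \sum_(k : {ffun 'I_d -> 'I_N}) `|term (idx N k)|) /\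
      (fun N : nat => \sum_(k : {ffun 'I_d -> 'I_N}) term (idx N k)) @ \oo
        --> f y.

Definition real_analytic_on (R : realType) (d : nat)
    (U : set 'rV[R]_d) (f : 'rV[R]_d -> R) : Prop :=
  forall u, U u -> real_analytic_at f u.

(** ** Tensor calculus in one coordinate domain *)

Section local_tensors.
Variables (R : realType) (d : nat).
Local Notation coords := 'rV[R]_d.

Definition inner (a : 'M[R]_d) (v w : coords) : R := (v *m a *m w^T) 0 0.

(* Components of L_X g in one chart. *)
Definition lie_derivative (X : coords -> coords) (g : coords -> 'M[R]_d)
    (u : coords) (i j : 'I_d) : R :=
  \sum_k (X u 0 k * partial k (fun x => g x i j) u
          + g u k j * partial i (fun x => X x 0 k) u
          + g u i k * partial j (fun x => X x 0 k) u).

(* christoffel g k i j = Gamma^k_(ij) *)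
Definition christoffel (g : coords -> 'M[R]_d) (k i j : 'I_d) (u : coords) : R :=
  2^-1 * \sum_l invmx (g u) k l *
    (partial i (fun x => g x j l) u + partial j (fun x => g x i l) u
     - partial l (fun x => g x i j) u).

(* R(e_i, e_j) e_k = \sum_l (riemann g l k i j) e_l, with the convention
   R(V, W) Z = D_V D_W Z - D_W D_V Z - D_[V, W] Z. *)
Definition riemann (g : coords -> 'M[R]_d) (l k i j : 'I_d) (u : coords) : R :=
  partial i (christoffel g l j k) u - partial j (christoffel g l i k) u
  + \sum_m (christoffel g l i m u * christoffel g m j k u
            - christoffel g l j m u * christoffel g m i k u).

(* R(v, w) w *)
Definition riemann_vec (g : coords -> 'M[R]_d) (u : coords) (v w : coords) :
  coords :=
  \row_l \sum_i \sum_j \sum_k riemann g l k i j u * v 0 i * w 0 j * w 0 k.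

Definition sectional (g : coords -> 'M[R]_d) (u : coords) (v w : coords) : R :=
  inner (g u) (riemann_vec g u v w) v
  / (inner (g u) v v * inner (g u) w w - inner (g u) v w ^+ 2).

End local_tensors.

(** ** Charts and manifolds *)

(* Only the values of [cmap] on [cdom] and of [cinv] on [cimg] matter. *)
Record chart (R : realType) (T : topologicalType) (d : nat) := Chart {
  cdom : set T;
  cmap : T -> 'rV[R]_d;
  cinv : 'rV[R]_d -> T }.

Definition cimg (R : realType) (T : topologicalType) (d : nat)
  (c : chart R T d) : set 'rV[R]_d := cmap c @` cdom c.

Definition is_chart (R : realType) (T : topologicalType) (d : nat)
    (c : chart R T d) : Prop :=
  [/\ open (cdom c), open (cimg c),
      forall x, cdom c x -> cinv c (cmap c x) = x,
      {within cdom c, continuous (cmap c)}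
    & {within cimg c, continuous (cinv c)}].

(* A charted space; [is_manifold] says that it is a smooth manifold.
   [chart_at x] is a preferred chart around x. *)
Record charted (R : realType) := Charted {
  carrier :> topologicalType;
  dim : nat;
  atlas : set (chart R carrier dim);
  chart_at : carrier -> chart R carrier dim }.

(* The coordinate expression of f : M -> N in the charts c, c', and the set on
   which it is meaningful. *)
Definition local_rep (R : realType) (M N : charted R) (f : M -> N)
    (c : chart R M (dim M)) (c' : chart R N (dim N)) :
  'rV[R]_(dim M) -> 'rV[R]_(dim N) := fun u => cmap c' (f (cinv c u)).

Definition local_dom (R : realType) (M N : charted R) (f : M -> N)
    (c : chart R M (dim M)) (c' : chart R N (dim N)) : set 'rV[R]_(dim M) :=
  cmap c @` (cdom c `&` f @^-1` cdom c').

Definition smooth_map (R : realType) (M N : charted R) (f : M -> N) : Prop :=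
  continuous f /\
  forall c c', atlas c -> atlas c' ->
    smooth_on (local_dom f c c') (local_rep f c c').

Definition is_manifold (R : realType) (M : charted R) : Prop :=
  [/\ hausdorff_space M, @second_countable M,
      forall x : M, atlas (chart_at x) /\ cdom (chart_at x) x,
      forall c : chart R M (dim M), atlas c -> is_chart c
    & forall c c' : chart R M (dim M), atlas c -> atlas c' ->
        smooth_on (local_dom (@id M) c c') (local_rep (@id M) c c')].

Definition prod_chart (R : realType) (T1 T2 : topologicalType) (d1 d2 : nat)
    (c1 : chart R T1 d1) (c2 : chart R T2 d2) :
  chart R (T1 * T2)%type (d1 + d2) :=
  @Chart R (T1 * T2)%type (d1 + d2)
    (cdom c1 `*` cdom c2)
    (fun p => row_mx (cmap c1 p.1) (cmap c2 p.2))
    (fun u => (cinv c1 (lsubmx u), cinv c2 (rsubmx u))).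

Definition prod_charted (R : realType) (M N : charted R) : charted R :=
  @Charted R (M * N)%type (dim M + dim N)
    [set c | exists c1 c2,
      [/\ atlas c1, atlas c2 & c = prod_chart c1 c2]]
    (fun p => prod_chart (chart_at p.1) (chart_at p.2)).

(** ** The sphere [S^d] in [R^(d+1)], with its two stereographic charts *)

Definition sphere (R : realType) (d : nat) : set 'rV[R]_(d.+1) :=
  [set x | \sum_(i < d.+1) x 0 i ^+ 2 = 1].

Definition sqnorm (R : realType) (d : nat) (u : 'rV[R]_d) : R :=
  \sum_(i < d) u 0 i ^+ 2.

(* Inverse stereographic projection from the pole ((-1)^s, 0, ..., 0). *)
Definition stereo_inv (R : realType) (d : nat) (s : bool) (u : 'rV[R]_d) :
  'rV[R]_(1 + d) :=
  row_mx (const_mx ((-1) ^+ s * ((sqnorm u - 1) / (sqnorm u + 1))))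
         ((2 / (sqnorm u + 1)) *: u).

Lemma stereo_inv_sphere (R : realType) (d : nat) (s : bool) (u : 'rV[R]_d) :
  (stereo_inv s u : 'rV[R]_(d.+1)) \in @sphere R d.
Proof.
rewrite inE /sphere /= -[d.+1]/(1 + d)%N big_split_ord /= big_ord1.
have q0 : sqnorm u + 1 != 0.
  by rewrite gt_eqF // ltr_wpDl // sumr_ge0 // => i _; rewrite sqr_ge0.
rewrite row_mxEl mxE exprMn sqrr_sign mul1r.
under eq_bigr do rewrite row_mxEr mxE exprMn.
by rewrite -mulr_sumr -/(sqnorm u); field.
Qed.

Definition sphere_val (R : realType) (d : nat) (x : @sphere R d) :
  'rV[R]_(1 + d) := \val x.

Definition stereo_chart (R : realType) (d : nat) (s : bool) :
  chart R (@sphere R d) d :=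
  @Chart R (@sphere R d) d
    [set x | sphere_val x 0 0 != (-1) ^+ s]
    (fun x => (1 - (-1) ^+ s * sphere_val x 0 0)^-1 *: rsubmx (sphere_val x))
    (fun u => exist _ (stereo_inv s u : 'rV[R]_(d.+1)) (stereo_inv_sphere s u)).

(* The preferred chart at x projects from (1, 0, ..., 0), unless x is that
   pole. *)
Definition sphere_charted (R : realType) (d : nat) : charted R :=
  @Charted R (@sphere R d) d
    [set c | exists s, c = @stereo_chart R d s]
    (fun x => @stereo_chart R d (sphere_val x 0 0 == 1)).

(** ** Tensor fields, given by their components in the charts of the atlas *)

Section tensors.
Variables (R : realType) (M : charted R).
Local Notation d := (dim M).
Local Notation coords := 'rV[R]_d.

Definition vfield := chart R M d -> coords -> coords.
Definition metric := chart R M d -> coords -> 'M[R]_d.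

(* The components transform by the differential of the change of charts. *)
Definition vector_field (X : vfield) : Prop :=
  forall c c', atlas c -> atlas c' -> forall u, local_dom (@id M) c c' u ->
    let tau := local_rep (@id M) c c' in
    X c' (tau u) = 'D_(X c u) tau u.

Definition smooth_vector_field (X : vfield) : Prop :=
  vector_field X /\ forall c, atlas c -> smooth_on (cimg c) (X c).

Definition analytic_vector_field (X : vfield) : Prop :=
  vector_field X /\
  forall c, atlas c ->
    forall i, real_analytic_on (cimg c) (fun u => X c u 0 i).

(* f^* g = g *)
Definition preserves (g : metric) (f : M -> M) : Prop :=
  forall c c', atlas c -> atlas c' -> forall u, local_dom f c c' u ->
    let F := local_rep f c c' in
    forall v w : coords,
      inner (g c' (F u)) ('D_v F u) ('D_w F u) = inner (g c u) v w.

(* [preserves g id] is the change-of-chart rule for the components of g. *)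
Definition riemannian_metric (g : metric) : Prop :=
  [/\ preserves g id,
      forall c, atlas c -> smooth_on (cimg c) (g c),
      forall c u, atlas c -> cimg c u -> (g c u)^T = g c u
    & forall c u, atlas c -> cimg c u ->
        forall v : coords, v != 0 -> 0 < inner (g c u) v v].

Definition analytic_metric (g : metric) : Prop :=
  riemannian_metric g /\
  forall c, atlas c ->
    forall i j, real_analytic_on (cimg c) (fun u => g c u i j).

Definition killing (g : metric) (X : vfield) : Prop :=
  smooth_vector_field X /\
  forall c, atlas c -> forall u, cimg c u ->
    forall i j, lie_derivative (X c) (g c) u i j = 0.

Definition unit_length (g : metric) (X : vfield) : Prop :=
  forall c, atlas c -> forall u, cimg c u -> inner (g c u) (X c u) (X c u) = 1.

(* K is the sectional curvature of some tangent 2-plane span(v, w). *)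
Definition is_sectional_curvature (g : metric) (K : R) : Prop :=
  exists c u (v w : coords),
    [/\ atlas c, cimg c u, free [:: v; w] & K = sectional (g c) u v w].

(** ** Integral curves

    Maximal integral curves on a compact manifold are defined on all of R, so
    only curves R -> M are considered. *)

Definition integral_curve (X : vfield) (gamma : R -> M) : Prop :=
  continuous gamma /\
  forall t c, atlas c -> cdom c (gamma t) ->
    is_derive t (1 : R) (fun s => cmap c (gamma s)) (X c (cmap c (gamma t))).

Definition simple_closed (gamma : R -> M) (T : R) : Prop :=
  [/\ 0 < T, forall t, gamma (t + T) = gamma t
    & forall s t, 0 <= s < T -> 0 <= t < T -> gamma s = gamma t -> s = t].

Definition closed_integral_curves (X : vfield) : Prop :=
  (forall x : M, exists2 gamma, integral_curve X gamma & gamma 0 = x) /\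
  (forall gamma, integral_curve X gamma -> exists T, simple_closed gamma T).

Definition speed (g : metric) (gamma : R -> M) (t : R) : R :=
  let c := chart_at (gamma t) in
  let v := 'D_(1 : R) (fun s => cmap c (gamma s)) t in
  Num.sqrt (inner (g c (cmap c (gamma t))) v v).

Definition curve_length (g : metric) (gamma : R -> M) (a b : R) : R :=
  (\int[lebesgue_measure]_(t in `[a, b]) speed g gamma t)%R.

Definition integral_curve_lengths (g : metric) (X : vfield) : set R :=
  [set len | exists gamma T,
    [/\ integral_curve X gamma, simple_closed gamma T
      & len = curve_length g gamma 0 T]].

End tensors.

(** ** Lie groups, orbit spaces, cohomogeneity *)

Record lie_group (R : realType) := LieGroup {
  lie_charted :> charted R;
  lie_mul : lie_charted -> lie_charted -> lie_charted;
  lie_one : lie_charted;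
  lie_inv : lie_charted -> lie_charted;
  lie_manifold : is_manifold lie_charted;
  lie_mulA : associative lie_mul;
  lie_mul1 : left_id lie_one lie_mul;
  lie_mulV : left_inverse lie_one lie_inv lie_mul;
  lie_mul_smooth : @smooth_map R (prod_charted lie_charted lie_charted)
    lie_charted (fun p => lie_mul p.1 p.2);
  lie_inv_smooth : smooth_map lie_inv }.

Definition smooth_action (R : realType) (G : lie_group R) (M : charted R)
    (act : G -> M -> M) : Prop :=
  [/\ forall x, act (lie_one G) x = x,
      forall a b x, act (lie_mul a b) x = act a (act b x)
    & @smooth_map R (prod_charted G M) M (fun p => act p.1 p.2)].

Definition orbit (G : Type) (T : topologicalType) (act : G -> T -> T) (x : T) :
  set T := [set act a x | a in [set: G]].

Definition same_orbit (G : Type) (T : topologicalType) (act : G -> T -> T) :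
  rel T := fun x y => `[< orbit act x = orbit act y >].

Lemma same_orbit_equiv (G : Type) (T : topologicalType) (act : G -> T -> T) :
  equiv_class_of (same_orbit act).
Proof.
split=> [x|x y|y x z]; first exact/asboolP.
- by apply/asboolP/asboolP => ->.
- by move=> /asboolP xy /asboolP yz; apply/asboolP; rewrite xy.
Qed.

Canonical same_orbit_rel (G : Type) (T : topologicalType) (act : G -> T -> T) :=
  EquivRelPack (same_orbit_equiv act).

Definition orbit_space (G : Type) (T : topologicalType) (act : G -> T -> T) :
  topologicalType := quotient_topology {eq_quot same_orbit_rel act}.

Definition open_cover (T : topologicalType) (U : set (set T)) : Prop :=
  (forall A, U A -> open A) /\ \bigcup_(A in U) A = [set: T].

(* Lebesgue covering dimension *)
Definition covering_dim_le (T : topologicalType) (m : nat) : Prop :=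
  forall U : set (set T), open_cover U ->
    exists V : set (set T),
      [/\ open_cover V, forall B, V B -> exists2 A, U A & B `<=` A
        & forall x : T, ([set B | V B /\ B x] #<= `I_m.+1)%card].

Definition covering_dim (T : topologicalType) (m : nat) : Prop :=
  covering_dim_le T m /\ forall k, (k < m)%N -> ~ covering_dim_le T k.

Definition cohomogeneity_one (R : realType) (M : charted R) (g : metric M) :
  Prop :=
  exists (G : lie_group R) (act : G -> M -> M),
    [/\ compact [set: G], smooth_action act,
        forall a, preserves g (act a)
      & covering_dim (orbit_space act) 1].

(* Main.v *)
(* Split R^(2n) = C + C^(n-1) and rotate the two summands with speeds 1 and
   b = (m+1)/m. The resulting field X is Killing for the round metric and its
   squared length F = 1 + (b^2 - 1)(1 - |z_1|^2) is constant along its flow, so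
   X is a unit Killing field for the conformal metric round/F. Generic orbits
   have period 2 pi m, while those with z_1 = 0 have period 2 pi m/(m+1), so
   L/l = m + 1. As b tends to 1, F tends to 1 in C^2 and the curvature tends
   to 1. The isometries commuting with the projection onto the first summand
   act with |z_1|^2 as a complete invariant, so the orbit space is an interval.

   In both stereographic charts the metric is (4/Q) times the Euclidean one,
   where Q is a polynomial. *)
Require Import Defs.
From HB Require Import structures.
From mathcomp Require Import all_boot all_order all_algebra.
From mathcomp Require Import all_classical all_reals all_analysis.
From mathcomp Require Import ring lra.

Set Implicit Arguments.
Unset Strict Implicit.
Unset Printing Implicit Defensive.

Import Order.TTheory GRing.Theory Num.Theory.
Import numFieldNormedType.Exports.
Local Open Scope classical_set_scope.
Local Open Scope ring_scope.
Local Open Scope quotient_scope.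

(** * Smoothness of rational functions *)

(** Since all notions of the statement are read in charts, every object is chosen with rational
    coordinate expressions: stereographic charts on the sphere, Cayley charts on the group. Rational
    functions without poles are stable under differentiation, which settles smoothness; analyticity
    concerns only polynomials and 1/Q, where a geometric series suffices.

    Both centres of projection lie on the first complex line, which is why the two charts give the
    same Q. The complex structure of the complement enters only through a real skew matrix [N] with
    [c *m N = 0] and [N *m N = c^T *m c - 1%:M].

    The passage b -> 1 is made quantitative. The metric is conformally flat, so its curvature K is a
    formula in the gradient and Hessian of Q, and (K - 1) Q turns out to be k = b^2 - 1 times an
    expression of size at most 20 Q, uniformly over the unbounded chart.

    The speed (m+1)/m is a quotient of consecutive, hence coprime, integers, so 2 pi m is the exact
    generic period. The group is all of O(2) x O(2n-2): it contains enough reflections to join any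
    two points with the same |z_1|^2. *)

Section rational_functions.
Variables (R : realType) (d : nat).
Implicit Types (U : set 'rV[R]_d) (f g : 'rV[R]_d -> R).

(* Closed under partial derivatives on an open U, whence C^oo. *)
Inductive rat_on U : ('rV[R]_d -> R) -> Prop :=
| rat_coord i : rat_on U (fun u => u 0 i)
| rat_cst c : rat_on U (fun=> c)
| rat_add f g : rat_on U f -> rat_on U g -> rat_on U (fun u => f u + g u)
| rat_mul f g : rat_on U f -> rat_on U g -> rat_on U (fun u => f u * g u)
| rat_inv f : rat_on U f -> (forall u, U u -> f u != 0) ->
    rat_on U (fun u => (f u)^-1)
| rat_ext f g : (forall u, U u -> f u = g u) -> rat_on U f -> rat_on U g.

Lemma rat_opp U f : rat_on U f -> rat_on U (fun u => - f u).
Proof.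
move=> rf; apply: (@rat_ext _ (fun u => -1 * f u)).
  by move=> u _; rewrite mulN1r.
by apply: rat_mul => //; exact: rat_cst.
Qed.

Lemma rat_sub U f g : rat_on U f -> rat_on U g -> rat_on U (fun u => f u - g u).
Proof. by move=> rf rg; apply: rat_add => //; exact: rat_opp. Qed.

Lemma rat_sum U (I : Type) (r : seq I) (P : pred I) (F : I -> 'rV[R]_d -> R) :
  (forall i, rat_on U (F i)) -> rat_on U (fun u => \sum_(i <- r | P i) F i u).
Proof.
move=> rF; elim: r => [|i r IH].
  by apply: rat_ext (rat_cst U 0) => u _; rewrite big_nil.
apply: (@rat_ext _ (fun u => (if P i then F i u else 0) +
   \sum_(i <- r | P i) F i u)).
  by move=> u _; rewrite big_cons; case: (P i); rewrite ?add0r.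
by apply: rat_add => //; case: (P i) => //; exact: rat_cst.
Qed.

Lemma rat_prod U (I : Type) (r : seq I) (P : pred I) (F : I -> 'rV[R]_d -> R) :
  (forall i, rat_on U (F i)) -> rat_on U (fun u => \prod_(i <- r | P i) F i u).
Proof.
move=> rF; elim: r => [|i r IH].
  by apply: rat_ext (rat_cst U 1) => u _; rewrite big_nil.
apply: (@rat_ext _ (fun u => (if P i then F i u else 1) *
   \prod_(i <- r | P i) F i u)).
  by move=> u _; rewrite big_cons; case: (P i); rewrite ?mul1r.
by apply: rat_mul => //; case: (P i) => //; exact: rat_cst.
Qed.

Lemma near_open U (P : 'rV[R]_d -> Prop) u : open U -> U u ->
  (forall x, U x -> P x) -> \forall x \near u, P x.
Proof.
by move=> oU Uu UP; have := open_nbhs_nbhs (conj oU Uu); exact: filterS.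
Qed.

Lemma near_eq_continuous (V W : topologicalType) (f g : V -> W) x :
  (\near x, f x = g x) -> {for x, continuous f} -> {for x, continuous g}.
Proof.
move=> fg cf; rewrite /prop_for /continuous_at -(nbhs_singleton fg).
apply: cvg_trans cf; apply: (near_eq_cvg (F := nbhs x)).
by apply: filterS fg => y ->.
Qed.

Lemma rat_continuous U f u : open U -> rat_on U f -> U u ->
  {for u, continuous f}.
Proof.
move=> oU rf Uu; elim: rf => {f}.
- by move=> i; exact: coord_continuous.
- by move=> c; exact: cst_continuous.
- by move=> f g _ cf _ cg; exact: (cvgD cf cg).
- by move=> f g _ cf _ cg; exact: (cvgM cf cg).
- by move=> f _ cf f0; exact: (cvgV (f0 _ Uu) cf).
- move=> f g fg _ cf; apply: near_eq_continuous cf.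
  exact: near_open oU Uu fg.
Qed.

Lemma is_derive_coord (m n : nat) (V : normedModType R) (M : V -> 'M[R]_(m, n))
    (dM : 'M[R]_(m, n)) x v
    i j : is_derive x v M dM -> is_derive x v (fun y => M y i j) (dM i j).
Proof.
move=> [dxM <-]; have := derivable_mxP M x v; move=> [/(_ dxM) dc _].
by split; [exact: dc|rewrite derive_mx // mxE].
Qed.

Lemma is_derive_mx (m n : nat) (V : normedModType R) (M : V -> 'M[R]_(m, n))
    (dM : 'M[R]_(m, n)) x v :
  (forall i j, is_derive x v (fun y => M y i j) (dM i j)) -> is_derive x v M dM.
Proof.
move=> dc; have dx : derivable M x v.
  by apply/derivable_mxP => i j; have [] := dc i j.
split => //; rewrite derive_mx //; apply/matrixP => i j; rewrite mxE.
by have [] := dc i j.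
Qed.

Lemma rat_derive U f v : open U -> rat_on U f ->
  exists2 df, rat_on U df & forall u, U u -> is_derive u v f (df u).
Proof.
move=> oU; elim => {f}.
- move=> i; exists (fun=> v 0 i); first exact: rat_cst.
  by move=> u _; apply: is_derive_coord; exact: is_derive_id.
- by move=> c; exists (fun=> 0); [exact: rat_cst|move=> u _; exact: is_derive_cst].
- move=> f g _ [df rdf fE] _ [dg rdg gE]; exists (fun u => df u + dg u).
    exact: rat_add.
  by move=> u Uu; have := fE u Uu; have := gE u Uu; move=> ? ?; exact: is_deriveD.
- move=> f g rf [df rdf fE] rg [dg rdg gE].
  exists (fun u => f u * dg u + g u * df u).
    by apply: rat_add; apply: rat_mul.
  by move=> u Uu; have := fE u Uu; have := gE u Uu; move=> ? ?; exact: is_deriveM.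
- move=> f rf [df rdf fE] f0.
  exists (fun u => - ((f u)^-1 * (f u)^-1) * df u).
    apply: rat_mul => //; apply: rat_opp; apply: rat_mul; exact: rat_inv.
  move=> u Uu; have [dfu dfE] := fE u Uu; split.
    by apply: derivableV => //; exact: f0.
  by rewrite deriveV ?f0 // dfE -invfM -expr2.
- move=> f g fg _ [df rdf fE]; exists df => // u Uu.
  by apply: near_eq_is_derive (fE u Uu); exact: (near_open oU Uu fg).
Qed.

End rational_functions.

Section rational_matrices.
Variables (R : realType) (d : nat).
Implicit Types (U : set 'rV[R]_d).

Definition rat_mx m n U (F : 'rV[R]_d -> 'M[R]_(m, n)) : Prop :=
  forall i j, rat_on U (fun u => F u i j).

Lemma rat_mx_cst m n U (A : 'M[R]_(m, n)) : rat_mx U (fun=> A).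
Proof. by move=> i j; exact: rat_cst. Qed.

Lemma rat_mx_id U : rat_mx U (fun u => u).
Proof. by move=> i j; rewrite (ord1 i); exact: rat_coord. Qed.

Lemma rat_mx_add m n U (F G : _ -> 'M[R]_(m, n)) :
  rat_mx U F -> rat_mx U G -> rat_mx U (fun u => F u + G u).
Proof.
move=> rF rG i j; apply: rat_ext (rat_add (rF i j) (rG i j)) => u _.
by rewrite mxE.
Qed.

Lemma rat_mx_opp m n U (F : _ -> 'M[R]_(m, n)) :
  rat_mx U F -> rat_mx U (fun u => - F u).
Proof.
by move=> rF i j; apply: rat_ext (rat_opp (rF i j)) => u _; rewrite mxE.
Qed.

Lemma rat_mx_sub m n U (F G : _ -> 'M[R]_(m, n)) :
  rat_mx U F -> rat_mx U G -> rat_mx U (fun u => F u - G u).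
Proof. by move=> rF rG; apply: rat_mx_add => //; exact: rat_mx_opp. Qed.

Lemma rat_mx_scale m n U f (F : _ -> 'M[R]_(m, n)) :
  rat_on U f -> rat_mx U F -> rat_mx U (fun u => f u *: F u).
Proof.
move=> rf rF i j; apply: rat_ext (rat_mul rf (rF i j)) => u _.
by rewrite mxE.
Qed.

Lemma rat_mx_mul m n p U (F : _ -> 'M[R]_(m, n)) (G : _ -> 'M[R]_(n, p)) :
  rat_mx U F -> rat_mx U G -> rat_mx U (fun u => F u *m G u).
Proof.
move=> rF rG i j.
apply: rat_ext (@rat_sum _ _ U _ _ xpredT (fun k u => F u i k * G u k j) _).
  by move=> u _; rewrite mxE.
by move=> k; exact: rat_mul.
Qed.

Lemma rat_mx_tr m n U (F : _ -> 'M[R]_(m, n)) :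
  rat_mx U F -> rat_mx U (fun u => (F u)^T).
Proof. by move=> rF i j; apply: rat_ext (rF j i) => u _; rewrite mxE. Qed.

Lemma rat_det n U (F : _ -> 'M[R]_n) :
  rat_mx U F -> rat_on U (fun u => \det (F u)).
Proof.
move=> rF; apply: rat_sum => s; apply: rat_mul; first exact: rat_cst.
by apply: rat_prod => i; exact: rF.
Qed.

(** Cramer's rule: the entries are cofactors divided by the determinant, which does not vanish on
    [U]. *)
Lemma rat_mx_inv n U (F : _ -> 'M[R]_n) :
  rat_mx U F -> (forall u, U u -> F u \in unitmx) ->
  rat_mx U (fun u => invmx (F u)).
Proof.
move=> rF Fu i j.
have du u : U u -> \det (F u) != 0 by move=> /Fu; rewrite unitmxE unitfE.
apply: (@rat_ext _ _ _ (fun u => (\det (F u))^-1 * cofactor (F u) j i)).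
  by move=> u /Fu Uu; rewrite /invmx Uu !mxE.
apply: rat_mul; first by apply: rat_inv => //; exact: rat_det.
apply: rat_mul; first exact: rat_cst.
by apply: rat_det => k l; apply: rat_ext (rF _ _) => u _; rewrite !mxE.
Qed.

Lemma rat_row_mx n1 n2 U (F : _ -> 'rV[R]_n1) (G : _ -> 'rV[R]_n2) :
  rat_mx U F -> rat_mx U G -> rat_mx U (fun u => row_mx (F u) (G u)).
Proof.
move=> rF rG i j; case: (splitP j) => k jk.
- have -> : j = lshift n2 k by apply/val_inj.
  by apply: rat_ext (rF i k) => u _; rewrite row_mxEl.
- have -> : j = rshift n1 k by apply/val_inj.
  by apply: rat_ext (rG i k) => u _; rewrite row_mxEr.
Qed.

Lemma rat_mx_const m n U f : rat_on U f -> rat_mx U (fun u => const_mx (f u) : 'M[R]_(m, n)).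
Proof. by move=> rf i j; apply: rat_ext rf => u _; rewrite mxE. Qed.

Lemma rat_rsubmx n1 n2 U (F : _ -> 'rV[R]_(n1 + n2)) :
  rat_mx U F -> rat_mx U (fun u => rsubmx (F u)).
Proof. by move=> rF i j; apply: rat_ext (rF _ _) => u _; rewrite mxE. Qed.

Lemma rat_lsubmx n1 n2 U (F : _ -> 'rV[R]_(n1 + n2)) :
  rat_mx U F -> rat_mx U (fun u => lsubmx (F u)).
Proof. by move=> rF i j; apply: rat_ext (rF _ _) => u _; rewrite mxE. Qed.

Lemma rat_mx_ext m n U (F G : _ -> 'M[R]_(m, n)) :
  (forall u, U u -> F u = G u) -> rat_mx U F -> rat_mx U G.
Proof. by move=> FG rF i j; apply: rat_ext (rF i j) => u Uu; rewrite FG. Qed.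

Lemma rat_sqnorm U n (F : _ -> 'rV[R]_n) :
  rat_mx U F -> rat_on U (fun u => sqnorm (F u)).
Proof.
move=> rF; apply: rat_sum => i; apply: rat_ext (rat_mul (rF 0 i) (rF 0 i)).
by move=> u _; rewrite expr2.
Qed.

Lemma cvg_mx m n (T : Type) (F : set_system T) (FF : Filter F)
    (M : T -> 'M[R]_(m, n)) (A : 'M[R]_(m, n)) :
  (forall i j, M x i j @[x --> F] --> A i j) -> M x @[x --> F] --> A.
Proof.
move=> MA; apply/cvgrPdist_le => /= e e0.
near=> x; rewrite /Num.Def.normr/= mx_normrE (bigmax_le _ (ltW e0))//= => i _.
rewrite !mxE/=; move: i; near: x; apply: filter_forall => /= i.
by have /cvgrPdist_le/(_ _ e0) := MA i.1 i.2.
Unshelve. all: by end_near. Qed.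

Lemma rat_mx_continuous m n U (F : _ -> 'M[R]_(m, n)) u :
  open U -> rat_mx U F -> U u -> {for u, continuous F}.
Proof.
move=> oU rF Uu; apply: (@cvg_mx m n _ (nbhs u) _ F (F u)) => i j.
exact: rat_continuous oU (rF i j) Uu.
Qed.

Lemma rat_mx_derive m n U (F : _ -> 'M[R]_(m, n)) v : open U -> rat_mx U F ->
  exists2 dF, rat_mx U dF & forall u, U u -> is_derive u v F (dF u).
Proof.
move=> oU rF.
pose D i j := cid2 (rat_derive v oU (rF i j)).
exists (fun u => \matrix_(i, j) s2val (D i j) u).
  by move=> i j; apply: rat_ext (s2valP (D i j)) => u _; rewrite mxE.
move=> u Uu; apply: is_derive_mx => i j; rewrite mxE.
exact: (s2valP' (D i j)).
Qed.

(** By induction on the word of partial derivatives, every iterated derivative agrees on [U] with a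
    rational map, so continuity and derivability are needed for rational maps only. *)
Lemma rat_mx_smooth m n U (F : _ -> 'M[R]_(m, n)) :
  open U -> rat_mx U F -> smooth_on U F.
Proof.
move=> oU rF s u Uu.
suff rs : rat_mx U (foldr (@partial R d _) F s).
  split; first exact: rat_mx_continuous rs Uu.
  by move=> i; have [dF _ /(_ _ Uu)[]] := rat_mx_derive (delta_mx 0 i) oU rs.
elim: s => //= i s IH.
have [dF rdF dFE] := rat_mx_derive (delta_mx 0 i) oU IH.
by apply: rat_mx_ext rdF => x /dFE[].
Qed.

End rational_matrices.

(** * Analyticity of polynomials and of their inverses *)

Section power_series.
Variables (R : realType) (d : nat).
Local Notation midx := {ffun 'I_d -> nat}.
Implicit Types (s : seq (R * midx)) (k : midx) (h : 'rV[R]_d).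

Definition monom k h : R := \prod_(i < d) h 0 i ^+ k i.

Definition mdeg k : nat := \sum_(i < d) k i.

(** A polynomial is a list of pairs of a coefficient and an exponent. An exponent may occur several
    times, so sums and products need no normalisation. *)
Definition monsum s h : R := \sum_(t <- s) t.1 * monom t.2 h.

(** Bounds the polynomial on the cube of radius [r] (see [norm_monsum]). Unlike the supremum it is
    multiplicative on lists, which makes powers computable. *)
Definition majorant s (r : R) : R := \sum_(t <- s) `|t.1| * r ^+ mdeg t.2.

(** The exponents over which [real_analytic_at] sums, as a sequence in a type independent of [N], so
    that different [N] can be compared. *)
Definition mcube (N : nat) : seq midx :=
  [seq [ffun i => val (k i)] | k : {ffun 'I_d -> 'I_N}].

Lemma big_mcube (F : midx -> R) N :
  \sum_(k : {ffun 'I_d -> 'I_N}) F [ffun i => val (k i)] =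
  \sum_(k <- mcube N) F k.
Proof. by rewrite /mcube big_map big_enum. Qed.

Lemma mem_mcube N k : (k \in mcube N) = [forall i, (k i < N)%N].
Proof.
apply/mapP/forallP => [[k' _ ->] i|kN]; first by rewrite ffunE; exact: ltn_ord.
exists [ffun i => Ordinal (kN i)]; first by rewrite mem_enum.
by apply/ffunP => i; rewrite !ffunE.
Qed.

Lemma uniq_mcube N : uniq (mcube N).
Proof.
rewrite map_inj_uniq ?enum_uniq // => k k' /ffunP kk'.
by apply/ffunP => i; apply/val_inj; have := kk' i; rewrite !ffunE.
Qed.

Lemma le_big_mcube (F : midx -> R) : (forall k, 0 <= F k) ->
  {homo (fun N => \sum_(k <- mcube N) F k) : N M / (N <= M)%N >-> N <= M}.
Proof.
move=> F0 N M NM.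
have E : perm_eq (mcube N) [seq k <- mcube M | k \in mcube N].
  apply: uniq_perm; rewrite ?filter_uniq ?uniq_mcube // => k.
  rewrite mem_filter; case kN: (k \in mcube N) => //=.
  move: kN; rewrite !mem_mcube => /forallP kN; apply/esym/forallP => i.
  exact: leq_trans (kN i) NM.
rewrite (perm_big _ E) big_filter [leRHS](bigID (fun k => k \in mcube N)) /= lerDl.
by apply: sumr_ge0 => k _; exact: F0.
Qed.

Lemma mdeg_mcube N k : k \in mcube N -> (mdeg k <= d * N)%N.
Proof.
rewrite mem_mcube => /forallP kN; rewrite /mdeg -[X in (_ <= X * N)%N]card_ord.
by rewrite -sum_nat_const; apply: leq_sum => i _; exact: ltnW.
Qed.

Lemma mcube_mdeg N k : (mdeg k < N)%N -> k \in mcube N.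
Proof.
move=> kN; rewrite mem_mcube; apply/forallP => i; apply: leq_ltn_trans kN.
by rewrite /mdeg (bigD1 i) //= leq_addr.
Qed.

Lemma norm_monom k h r : `|h| <= r -> `|monom k h| <= r ^+ mdeg k.
Proof.
move=> hr; rewrite /monom normr_prod /mdeg -prodrXr.
apply: ler_prod => i _; rewrite normrX exprn_ge0 //= lerXn2r ?nnegrE //.
  exact: le_trans hr.
apply: le_trans hr; rewrite [leRHS]/Num.Def.normr/= mx_normrE.
exact: (le_bigmax _ (fun i : 'I_1 * 'I_d => `|h i.1 i.2|) (0, i)).
Qed.

Lemma majorant_ge0 s r : 0 <= r -> 0 <= majorant s r.
Proof.
by move=> r0; apply: sumr_ge0 => t _; rewrite mulr_ge0 // exprn_ge0.
Qed.

(** Each term of [s] has exactly one exponent, so it is counted once if that exponent lies in the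
    cube and never otherwise. *)
Lemma exchange_mcube s N (G : R * midx -> R) :
  \sum_(k <- mcube N) \sum_(t <- s | t.2 == k) G t =
  \sum_(t <- s | t.2 \in mcube N) G t.
Proof.
rewrite (exchange_big_dep xpredT) //= [RHS]big_mkcond; apply: eq_bigr => t _.
under eq_bigl do rewrite eq_sym.
rewrite big_const_seq (count_uniq_mem t.2 (uniq_mcube N)).
by case: (t.2 \in _) => //=; rewrite addr0.
Qed.

(* The polynomials L m have lowest degrees tending to infinity, so each
   coefficient of the sum of the series is a finite sum; as their degrees are
   finite, a cube of exponents contains all terms of the first few L m. *)
Lemma real_analytic_series (f : 'rV[R]_d -> R) (a : 'rV[R]_d)
    (L : nat -> seq (R * midx)) (r C : R) (D : nat) : 0 < r ->
  (forall m t, t \in L m -> (m <= mdeg t.2 <= D * m.+1)%N) ->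
  (forall m, majorant (L m) r <= C * 2^-1 ^+ m) ->
  (forall y, `|y - a| < r ->
     \sum_(m < K) monsum (L m) (y - a) @[K --> \oo] --> f y) ->
  real_analytic_at f a.
Proof.
move=> r0 Ldeg Lmaj Lf.
(* The sum stops at [mdeg k] because [L m] contains no exponent of degree below [m]. *)
pose c k := \sum_(m < (mdeg k).+1) \sum_(t <- L m | t.2 == k) t.1.
have C0 : 0 <= C.
  by have := Lmaj 0; rewrite expr0 mulr1; apply: le_trans; apply/majorant_ge0/ltW.
exists c, r; split => // y yr /=.
set h := y - a.
have hr : `|h| <= r by exact: ltW.
have termE k : c k * \prod_(i < d) (y 0 i - a 0 i) ^+ k i = c k * monom k h.
  by congr (_ * _); apply: eq_bigr => i _; rewrite !mxE.
(* Degrees in the cube are at most [d * N]. The summand [N] gives [K N <= B N] further down, also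
   for [d = 0]. *)
pose B N := (d * N + N).+1.
have cE N k : k \in mcube N ->
    c k = \sum_(m < B N) \sum_(t <- L m | t.2 == k) t.1.
  move=> /mdeg_mcube kN; rewrite /c.
  rewrite -!(big_mkord xpredT (fun m => \sum_(t <- L m | t.2 == k) t.1)).
  rewrite [RHS](@big_cat_nat _ _ _ (mdeg k).+1) //=; last first.
    by rewrite /B ltnS (leq_trans kN) // leq_addr.
  rewrite [X in _ = _ + X]big_nat_cond [X in _ = _ + X]big1 ?addr0 // => m.
  rewrite andbT => /andP[km _]; rewrite big_seq_cond big1 // => t /andP[tL /eqP tk].
  by have /andP[] := Ldeg _ _ tL; rewrite tk leqNgt km.
have majE m (P : pred (R * midx)) :
    \sum_(t <- L m | P t) `|t.1| * `|monom t.2 h| <= C * 2^-1 ^+ m.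
  apply: le_trans (Lmaj m); rewrite /majorant [leRHS](bigID P) /=.
  rewrite -[leLHS]addr0 lerD //.
    by apply: ler_sum => t _; rewrite ler_wpM2l // norm_monom.
  by apply: sumr_ge0 => t _; rewrite mulr_ge0 // exprn_ge0 // ltW.
have geo (K M : nat) : \sum_(K <= m < M) C * 2^-1 ^+ m <= C * 2 * 2^-1 ^+ K.
  have [MK|KM] := leqP M K.
    by rewrite big_geq // !mulr_ge0 // exprn_ge0.
  suff -> : \sum_(K <= m < M) C * 2^-1 ^+ m = C * 2 * (2^-1 ^+ K - 2^-1 ^+ M).
    rewrite ler_wpM2l ?mulr_ge0 // lerBlDr lerDl exprn_ge0 //.
  rewrite -(subnKC (ltnW KM)); elim: (M - K)%N => [|n IH].
    by rewrite addn0 big_geq // subrr mulr0.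
  by rewrite addnS big_nat_recr ?leq_addr //= IH exprS; field.
split.
  under eq_fun do under eq_bigr do rewrite termE.
  under eq_fun do rewrite (big_mcube (fun k => `|c k * monom k h|)).
  apply: nondecreasing_is_cvgn; first exact: le_big_mcube.
  (* The absolute partial sums are dominated by the majorants of the [L m], whose geometric bounds
     add up to at most [C * 2]. *)
  exists (C * 2) => _ [N _ <-].
  apply: (@le_trans _ _ (\sum_(k <- mcube N) \sum_(m < B N)
      \sum_(t <- L m | t.2 == k) `|t.1| * `|monom t.2 h|)).
    rewrite !big_seq; apply: ler_sum => k kN.
    rewrite (cE _ _ kN) normrM.
    rewrite [leRHS](eq_bigr (fun m : 'I_(B N) =>
      (\sum_(t <- L m | t.2 == k) `|t.1|) * `|monom k h|)); last first.
      by move=> m _; rewrite big_distrl; apply: eq_bigr => t /eqP ->.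
    rewrite -big_distrl /= ler_wpM2r //.
    apply: le_trans (ler_norm_sum _ _ _) _; apply: ler_sum => m _.
    exact: ler_norm_sum.
  rewrite exchange_big /=.
  under eq_bigr do rewrite exchange_mcube.
  apply: le_trans (_ : \sum_(0 <= m < B N) C * 2^-1 ^+ m <= _).
    by rewrite big_mkord; apply: ler_sum => m _; exact: majE.
  by have := geo 0 (B N); rewrite expr0 mulr1.
have partE N : \sum_(k : {ffun 'I_d -> 'I_N})
      c [ffun i => val (k i)] *
      \prod_(i < d) (y 0 i - a 0 i) ^+ [ffun i => val (k i)] i =
    \sum_(m < B N) \sum_(t <- L m | t.2 \in mcube N) t.1 * monom t.2 h.
  under eq_bigr do rewrite termE.
  rewrite (big_mcube (fun k => c k * monom k h)).
  under [RHS]eq_bigr do rewrite -exchange_mcube.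
  rewrite [RHS]exchange_big /= !big_seq; apply: eq_bigr => k kN.
  rewrite (cE _ _ kN) big_distrl /=; apply: eq_bigr => m _.
  by rewrite big_distrl; apply: eq_bigr => t /eqP ->.
under eq_fun do rewrite partE.
have Ly := Lf y yr; rewrite -/h in Ly.
(* For [m < K N] the degrees in [L m] are at most [D * K N <= N.-1], so the cube contains all its
   exponents. The divisor is [D.+1] since [D] may be 0. *)
pose K N := ((N.-1) %/ D.+1)%N.
have Koo : K N @[N --> \oo] --> \oo.
  apply/cvgnyPge => A; near=> N; rewrite /K leq_divRL //.
  have AN : (A * D.+1 < N)%N by near: N; exact: nbhs_infty_gt.
  by rewrite -ltnS prednK // (leq_ltn_trans _ AN).
have {}Ly : \sum_(m < K N) monsum (L m) h @[N --> \oo] --> f y.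
  exact: (cvg_comp _ _ Koo Ly).
have K0 : C * 2 * 2^-1 ^+ K N @[N --> \oo] --> 0.
  rewrite -[X in _ --> X](mulr0 (C * 2)); apply: cvgMl_tmp.
  have /(cvg_comp _ _ Koo) : (2^-1 : R) ^+ N @[N --> \oo] --> 0.
    by apply: cvg_expr; rewrite ger0_norm // invf_lt1 // ltr1n.
  exact.
pose S N := \sum_(m < B N) \sum_(t <- L m | t.2 \in mcube N) t.1 * monom t.2 h.
rewrite -/S.
pose T N := \sum_(m < K N) monsum (L m) h.
(* The two sums agree on the first [K N] polynomials, and the rest of [S N] is bounded by the tail
   of a geometric series. *)
suff ST : (fun N => S N - T N) @ \oo --> 0.
  have : (fun N => (S N - T N) + T N) @ \oo --> 0 + f y by exact: cvgD ST Ly.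
  by rewrite add0r; under eq_fun do rewrite subrK.
apply/norm_cvg0P.
apply: (@squeeze_cvgr _ _ _ _ (cst 0) (fun N => C * 2 * 2^-1 ^+ K N)) => //; last first.
  exact: cvg_cst.
near=> N; rewrite normr_ge0 /=.
have N0 : (0 < N)%N by near: N; exact: nbhs_infty_gt.
have KB : (K N <= B N)%N.
  rewrite /K /B (leq_trans (leq_div _ _)) // (leq_trans (leq_pred _)) //.
  by rewrite leqW // leq_addl.
rewrite /S /T -(big_mkord xpredT (fun m => \sum_(t <- L m | _) _)).
rewrite -(big_mkord xpredT (fun m => monsum (L m) h)).
rewrite (@big_cat_nat _ _ _ (K N)) //= addrAC -sumrB [X in `|X + _|]big_nat_cond.
rewrite [X in `|X + _|]big1 ?add0r.
  apply: le_trans (geo (K N) (B N)); apply: le_trans (ler_norm_sum _ _ _) _.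
  apply: ler_sum => m _; apply: le_trans (ler_norm_sum _ _ _) _.
  by under eq_bigr do rewrite normrM; exact: majE.
move=> m; rewrite andbT => /andP[_ mK].
apply/eqP; rewrite subr_eq0; apply/eqP; rewrite /monsum [RHS]big_seq.
rewrite [LHS]big_seq_cond; apply: eq_bigl => t; case tL: (t \in L m) => //=.
apply: mcube_mdeg; have /andP[_] := Ldeg _ _ tL; move=> /leq_ltn_trans; apply.
have : (D * m.+1 <= D * K N)%N by rewrite leq_mul2l mK orbT.
move=> /leq_ltn_trans; apply; rewrite -(prednK N0) ltnS.
apply: leq_trans (leq_divM N.-1 D.+1); rewrite mulnC leq_mul2l leqnSn orbT.
Unshelve. all: by end_near. Qed.

End power_series.

Section polynomial_functions.
Variables (R : realType) (d : nat).
Local Notation midx := {ffun 'I_d -> nat}.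
Implicit Types (s : seq (R * midx)) (k : midx) (h a : 'rV[R]_d).

Definition madd k k' : midx := [ffun i => (k i + k' i)%N].

Definition mprod s s' : seq (R * midx) :=
  [seq (t.1 * t'.1, madd t.2 t'.2) | t <- s, t' <- s'].

Definition midx0 : midx := [ffun=> 0%N].

Definition mpow s n := iter n (mprod s) [:: (1, midx0)].

Lemma monom_madd k k' h : monom (madd k k') h = monom k h * monom k' h.
Proof.
by rewrite /monom -big_split; apply: eq_bigr => i _; rewrite ffunE exprD.
Qed.

Lemma mdeg_madd k k' : mdeg (madd k k') = (mdeg k + mdeg k')%N.
Proof. by rewrite /mdeg -big_split; apply: eq_bigr => i _; rewrite ffunE. Qed.

Lemma monom0 h : monom midx0 h = 1.
Proof. by rewrite /monom big1 // => i _; rewrite ffunE expr0. Qed.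

Lemma mdeg0 : mdeg midx0 = 0%N.
Proof. by rewrite /mdeg big1 // => i _; rewrite ffunE. Qed.

Lemma monsum_mprod s s' h : monsum (mprod s s') h = monsum s h * monsum s' h.
Proof.
rewrite /monsum big_allpairs_dep big_distrl; apply: eq_bigr => t _.
rewrite big_distrr; apply: eq_bigr => t' _ /=.
by rewrite monom_madd mulrACA.
Qed.

Lemma majorant_mprod s s' r :
  majorant (mprod s s') r = majorant s r * majorant s' r.
Proof.
rewrite /majorant big_allpairs_dep big_distrl; apply: eq_bigr => t _.
rewrite big_distrr; apply: eq_bigr => t' _ /=.
by rewrite mdeg_madd exprD normrM mulrACA.
Qed.

Lemma monsum_mpow s n h : monsum (mpow s n) h = monsum s h ^+ n.
Proof.
elim: n => [|n IH] /=; last by rewrite monsum_mprod IH exprS.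
by rewrite /monsum big_seq1 monom0 mulr1.
Qed.

Lemma majorant_mpow s n r : majorant (mpow s n) r = majorant s r ^+ n.
Proof.
elim: n => [|n IH] /=; last by rewrite majorant_mprod IH exprS.
by rewrite /majorant big_seq1 mdeg0 normr1 mulr1.
Qed.

Lemma mdeg_mpow s D n t : (forall t, t \in s -> (1 <= mdeg t.2 <= D)%N) ->
  t \in mpow s n -> (n <= mdeg t.2 <= D * n)%N.
Proof.
move=> sD; elim: n t => [|n IH] t /=.
  by rewrite inE => /eqP ->; rewrite mdeg0.
move=> /allpairsPdep[t1 [t2 [/sD /andP[t1l t1u] /IH/andP[t2l t2u] ->]]] /=.
by rewrite mdeg_madd mulnS -add1n !leq_add.
Qed.

(** The polynomial is written in powers of [y - a] because [a] is the point at which a power series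
    is sought. *)
Definition polyf a (f : 'rV[R]_d -> R) := exists s, forall y, f y = monsum s (y - a).

Lemma polyf_cst a c : polyf a (fun=> c).
Proof. by exists [:: (c, midx0)] => y; rewrite /monsum big_seq1 monom0 mulr1. Qed.

Lemma polyf_add a f g : polyf a f -> polyf a g -> polyf a (fun y => f y + g y).
Proof.
by move=> [s fE] [s' gE]; exists (s ++ s') => y; rewrite fE gE /monsum big_cat.
Qed.

Lemma polyf_mul a f g : polyf a f -> polyf a g -> polyf a (fun y => f y * g y).
Proof.
by move=> [s fE] [s' gE]; exists (mprod s s') => y; rewrite fE gE monsum_mprod.
Qed.

Lemma polyf_coord a i : polyf a (fun y => y 0 i).
Proof.
exists [:: (a 0 i, midx0); (1, [ffun j => nat_of_bool (j == i)])] => y.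
rewrite /monsum big_cons big_seq1 monom0 mulr1 mul1r /= /monom (bigD1 i) //=.
rewrite big1 => [|j /negbTE ji]; last by rewrite ffunE ji expr0.
by rewrite ffunE eqxx mulr1 !mxE; ring.
Qed.

Lemma polyf_sum a (I : Type) (r : seq I) (P : pred I) (F : I -> 'rV[R]_d -> R) :
  (forall i, polyf a (F i)) -> polyf a (fun u => \sum_(i <- r | P i) F i u).
Proof.
move=> pF; elim: r => [|i r IH].
  by under eq_fun do rewrite big_nil; exact: polyf_cst.
under eq_fun do rewrite big_cons; case: (P i) => //; exact: polyf_add.
Qed.

Lemma mdeg_bound s : exists D, forall t, t \in s -> (mdeg t.2 <= D)%N.
Proof.
exists (\sum_(t <- s) mdeg t.2)%N => t ts.
by rewrite (big_rem t) //= leq_addr.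
Qed.

Lemma polyf_analytic a f : polyf a f -> real_analytic_at f a.
Proof.
move=> [s fE]; have [D sD] := mdeg_bound s.
apply: (@real_analytic_series _ _ f a
  (fun m => if m is 0%N then s else [::]) 1 (majorant s 1) D) => //.
- by case=> //= t ts; rewrite muln1 sD.
- move=> [|m]; rewrite ?expr0 ?mulr1 // /majorant big_nil.
  by rewrite mulr_ge0 ?exprn_ge0 ?majorant_ge0.
- move=> y _; rewrite fE; apply: cvg_near_cst; near=> K.
  have : (0 < K)%N by near: K; exact: nbhs_infty_gt.
  case: (K) => // K' _; rewrite big_ord_recl big1 ?addr0 // => i _.
  by rewrite /monsum big_nil.
Unshelve. all: by end_near. Qed.

Lemma norm_monsum s h r : `|h| <= r -> `|monsum s h| <= majorant s r.
Proof.
move=> hr; apply: le_trans (ler_norm_sum _ _ _) _; apply: ler_sum => t _.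
by rewrite normrM ler_wpM2l // norm_monom.
Qed.

(** Geometric series: 1/f is 1/f(a) times the sum of the powers [p ^ m]. As [p] has no constant
    term, [p ^ m] starts in degree [m], as [real_analytic_series] demands. *)
Lemma polyf_inv_analytic a f : polyf a f -> f a != 0 ->
  real_analytic_at (fun y => (f y)^-1) a.
Proof.
move=> [s fE] fa; have [D sD] := mdeg_bound s.
(* f (a + h) = f a (1 - p h) with p lacking a constant term *)
pose p := [seq (- (f a)^-1 * t.1, t.2) | t <- s & (0 < mdeg t.2)%N].
have pE y : f y = f a * (1 - monsum p (y - a)).
  rewrite /monsum big_map big_filter.
  under eq_bigr do rewrite /= -mulrA.
  rewrite -big_distrr /= mulNr opprK mulrDr mulr1 mulVKf //.
  rewrite !fE subrr /monsum (bigID (fun t => (0 < mdeg t.2)%N)) /= addrC.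
  congr (_ + _); rewrite [RHS](bigID (fun t => (0 < mdeg t.2)%N)) /= [X in _ = X + _]big1 ?add0r.
    apply: eq_bigr => t; rewrite -eqn0Ngt /mdeg sum_nat_eq0 => /forallP /= t0.
    congr (_ * _); rewrite /monom !big1 // => i _.
      by have /eqP -> := t0 i; rewrite expr0.
    by have /eqP -> := t0 i; rewrite expr0.
  move=> t; rewrite lt0n sum_nat_eq0 negb_forall => /existsP[i ti].
  have {}ti : t.2 i != 0%N by move: ti; rewrite implyTb.
  by rewrite /monom (bigD1 i) //= mxE expr0n (negbTE ti) mul0r mulr0.
have pD t : t \in p -> (1 <= mdeg t.2 <= D)%N.
  by move=> /mapP[t']; rewrite mem_filter => /andP[t0 /sD tD] -> /=; rewrite t0.
pose M := majorant p 1; have M0 : 0 <= M by exact: majorant_ge0.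
(* All terms of [p] have degree at least 1 and [r <= 1], so [majorant p r <= M * r <= 2^-1]. *)
pose r : R := (2 * (M + 1))^-1.
have r0 : 0 < r by rewrite invr_gt0 mulr_gt0 // ltr_wpDl.
have r1 : r <= 1.
  by rewrite invf_le1 ?mulr_gt0 ?ltr_wpDl //; lra.
have pr : majorant p r <= 2^-1.
  apply: (@le_trans _ _ (M * r)).
    rewrite /M /majorant big_distrl !big_seq; apply: ler_sum => t /pD /andP[t1 _].
    rewrite expr1n mulr1 ler_wpM2l // -{2}(expr1 r).
    by apply: ler_wiXn2l => //; exact: ltW.
  rewrite /r ler_pdivrMr ?mulr_gt0 ?ltr_wpDl //; lra.
have fV : (f a)^-1 != 0 by rewrite invr_eq0.
pose L m := [seq ((f a)^-1 * t.1, t.2) | t <- mpow p m].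
have LE m h : monsum (L m) h = (f a)^-1 * monsum p h ^+ m.
  rewrite -monsum_mpow /monsum big_map big_distrr /=.
  by apply: eq_bigr => t _; rewrite mulrA.
apply: (@real_analytic_series _ _ _ a L r `|(f a)^-1| D) => //.
- move=> m t /mapP[t' /(mdeg_mpow pD)/andP[t1 t2] ->] /=.
  by rewrite t1 (leq_trans t2) // leq_mul2l leqnSn orbT.
- move=> m; rewrite /majorant big_map.
  under eq_bigr do rewrite /= normrM -mulrA.
  rewrite -big_distrr /= ler_wpM2l // -/(majorant _ _) majorant_mpow.
  by rewrite lerXn2r ?nnegrE ?majorant_ge0 // ltW.
move=> y ya; rewrite pE invfM; set z := monsum p (y - a).
under eq_fun do under eq_bigr do rewrite LE.
under eq_fun do rewrite -big_distrr /=.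
apply: cvgMl_tmp; have z1 : `|z| < 1.
  apply: le_lt_trans (norm_monsum _ (ltW ya)) _; apply: le_lt_trans pr _.
  by rewrite invf_lt1 // ltr1n.
have := @cvg_geometric_series R 1 z z1.
rewrite mul1r; apply: cvg_trans; apply: near_eq_cvg; near=> K.
rewrite /series /= big_mkord; apply: eq_bigr => i _; rewrite /geometric /=.
by rewrite mul1r.
Unshelve. all: by end_near. Qed.

End polynomial_functions.

(** * Subspaces, and charts onto the whole coordinate space *)

Section set_type_topology.
Variables (X : topologicalType) (A : set X).

Lemma set_val_continuous : continuous (set_val : A -> X).
Proof. exact: initial_continuous. Qed.

Lemma continuous_set_val (T : topologicalType) (f : T -> A) (x : T) :
  {for x, continuous (fun t => set_val (f t))} -> {for x, continuous f}.
Proof.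
move=> cf U [_ [[W oW <-] Wfx WU]]; apply: filterS WU _.
by apply: cf; apply: open_nbhs_nbhs.
Qed.

Lemma set_type_compact : compact A -> compact [set: A].
Proof.
move=> cA F PF _; have GA : (set_val @ F) A.
  by rewrite /fmap /=; apply: filterS filterT => x _; exact: set_valP.
have [x [Ax clx]] := cA (set_val @ F) _ GA.
exists (exist _ x (mem_set Ax) : A); split => // P N FP [_ [[W oW <-] Wx WN]].
have GP : (set_val @ F) (set_val @` P).
  by rewrite /fmap /=; apply: filterS FP => p Pp; exists p.
have [_ [[p Pp <-] Wp]] := clx _ W GP (open_nbhs_nbhs (conj oW Wx)).
by exists p; split => //; exact: WN.
Qed.

Lemma set_type_hausdorff : hausdorff_space X -> hausdorff_space A.
Proof.
move=> hX x y clxy; apply/val_inj; apply: hX => U V Ux Vy.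
have [z [Uz Vz]] := clxy _ _ (set_val_continuous Ux) (set_val_continuous Vy).
by exists (set_val z).
Qed.

End set_type_topology.

Section full_charts.
Variable R : realType.

(** The charts of the sphere and of the group are homeomorphisms onto the whole coordinate space.
    This turns [local_dom] into a plain preimage under [cinv], open for every continuous map, and
    spares all questions about boundaries of images. *)
Definition full_chart (T : topologicalType) d (c : chart R T d) : Prop :=
  [/\ open (cdom c), forall u, cdom c (cinv c u) /\ cmap c (cinv c u) = u,
      forall x, cdom c x -> cinv c (cmap c x) = x,
      {in cdom c, continuous (cmap c)} & continuous (cinv c)].

Lemma full_chart_cimg (T : topologicalType) d (c : chart R T d) :
  full_chart c -> cimg c = setT.
Proof.
move=> [_ ck _ _ _]; apply/seteqP; split => // u _.
by have [cu uE] := ck u; exists (cinv c u).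
Qed.

Lemma full_chart_is_chart (T : topologicalType) d (c : chart R T d) :
  full_chart c -> is_chart c.
Proof.
move=> fc; have [oc ck kc cc ci] := fc; split => //.
- by rewrite (full_chart_cimg fc); exact: openT.
- by rewrite continuous_open_subspace.
- exact: continuous_subspaceT.
Qed.

Lemma full_local_dom (M N : charted R) (f : M -> N) c c' : full_chart c ->
  local_dom f c c' = [set u | cdom c' (f (cinv c u))].
Proof.
move=> [oc ck kc cc ci]; apply/seteqP; split => [_ [x [cx fx] <-]|u /= fu].
  by rewrite /= kc.
by have [cu uE] := ck u; exists (cinv c u).
Qed.

Lemma open_full_local_dom (M N : charted R) (f : M -> N) c c' :
  full_chart c -> full_chart c' -> continuous f -> open (local_dom f c c').
Proof.
move=> fc [oc' _ _ _ _] cf; rewrite (full_local_dom _ _ fc).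
apply: open_comp oc' => u _; apply: continuous_comp; last exact: cf.
by have [_ _ _ _] := fc; apply.
Qed.

Lemma full_smooth_map (M N : charted R) (f : M -> N) : continuous f ->
  (forall c, @atlas R M c -> full_chart c) ->
  (forall c, @atlas R N c -> full_chart c) ->
  (forall c c', atlas c -> atlas c' ->
     rat_mx (local_dom f c c') (local_rep f c c')) ->
  smooth_map f.
Proof.
move=> cf aM aN rf; split => // c c' ac ac'.
by apply: rat_mx_smooth; [apply: open_full_local_dom; auto|exact: rf].
Qed.

Lemma full_chart_prod (T1 T2 : topologicalType) d1 d2 (c1 : chart R T1 d1)
    (c2 : chart R T2 d2) :
  full_chart c1 -> full_chart c2 -> full_chart (prod_chart c1 c2).
Proof.
move=> [oc1 k1 v1 m1 i1] [oc2 k2 v2 m2 i2]; split => /=.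
- rewrite (_ : _ `*` _ = fst @^-1` cdom c1 `&` snd @^-1` cdom c2) //.
  by apply: openI; apply: open_comp => // -[x y] _; [exact: cvg_fst|exact: cvg_snd].
- move=> u; have [? E1] := k1 (lsubmx u); have [? E2] := k2 (rsubmx u).
  by split => //; rewrite E1 E2 hsubmxK.
- by move=> [x y] [/= cx cy]; rewrite row_mxKl row_mxKr v1 // v2.
- move=> [x y] xy; have [/= /mem_set cx /mem_set cy] := set_mem xy.
  apply: (@cvg_mx _ _ _ _ (nbhs (x, y)) _) => i j /=.
  case: (splitP j) => k jk.
  + have -> : j = lshift d2 k by apply/val_inj.
    under eq_fun do rewrite row_mxEl; rewrite row_mxEl.
    have : {for x, continuous (fun p => cmap c1 p i k)}.
      exact: continuous_comp (m1 _ cx) (@coord_continuous R 1 d1 i k _).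
    by move=> /(cvg_comp (@fst T1 T2) _ (@cvg_fst _ _ (nbhs x) (nbhs y) _)); exact.
  + have -> : j = rshift d1 k by apply/val_inj.
    under eq_fun do rewrite row_mxEr; rewrite row_mxEr.
    have : {for y, continuous (fun p => cmap c2 p i k)}.
      exact: continuous_comp (m2 _ cy) (@coord_continuous R 1 d2 i k _).
    by move=> /(cvg_comp (@snd T1 T2) _ (@cvg_snd _ _ (nbhs x) (nbhs y) _)); exact.
- have lc : continuous (fun u : 'rV[R]_(d1 + d2) => lsubmx u).
    by move=> u; apply: rat_mx_continuous openT (rat_lsubmx (rat_mx_id _)) I.
  have rc : continuous (fun u : 'rV[R]_(d1 + d2) => rsubmx u).
    by move=> u; apply: rat_mx_continuous openT (rat_rsubmx (rat_mx_id _)) I.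
  move=> u; apply: (cvg_pair (F := nbhs u)) => /=.
    exact: (cvg_comp _ _ (lc u) (i1 (lsubmx u))).
  exact: (cvg_comp _ _ (rc u) (i2 (rsubmx u))).
Qed.

End full_charts.

(** * The orthogonal transformations commuting with a matrix, as a Lie group *)

Ltac mxring := let i := fresh in let j := fresh in
  apply/matrixP => i j; rewrite !mxE; ring.

Section cayley.
Variables (R : realType) (m : nat).
Implicit Types A B S D : 'M[R]_m.

Lemma mulmx_tr_eq0 (x : 'rV[R]_m) : x *m x^T = 0 -> x = 0.
Proof.
move=> /matrixP/(_ 0 0); rewrite !mxE => /eqP.
rewrite psumr_eq0 => [/allP xx|i _]; last by rewrite mxE -expr2 sqr_ge0.
apply/rowP => i; have := xx i (mem_index_enum i).
by rewrite !mxE mulf_eq0 orbb => /eqP.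
Qed.

(** A row [x] of the kernel satisfies [x = - x *m S], hence [x *m x^T = - x *m S *m x^T], and the
    right-hand side is 0 by skewness. *)
Lemma unitmx_1Dskew S : S^T = - S -> 1%:M + S \in unitmx.
Proof.
move=> Sskew; rewrite -row_free_unit -kermx_eq0; apply/eqP/row_matrixP => i.
rewrite row0; set x := row i _; apply: mulmx_tr_eq0.
have /eqP : x *m (1%:M + S) = 0 by rewrite -row_mul mulmx_ker row0.
rewrite mulmxDr mulmx1 addr_eq0 => /eqP xS.
have ss : x *m S *m x^T = - (x *m S *m x^T).
  have {1}-> : x *m S *m x^T = (x *m S *m x^T)^T.
    by apply/matrixP => a b; rewrite !ord1 [in RHS]mxE.
  by rewrite !trmx_mul trmxK Sskew mulNmx mulmxN mulmxA.
rewrite {1}xS mulNmx; apply/eqP; rewrite oppr_eq0.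
move/eqP: ss; rewrite -addr_eq0 -mulr2n -scaler_nat scaler_eq0.
by rewrite pnatr_eq0.
Qed.

Lemma mulmx_1DB S : (1%:M + S) *m (1%:M - S) = (1%:M - S) *m (1%:M + S).
Proof. by rewrite !(mulmxDl, mulmxDr, mulmxN, mulNmx, mul1mx, mulmx1); mxring. Qed.

(** The Cayley transform: an involution exchanging skew matrices with orthogonal matrices that do
    not have the eigenvalue -1. Unlike the exponential it is rational with a rational inverse, and
    it is defined on the whole space of skew matrices. *)
Definition cay S : 'M[R]_m := (1%:M - S) *m invmx (1%:M + S).

Lemma unitmx_comm_inv A B : A \in unitmx -> A *m B = B *m A ->
  invmx A *m B = B *m invmx A.
Proof. by move=> uA AB; apply: (canLR (mulKmx uA)); rewrite mulmxA AB mulmxK. Qed.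

Lemma cay_comm D S : 1%:M + S \in unitmx -> S *m D = D *m S ->
  cay S *m D = D *m cay S.
Proof.
move=> uS SD; rewrite /cay -mulmxA unitmx_comm_inv //; last first.
  by rewrite mulmxDl mulmxDr SD mul1mx mulmx1.
by rewrite !mulmxA mulmxBl mulmxBr SD mul1mx mulmx1.
Qed.

Lemma add1_cay S : 1%:M + S \in unitmx -> 1%:M + cay S = 2 *: invmx (1%:M + S).
Proof.
move=> uS; rewrite -{1}(mulmxV uS) /cay -mulmxDl addrACA subrr addr0.
by rewrite -mulr2n -scaler_nat -scalemxAl mul1mx.
Qed.

Lemma sub1_cay S : 1%:M + S \in unitmx ->
  1%:M - cay S = 2 *: (S *m invmx (1%:M + S)).
Proof.
move=> uS; rewrite -{1}(mulmxV uS) /cay -mulmxBl opprB addrC addrA subrK.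
by rewrite -mulr2n -scaler_nat -scalemxAl.
Qed.

Lemma unitmx_add1_cay S : 1%:M + S \in unitmx -> 1%:M + cay S \in unitmx.
Proof.
by move=> uS; rewrite add1_cay // unitmxZ ?unitmx_inv // unitfE pnatr_eq0.
Qed.

Lemma cayK S : 1%:M + S \in unitmx -> cay (cay S) = S.
Proof.
move=> uS; rewrite {1}/cay sub1_cay // add1_cay // invmxZ ?unitmx_inv //; last first.
  by rewrite unitmxZ ?unitmx_inv // unitfE pnatr_eq0.
rewrite invmxK -scalemxAl -scalemxAr scalerA mulmxKV //.
by rewrite mulfV ?pnatr_eq0 // scale1r.
Qed.

Lemma cay_orthogonal S : S^T = - S -> cay S *m (cay S)^T = 1%:M.
Proof.
move=> Sskew; have uS := unitmx_1Dskew Sskew.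
have uS' : 1%:M - S \in unitmx.
  by rewrite -Sskew -unitmx_tr linearD /= trmx1 trmxK.
have tD : (1%:M + S)^T = 1%:M - S by rewrite linearD /= trmx1 Sskew.
have tB : (1%:M - S)^T = 1%:M + S by rewrite linearB /= trmx1 Sskew opprK.
rewrite /cay trmx_mul trmx_inv tD tB.
have c := mulmx_1DB S.
rewrite mulmxA -(mulmxA _ (invmx (1%:M + S))).
rewrite (unitmx_comm_inv uS (esym (unitmx_comm_inv uS' (esym c)))).
by rewrite mulKVmx // mulVmx.
Qed.

Lemma cay_skew B : B *m B^T = 1%:M -> 1%:M + B \in unitmx ->
  (cay B)^T = - cay B.
Proof.
move=> BB uB; have BB' := mulmx1C BB.
have uB' : 1%:M + B^T \in unitmx by rewrite -unitmx_tr linearD /= trmx1 trmxK.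
have c := mulmx_1DB B.
have -> : cay B = invmx (1%:M + B) *m (1%:M - B).
  by rewrite /cay -unitmx_comm_inv.
have tD : (1%:M + B)^T = 1%:M + B^T by rewrite linearD /= trmx1.
have tB : (1%:M - B)^T = 1%:M - B^T by rewrite linearB /= trmx1.
rewrite trmx_mul trmx_inv tD tB.
apply: (canLR (mulmxK uB')); rewrite mulNmx -mulmxA.
have e1 : (1%:M - B) *m (1%:M + B^T) = - (1%:M + B) *m (1%:M - B^T).
  by rewrite !(mulmxDl, mulmxDr, mulmxN, mulNmx, mul1mx, mulmx1) BB; mxring.
by rewrite e1 mulNmx mulmxN opprK mulKmx.
Qed.

End cayley.

Section matrix_domain.
Variables (R : realType) (p q : nat).

Lemma mxvec_continuous : continuous (@mxvec R p q).
Proof.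
move=> M; apply: (@cvg_mx _ _ _ _ (nbhs M) _) => i j.
case/mxvec_indexP: j => a b; rewrite (ord1 i) mxvecE.
under eq_fun do rewrite mxvecE.
exact: coord_continuous.
Qed.

Lemma rat_vec_mx U : rat_mx U (@vec_mx R p q).
Proof.
by move=> i j; apply: rat_ext (rat_coord _ (mxvec_index i j)) => u _; rewrite mxE.
Qed.

Lemma vec_mx_continuous : continuous (@vec_mx R p q).
Proof. by move=> u; apply: rat_mx_continuous openT (rat_vec_mx _) I. Qed.

(** [rat_on] speaks of functions of a row vector; flattening the matrix carries the continuity of
    rational maps over to matrix arguments. *)
Lemma rat_mx_continuous_at r s (G : 'M[R]_(p, q) -> 'M[R]_(r, s)) U B :
  open U -> rat_mx (vec_mx @^-1` U) (G \o vec_mx) -> U B -> {for B, continuous G}.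
Proof.
move=> oU rG UB; rewrite (_ : G = G \o vec_mx \o mxvec); last first.
  by apply/funext => M /=; rewrite mxvecK.
apply: continuous_comp; first exact: mxvec_continuous.
apply: (rat_mx_continuous _ rG); last by rewrite /= mxvecK.
by apply: open_comp oU => u _; exact: vec_mx_continuous.
Qed.

Lemma rat_continuous_at (f : 'M[R]_(p, q) -> R) U B :
  open U -> rat_on (vec_mx @^-1` U) (f \o vec_mx) -> U B -> {for B, continuous f}.
Proof.
move=> oU rG UB; rewrite (_ : f = f \o vec_mx \o mxvec); last first.
  by apply/funext => M /=; rewrite mxvecK.
apply: continuous_comp; first exact: mxvec_continuous.
apply: (rat_continuous _ rG); last by rewrite /= mxvecK.
by apply: open_comp oU => u _; exact: vec_mx_continuous.
Qed.

End matrix_domain.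

Section orthogonal_commutant.
Variables (R : realType) (m : nat) (D : 'M[R]_m).
Implicit Types A B S : 'M[R]_m.

(** For an orthogonal projection [D] of rank 2 this is O(2) x O(m - 2); the group that acts below is
    the case [D := polar_proj c]. *)
Definition ogroup : set 'M[R]_m :=
  [set A | A *m A^T = 1%:M /\ A *m D = D *m A].

(** The linearised equations of [ogroup] at the identity. The Lie algebra becomes the kernel of a
    linear map, and a basis of that kernel supplies the coordinates. *)
Definition lie_eq S : 'M[R]_(m, m + m) := row_mx (S^T + S) (S *m D - D *m S).

Fact lie_eq_linear : linear lie_eq.
Proof.
move=> a S T; rewrite /lie_eq scale_row_mx add_row_mx linearP /=.
congr row_mx; first by rewrite scalerDr addrACA.
by rewrite mulmxDl mulmxDr -scalemxAl -scalemxAr scalerBr opprD addrACA.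
Qed.

HB.instance Definition _ :=
  GRing.isLinear.Build R 'M[R]_m 'M[R]_(m, m + m) _ lie_eq lie_eq_linear.

Definition lie_alg : {vspace 'M[R]_m} := lker (linfun lie_eq).

Lemma lie_algP S : reflect (S^T = - S /\ S *m D = D *m S) (S \in lie_alg).
Proof.
rewrite memv_ker lfunE /= /lie_eq -(row_mx0 R m m m).
apply: (iffP eqP) => [/eq_row_mx[/eqP + /eqP]|[-> ->]].
  by rewrite addr_eq0 subr_eq0 => /eqP -> /eqP ->.
by rewrite addNr subrr.
Qed.

Local Notation k := (\dim lie_alg).

Definition lie_vec (v : 'rV[R]_k) : 'M[R]_m :=
  \sum_(i < k) v 0 i *: (vbasis lie_alg)`_i.

Definition lie_coord S : 'rV[R]_k := \row_i coord (vbasis lie_alg) i S.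

Lemma lie_vec_alg v : lie_vec v \in lie_alg.
Proof.
by apply: memv_suml => i _; rewrite memvZ // vbasis_mem // mem_nth ?size_tuple.
Qed.

Lemma lie_vecK v : lie_coord (lie_vec v) = v.
Proof.
apply/rowP => i; rewrite mxE /lie_vec coord_sum_free //.
exact: basis_free (vbasisP _).
Qed.

Lemma lie_coordK S : S \in lie_alg -> lie_vec (lie_coord S) = S.
Proof.
move=> /coord_vbasis {2}->; apply: eq_bigr => i _; by rewrite mxE.
Qed.

Lemma rat_lie_vec d (U : set 'rV[R]_d) F : rat_mx U F -> rat_mx U (fun u => lie_vec (F u)).
Proof.
move=> rF i j.
apply: rat_ext (@rat_sum _ _ U _ _ xpredT (fun l u => F u 0 l * (vbasis lie_alg)`_l i j) _).
  by move=> u _; rewrite summxE; apply: eq_bigr => l _; rewrite mxE.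
by move=> l; apply: rat_mul => //; exact: rat_cst.
Qed.

Lemma rat_lie_coord d (U : set 'rV[R]_d) F :
  rat_mx U F -> rat_mx U (fun u => lie_coord (F u)).
Proof.
move=> rF i j.
apply: rat_ext (@rat_sum _ _ U _ _ xpredT (fun a u => \sum_b
  F u a b * coord (vbasis lie_alg) j (delta_mx a b)) _).
  move=> u _; rewrite mxE [in RHS](matrix_sum_delta (F u)) linear_sum /=.
  apply: eq_bigr => a _; rewrite linear_sum /=; apply: eq_bigr => b _.
  by rewrite linearZ.
move=> a; apply: (@rat_sum _ _ U _ _ xpredT) => b.
by apply: rat_mul => //; exact: rat_cst.
Qed.

Lemma ogroup1 : ogroup 1%:M.
Proof. by split; rewrite ?trmx1 ?mulmx1 ?mul1mx. Qed.

Lemma ogroupM A B : ogroup A -> ogroup B -> ogroup (A *m B).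
Proof.
move=> [AA AD] [BB BD]; split.
  by rewrite trmx_mul mulmxA -(mulmxA A) BB mulmx1.
by rewrite -mulmxA BD !mulmxA AD.
Qed.

Lemma ogroupV A : ogroup A -> ogroup A^T.
Proof.
move=> [AA AD]; have AA' := mulmx1C AA; split; first by rewrite trmxK.
by rewrite -[LHS]mulmx1 -AA !mulmxA -(mulmxA A^T) -AD mulmxA AA' mul1mx.
Qed.

Lemma ogroup_cay S : S \in lie_alg -> ogroup (cay S).
Proof.
move=> /lie_algP[St SD]; split; first exact: cay_orthogonal.
by apply: cay_comm => //; exact: unitmx_1Dskew.
Qed.

Lemma cay_lie_alg B : ogroup B -> 1%:M + B \in unitmx -> cay B \in lie_alg.
Proof.
move=> [BB BD] uB; apply/lie_algP; split; first exact: cay_skew.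
exact: cay_comm.
Qed.

Lemma unit_lie_vec v : 1%:M + lie_vec v \in unitmx.
Proof. by have /lie_algP[vt _] := lie_vec_alg v; exact: unitmx_1Dskew. Qed.

Definition og_inv A (v : 'rV[R]_k) : 'M[R]_m := A *m cay (lie_vec v).

Lemma og_inv_in (A : ogroup) v : og_inv (\val A) v \in ogroup.
Proof.
apply/mem_set/ogroupM; last exact/ogroup_cay/lie_vec_alg.
exact/set_mem/valP.
Qed.

Definition og_coord A B : 'rV[R]_k := lie_coord (cay (A^T *m B)).

(** The Cayley parametrisation translated by [A]. Its domain consists of the [B] for which -1 is not
    an eigenvalue of [A^T *m B], so it is a neighbourhood of [A], and its image is the whole Lie
    algebra. *)
Definition og_chart (A : ogroup) : chart R ogroup k :=
  @Chart R ogroup k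
    [set B : ogroup | \det (1%:M + (\val A)^T *m \val B) != 0]
    (fun B : ogroup => og_coord (\val A) (\val B))
    (fun v => exist _ (og_inv (\val A) v) (og_inv_in A v)).

Lemma rat_cay d (U : set 'rV[R]_d) (F : _ -> 'M[R]_m) : rat_mx U F ->
  (forall u, U u -> 1%:M + F u \in unitmx) -> rat_mx U (fun u => cay (F u)).
Proof.
move=> rF uF; apply: rat_mx_mul.
  by apply: rat_mx_sub => //; exact: rat_mx_cst.
by apply: rat_mx_inv => //; apply: rat_mx_add => //; exact: rat_mx_cst.
Qed.

Lemma rat_og_inv d (U : set 'rV[R]_d) A (F : _ -> 'rV[R]_k) : rat_mx U F ->
  rat_mx U (fun u => og_inv A (F u)).
Proof.
move=> rF; apply: rat_mx_mul; first exact: rat_mx_cst.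
apply: rat_cay; first exact: rat_lie_vec.
by move=> u _; exact: unit_lie_vec.
Qed.

Lemma rat_og_coord d (U : set 'rV[R]_d) A (F : _ -> 'M[R]_m) : rat_mx U F ->
  (forall u, U u -> \det (1%:M + A^T *m F u) != 0) ->
  rat_mx U (fun u => og_coord A (F u)).
Proof.
move=> rF uF; apply: rat_lie_coord; apply: rat_cay.
  by apply: rat_mx_mul => //; exact: rat_mx_cst.
by move=> u /uF; rewrite unitmxE unitfE.
Qed.

Lemma og_val_continuous : continuous (fun A : ogroup => \val A : 'M[R]_m).
Proof. exact: set_val_continuous. Qed.

Lemma og_chart_full (A : ogroup) : full_chart (og_chart A).
Proof.
have [AA AD] := set_mem (valP A); have AA' := mulmx1C AA.
have oU : open [set B : 'M[R]_m | \det (1%:M + (\val A)^T *m B) != 0].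
  have := @open_neq R 0.
  move=> o0; apply: (@open_comp _ _ (fun B : 'M[R]_m => \det (1%:M + (\val A)^T *m B)) _ _ o0).
  move=> B _; apply: (@rat_continuous_at _ _ _ _ setT); [exact: openT| |by []].
  apply: rat_det; apply: rat_mx_add; first exact: rat_mx_cst.
  by apply: rat_mx_mul; [exact: rat_mx_cst|exact: rat_vec_mx].
split => /=.
- exact: (@open_comp _ _ (fun X : ogroup => \val X : 'M[R]_m) _
    (fun X _ => @og_val_continuous X) oU).
- move=> v; rewrite /og_inv /og_coord mulmxA AA' mul1mx.
  have uv := unit_lie_vec v; split.
    by have := unitmx_add1_cay uv; rewrite unitmxE unitfE.
  by rewrite cayK // lie_vecK.
- move=> B; rewrite -unitfE -unitmxE => uB; apply/val_inj => /=.
  rewrite /og_inv /og_coord lie_coordK.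
    by rewrite cayK // mulmxA AA mul1mx.
  apply: cay_lie_alg => //; apply: ogroupM; last exact/set_mem/valP.
  exact/ogroupV.
- move=> B /set_mem /= uB.
  apply: (@continuous_comp _ _ _ (fun X : ogroup => \val X) (og_coord (\val A))).
    exact: og_val_continuous.
  apply: rat_mx_continuous_at oU _ uB.
  by apply: rat_og_coord => //; exact: rat_vec_mx.
- move=> v; apply: continuous_set_val.
  by apply: rat_mx_continuous openT (rat_og_inv _ (rat_mx_id _)) I.
Qed.

Definition og_charted : charted R :=
  @Charted R ogroup k [set og_chart A | A in [set: ogroup]] og_chart.

Lemma og_atlas_full c : @atlas R og_charted c -> full_chart c.
Proof. by move=> [A _ <-]; exact: og_chart_full. Qed.

End orthogonal_commutant.

Section orthogonal_commutant_group.
Variables (R : realType) (m : nat) (D : 'M[R]_m).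
Local Notation G := (ogroup D).

Lemma og_in (X : G) : ogroup D (\val X).
Proof. exact/set_mem/valP. Qed.

Definition og_mul (X Y : G) : G :=
  exist _ (\val X *m \val Y) (mem_set (ogroupM (og_in X) (og_in Y))).
Definition og_one : G := exist _ 1%:M (mem_set (ogroup1 D)).
Definition og_opp (X : G) : G := exist _ (\val X)^T (mem_set (ogroupV (og_in X))).

(** The rows of an orthogonal matrix have norm 1, so its entries are bounded by 1, and the defining
    equations are closed. Flattening reduces the claim to Heine-Borel for row vectors. *)
Lemma ogroup_compact : compact (ogroup D).
Proof.
pose V := vec_mx @^-1` ogroup D : set 'rV[R]_(m * m).
have VE : ogroup D = vec_mx @` V.
  apply/seteqP; split => [X GX|_ [v Vv <-] //].
  by exists (mxvec X); rewrite /V /= mxvecK.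
rewrite VE; apply: continuous_compact.
  by apply: continuous_subspaceT => v; exact: vec_mx_continuous.
apply: bounded_closed_compact.
  exists 1; split => // M M1 v [/= vv _]; apply: le_trans (ltW M1).
  rewrite [leLHS]/Num.Def.normr/= mx_normrE (bigmax_le _ ler01) //= => -[i j] _ /=.
  case/mxvec_indexP: j => a b; rewrite (ord1 i) -[v]vec_mxK mxvecE.
  move: (vec_mx v) vv => W /matrixP/(_ a a); rewrite !mxE eqxx mulr1n => vv.
  rewrite -(@ler_pXn2r _ 2) ?nnegrE // expr1n -normrX ger0_norm ?sqr_ge0 //.
  rewrite -vv (bigD1 b) //= [X in _ <= _ * X + _]mxE expr2 lerDl.
  by apply: sumr_ge0 => c _; rewrite [X in _ * X]mxE -expr2 sqr_ge0.
have cl (F H : 'rV[R]_(m * m) -> 'M[R]_m) :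
    rat_mx setT F -> rat_mx setT H -> closed [set v | F v = H v].
  move=> rF rH; rewrite (_ : [set v | _] = (fun v => F v - H v) @^-1` [set 0]).
    apply: closed_comp.
      move=> v _; exact: (rat_mx_continuous openT (rat_mx_sub rF rH) I).
    exact/accessible_closed_set1/hausdorff_accessible/norm_hausdorff.
  by apply/seteqP; split => v /= => [->|/eqP]; rewrite ?subrr // subr_eq0 => /eqP.
have rv := @rat_vec_mx R m m setT.
by apply: closedI; apply: cl => //; do ?apply: rat_mx_mul => //;
  do ?apply: rat_mx_tr => //; apply: rat_mx_cst.
Qed.

Lemma og_compact : compact [set: G].
Proof. exact/set_type_compact/ogroup_compact. Qed.

Lemma og_second_countable : @second_countable G.
Proof.
(* Second countability comes from compactness of a pointed pseudometric space; the identity serves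
   as the point. *)
pose T : pseudoPMetricType R :=
  HB.pack (G : Type) (PseudoMetric.on (G : Type)) (isPointed.Build (G : Type) og_one).
exact: (@compact_second_countable R T og_compact).
Qed.

Let catlas := @og_atlas_full R m D.

Lemma continuous_from_og (T : topologicalType) (f : T -> G) :
  continuous (fun x => \val (f x) : 'M[R]_m) -> continuous f.
Proof. by move=> cf x; apply: continuous_set_val; exact: cf. Qed.

Lemma og_id_smooth : smooth_map (@id (og_charted D)).
Proof.
apply: full_smooth_map => //; first by move=> x; exact: cvg_id.
move=> c c' ac ac'; rewrite (full_local_dom _ _ (catlas ac)).
case: ac => [A _ <-]; case: ac' => [A' _ <-].
apply: rat_og_coord => //.
by apply: rat_og_inv; exact: rat_mx_id.
Qed.

Lemma og_manifold : is_manifold (og_charted D).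
Proof.
split.
- exact/set_type_hausdorff/norm_hausdorff.
- exact: og_second_countable.
- move=> X; split; first by exists X.
  rewrite /= (mulmx1C (og_in X).1) -scalemx1 -scalerDl detZ det1 mulr1.
  by rewrite expf_neq0 // pnatr_eq0.
- by move=> c /catlas/full_chart_is_chart.
- by have [] := og_id_smooth.
Qed.

Lemma og_mulA : associative og_mul.
Proof. by move=> X Y Z; apply/val_inj; rewrite /= mulmxA. Qed.

Lemma og_mul1 : left_id og_one og_mul.
Proof. by move=> X; apply/val_inj; rewrite /= mul1mx. Qed.

Lemma og_mulV : left_inverse og_one og_opp og_mul.
Proof. by move=> X; apply/val_inj; rewrite /= (mulmx1C (og_in X).1). Qed.

Lemma prod_atlas_full (M N : charted R) :
  (forall c, @atlas R M c -> full_chart c) ->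
  (forall c, @atlas R N c -> full_chart c) ->
  forall c, @atlas R (prod_charted M N) c -> full_chart c.
Proof. by move=> aM aN c [c1 [c2 [/aM f1 /aN f2 ->]]]; exact: full_chart_prod. Qed.

Lemma cvg_mulmx (T : Type) (F : set_system T) (FF : Filter F) a b c
    (f : T -> 'M[R]_(a, b)) (g : T -> 'M[R]_(b, c)) (A : 'M[R]_(a, b)) B :
  f x @[x --> F] --> A -> g x @[x --> F] --> B ->
  f x *m g x @[x --> F] --> A *m B.
Proof.
move=> fA gB; apply: cvg_mx => i j; rewrite mxE.
under eq_fun do rewrite mxE.
apply: (cvg_big (op := +%R) (P := xpredT)) => [|k _]; first exact: add_continuous.
apply: (@cvgM _ _ F).
  exact: (cvg_comp _ _ fA (@coord_continuous R a b i k A)).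
exact: (cvg_comp _ _ gB (@coord_continuous R b c k j B)).
Qed.

Lemma og_mul_smooth : @smooth_map R (prod_charted (og_charted D) (og_charted D))
  (og_charted D) (fun p => og_mul p.1 p.2).
Proof.
apply: full_smooth_map => //.
- apply: continuous_from_og => -[X Y].
  apply: (@cvg_mulmx _ (nbhs (X, Y))).
    exact: (cvg_comp (@fst G G) _ (@cvg_fst _ _ (nbhs X) (nbhs Y) _) (@og_val_continuous _ _ _ X)).
  exact: (cvg_comp (@snd G G) _ (@cvg_snd _ _ (nbhs X) (nbhs Y) _) (@og_val_continuous _ _ _ Y)).
- exact: prod_atlas_full.
- move=> c c' ac ac'; rewrite (full_local_dom _ _ (prod_atlas_full catlas catlas ac)).
  case: ac => [_ [_ [[A1 _ <-] [A2 _ <-] ->]]]; case: ac' => [A' _ <-].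
  apply: rat_og_coord => //.
  apply: rat_mx_mul; apply: rat_og_inv.
    by apply: rat_lsubmx; exact: rat_mx_id.
  by apply: rat_rsubmx; exact: rat_mx_id.
Qed.

Lemma og_opp_smooth : @smooth_map R (og_charted D) (og_charted D) og_opp.
Proof.
apply: full_smooth_map => //.
- apply: continuous_from_og => X; apply: (@cvg_mx _ _ _ _ (nbhs X) _) => i j /=.
  under eq_fun do rewrite mxE; rewrite mxE.
  exact: (cvg_comp _ _ (@og_val_continuous _ _ _ X) (@coord_continuous R m m j i _)).
- move=> c c' ac ac'; rewrite (full_local_dom _ _ (catlas ac)).
  case: ac => [A _ <-]; case: ac' => [A' _ <-].
  apply: rat_og_coord => //; apply: rat_mx_tr.
  by apply: rat_og_inv; exact: rat_mx_id.
Qed.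

Definition og_lie_group : lie_group R :=
  LieGroup og_manifold og_mulA og_mul1 og_mulV og_mul_smooth og_opp_smooth.

End orthogonal_commutant_group.

(** * Stereographic projection *)

Section dot_product.
Variables (R : realType) (n : nat).
Implicit Types u v w : 'rV[R]_n.

Definition dot u v : R := \sum_i u 0 i * v 0 i.

Lemma dotE u v : dot u v = (u *m v^T) 0 0.
Proof. by rewrite mxE; apply: eq_bigr => i _; rewrite mxE. Qed.

Lemma dotC u v : dot u v = dot v u.
Proof. by apply: eq_bigr => i _; rewrite mulrC. Qed.

Lemma dotDl u v w : dot (u + v) w = dot u w + dot v w.
Proof. by rewrite !dotE mulmxDl mxE. Qed.

Lemma dotDr u v w : dot u (v + w) = dot u v + dot u w.
Proof. by rewrite dotC dotDl !(dotC _ u). Qed.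

Lemma dotZl a u v : dot (a *: u) v = a * dot u v.
Proof. by rewrite !dotE -scalemxAl mxE. Qed.

Lemma dotZr a u v : dot u (a *: v) = a * dot u v.
Proof. by rewrite dotC dotZl dotC. Qed.

Lemma dotNl u v : dot (- u) v = - dot u v.
Proof. by rewrite -scaleN1r dotZl mulN1r. Qed.

Lemma dotNr u v : dot u (- v) = - dot u v.
Proof. by rewrite dotC dotNl dotC. Qed.

Lemma dot0l v : dot 0 v = 0.
Proof. by rewrite -(scale0r v) dotZl mul0r. Qed.

Lemma dot0r v : dot v 0 = 0.
Proof. by rewrite dotC dot0l. Qed.

Lemma sqnormE u : sqnorm u = dot u u.
Proof. by apply: eq_bigr => i _; rewrite expr2. Qed.

Lemma dot_ge0 u : 0 <= dot u u.
Proof. by rewrite -sqnormE; apply: sumr_ge0 => i _; exact: sqr_ge0. Qed.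

Lemma dot_eq0 u : dot u u = 0 -> u = 0.
Proof.
by rewrite dotE => uu; apply: mulmx_tr_eq0; apply/matrixP => i j; rewrite !ord1 uu mxE.
Qed.

Lemma dot_gt0 u : u != 0 -> 0 < dot u u.
Proof.
by rewrite lt_def dot_ge0 andbT; apply: contra => /eqP/dot_eq0 ->.
Qed.

Lemma dot_inj u v : (forall w, dot u w = dot v w) -> u = v.
Proof.
move=> uv; apply/eqP; rewrite -subr_eq0; apply/eqP/dot_eq0.
by rewrite dotDl dotNl uv subrr.
Qed.

Lemma dot_is_derive (V : normedModType R) (f g : V -> 'rV[R]_n ) (t z : V)
    (df dg : 'rV[R]_n) :
  is_derive t z f df -> is_derive t z g dg ->
  is_derive t z (fun y => dot (f y) (g y)) (dot (f t) dg + dot df (g t)).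
Proof.
move=> fd gd.
have -> : (fun y => dot (f y) (g y)) = \sum_i (fun y => f y 0 i * g y 0 i).
  by apply/funext => y; rewrite fct_sumE.
rewrite /dot -big_split; apply: is_derive_sum => i /=.
have fi := is_derive_coord 0 i fd; have gi := is_derive_coord 0 i gd.
apply: is_derive_eq (is_deriveM fi gi) _.
by rewrite /= /GRing.scale /= (mulrC (g t 0 i)).
Qed.

End dot_product.

Lemma dot_mulmx (R : realType) m n (u : 'rV[R]_m) (v : 'rV[R]_n) (A : 'M[R]_(m, n)) :
  dot (u *m A) v = dot u (v *m A^T).
Proof. by rewrite !dotE trmx_mul trmxK mulmxA. Qed.

Lemma dot_row_mx (R : realType) m n (u u' : 'rV[R]_m) (v v' : 'rV[R]_n) :
  dot (row_mx u v) (row_mx u' v') = dot u u' + dot v v'.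
Proof.
rewrite /dot big_split_ord /=; congr (_ + _); apply: eq_bigr => i _.
  by rewrite !row_mxEl.
by rewrite !row_mxEr.
Qed.

Lemma dot_const_mx1 (R : realType) (a b : R) :
  dot (const_mx a : 'rV_1) (const_mx b) = a * b.
Proof. by rewrite /dot big_ord1 !mxE. Qed.

Lemma inner_scalar (R : realType) d (a : R) (v w : 'rV[R]_d) :
  inner (a%:M) v w = a * dot v w.
Proof. by rewrite /inner mul_mx_scalar -scalemxAl mxE dotE. Qed.

Section stereographic.
Variables (R : realType) (d : nat).
Implicit Types (s : bool) (u v w : 'rV[R]_d) (x y : 'rV[R]_(1 + d)).

Definition coord0 x : R := x 0 0.

Definition stproj s x : 'rV[R]_d := (1 - (-1) ^+ s * coord0 x)^-1 *: rsubmx x.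

Definition dproj s x y : 'rV[R]_d :=
  (1 - (-1) ^+ s * coord0 x)^-1 *: rsubmx y +
  ((-1) ^+ s * coord0 y / (1 - (-1) ^+ s * coord0 x) ^+ 2) *: rsubmx x.

Definition dstereo s u w : 'rV[R]_(1 + d) :=
  row_mx (const_mx ((-1) ^+ s * (4 * dot u w / (dot u u + 1) ^+ 2)))
         ((2 / (dot u u + 1)) *: w - (4 * dot u w / (dot u u + 1) ^+ 2) *: u).

Lemma dotuu1 u : dot u u + 1 != 0.
Proof. by rewrite gt_eqF // ltr_wpDl // dot_ge0. Qed.

Lemma stereo_invE s u : stereo_inv s u =
  row_mx (const_mx ((-1) ^+ s * ((dot u u - 1) / (dot u u + 1))))
         ((2 / (dot u u + 1)) *: u).
Proof. by rewrite /stereo_inv sqnormE. Qed.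

Lemma x0_row (a : R) w : coord0 (row_mx (const_mx a) w) = a.
Proof.
have -> : coord0 (row_mx (const_mx a) w) =
    row_mx (const_mx a : 'rV_1) w 0 (lshift d 0).
  by congr (row_mx _ _ _ _); exact/val_inj.
by rewrite row_mxEl mxE.
Qed.

Lemma x0_stereo s u : coord0 (stereo_inv s u) = (-1) ^+ s * ((dot u u - 1) / (dot u u + 1)).
Proof. by rewrite stereo_invE x0_row. Qed.

Lemma sub1_x0_stereo s u : 1 - (-1) ^+ s * coord0 (stereo_inv s u) = 2 / (dot u u + 1).
Proof.
rewrite x0_stereo mulrA -expr2 sqrr_sign mul1r; have := dotuu1 u; by move=> ?; field.
Qed.

Lemma rsubmx_stereo s u : rsubmx (stereo_inv s u) = (2 / (dot u u + 1)) *: u.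
Proof. by rewrite stereo_invE row_mxKr. Qed.

Lemma proj_stereo s u : stproj s (stereo_inv s u) = u.
Proof.
rewrite /stproj sub1_x0_stereo rsubmx_stereo scalerA mulVf ?scale1r //.
by rewrite mulf_neq0 ?invr_eq0 ?dotuu1 // pnatr_eq0.
Qed.

Lemma row_x0 x : x = row_mx (const_mx (coord0 x)) (rsubmx x).
Proof.
rewrite -{1}(hsubmxK x); congr row_mx; apply/rowP => i; rewrite !mxE ord1.
by congr (x _ _); exact/val_inj.
Qed.

Lemma dot_x0 x y : dot x y = coord0 x * coord0 y + dot (rsubmx x) (rsubmx y).
Proof. by rewrite {1}(row_x0 x) {1}(row_x0 y) dot_row_mx dot_const_mx1. Qed.

Lemma x0_sub_neq0 s x : coord0 x != (-1) ^+ s -> 1 - (-1) ^+ s * coord0 x != 0.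
Proof.
apply: contra => /eqP e; have -> : coord0 x = (-1) ^+ s * (((-1) ^+ s) * coord0 x).
  by rewrite mulrA -expr2 sqrr_sign mul1r.
by move/eqP: e; rewrite subr_eq0 => /eqP <-; rewrite mulr1.
Qed.

Lemma stereo_proj s x : dot x x = 1 -> coord0 x != (-1) ^+ s ->
  stereo_inv s (stproj s x) = x.
Proof.
move=> xx /x0_sub_neq0; rewrite [RHS]row_x0 stereo_invE /stproj.
rewrite dotZl dotZr; move: xx; rewrite dot_x0 => /(canRL (addKr _)) ->.
move: (coord0 x) => a; have : ((-1) ^+ s : R) ^+ 2 = 1 by rewrite sqrr_sign.
move: ((-1) ^+ s) => e e1 ea0.
have q1 : (1 - e * a)^-1 * ((1 - e * a)^-1 * (- (a * a) + 1)) + 1 = 2 / (1 - e * a).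
  have -> : - (a * a) + 1 = (1 - e * a) * (1 + e * a).
    by rewrite -[1 in LHS]e1; ring: e1.
  by field.
have q2 : (1 - e * a)^-1 * ((1 - e * a)^-1 * (- (a * a) + 1)) - 1 = 2 * (e * a) / (1 - e * a).
  rewrite -[X in X - 1](addrK 1) q1; by field.
rewrite q1 q2 scalerA; congr row_mx.
  congr const_mx; transitivity (e ^+ 2 * a); last by rewrite e1 mul1r.
  by field; rewrite ea0 /=.
rewrite -[RHS]scale1r; congr (_ *: _).
by field; rewrite ea0.
Qed.

Lemma stereo_is_derive s (V : normedModType R) (f : V -> 'rV[R]_d ) (t z : V) (df : 'rV[R]_d) :
  is_derive t z f df ->
  is_derive t z (fun p => stereo_inv s (f p)) (dstereo s (f t) df).
Proof.
move=> fd; have qd := dot_is_derive fd fd.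
have nz := dotuu1 (f t).
have Vd : is_derive t z (fun p => (dot (f p) (f p) + 1)^-1)
    (- (2 * dot (f t) df) / (dot (f t) (f t) + 1) ^+ 2).
  have qd1 : is_derive t z (fun p => dot (f p) (f p) + 1) (dot (f t) df + dot df (f t)).
    apply: is_derive_eq (is_deriveD qd (is_derive_cst (1 : R) t z)) _; exact: addr0.
  split.
    by apply: derivableV => //; have [] := qd1.
  have [d1 dE] := qd1; rewrite deriveV // dE /GRing.scale /= (dotC df).
  by field.
under eq_fun do rewrite stereo_invE.
apply: is_derive_mx => i j; rewrite (ord1 i) /dstereo.
case: (splitP j) => k jk.
  have -> : j = lshift d k by apply/val_inj.
  under eq_fun do rewrite row_mxEl mxE; rewrite row_mxEl mxE.
  have -> : (fun t => (-1) ^+ s * ((dot (f t) (f t) - 1) / (dot (f t) (f t) + 1))) =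
      (fun t => (-1) ^+ s - (2 * (-1) ^+ s) *: (dot (f t) (f t) + 1)^-1).
    by apply/funext => p; have := dotuu1 (f p); rewrite /GRing.scale /= => ?; field.
  apply: is_derive_eq (is_deriveB (is_derive_cst ((-1) ^+ s : R) t z)
    (is_deriveZ (2 * (-1) ^+ s) Vd)) _.
  by rewrite /GRing.scale /= sub0r; field.
have -> : j = rshift 1 k by apply/val_inj.
under eq_fun do rewrite row_mxEr mxE; rewrite row_mxEr !mxE.
have -> : (fun t => 2 / (dot (f t) (f t) + 1) * f t 0 k) =
    (fun t => 2 *: ((dot (f t) (f t) + 1)^-1 * f t 0 k)).
  by apply/funext => p; rewrite /GRing.scale /= mulrA.
have fk := is_derive_coord 0 k fd.
apply: is_derive_eq (is_deriveZ 2 (is_deriveM Vd fk)) _.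
by rewrite /GRing.scale /=; field.
Qed.

(** Conformality of stereographic projection, with the conformal factor of the round metric. *)
Lemma dot_dstereo s u v w :
  dot (dstereo s u v) (dstereo s u w) = 4 / (dot u u + 1) ^+ 2 * dot v w.
Proof.
rewrite /dstereo dot_row_mx dot_const_mx1.
rewrite !(dotDl, dotDr, dotNl, dotNr, dotZl, dotZr) (dotC v u).
have := dotuu1 u => nz.
have e1 : ((-1) ^+ s : R) ^+ 2 = 1 by rewrite sqrr_sign.
rewrite (mulrACA ((-1) ^+ s)) -expr2 e1 mul1r.
by field.
Qed.

Lemma dstereo_inj s u v w : dstereo s u v = dstereo s u w -> v = w.
Proof.
move=> vw; have c0 : 4 / (dot u u + 1) ^+ 2 != 0.
  by rewrite mulf_neq0 ?invr_eq0 ?expf_neq0 ?dotuu1 // pnatr_eq0.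
apply: dot_inj => z; apply: (mulfI c0).
by rewrite -!(dot_dstereo s) vw.
Qed.

Lemma proj_is_derive s (V : normedModType R) (f : V -> 'rV[R]_(1 + d) ) (t z : V) df :
  is_derive t z f df -> coord0 (f t) != (-1) ^+ s ->
  is_derive t z (fun p => stproj s (f p)) (dproj s (f t) df).
Proof.
move=> fd /x0_sub_neq0 nz.
have fd0 := is_derive_coord 0 0 fd.
have Nd : is_derive t z (fun p => 1 - (-1) ^+ s * coord0 (f p)) (- ((-1) ^+ s * coord0 df)).
  apply: is_derive_eq (is_deriveB (is_derive_cst (1 : R) t z) (is_deriveZ ((-1) ^+ s) fd0)) _.
  by rewrite sub0r.
have Vd : is_derive t z (fun p => (1 - (-1) ^+ s * coord0 (f p))^-1)
    (((-1) ^+ s * coord0 df) / (1 - (-1) ^+ s * coord0 (f t)) ^+ 2).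
  have [d1 dE] := Nd; split; first exact: derivableV.
  by rewrite deriveV // dE /GRing.scale /=; field.
apply: is_derive_mx => i k; rewrite (ord1 i) /stproj /dproj !mxE.
under eq_fun do rewrite !mxE.
apply: is_derive_eq (is_deriveM Vd (is_derive_coord 0 (rshift 1 k) fd)) _.
by rewrite /GRing.scale /= (mulrC (f t _ _)).
Qed.

(** The hypothesis says that [y] is tangent to the sphere. With [dstereo_inj] this lets identities
    between coordinate vectors be checked on ambient vectors, where flow and isometries are
    linear. *)
Lemma dstereo_dproj s u y : dot (stereo_inv s u) y = 0 ->
  dstereo s u (dproj s (stereo_inv s u) y) = y.
Proof.
rewrite dot_x0 x0_stereo rsubmx_stereo dotZl => uy.
have nz := dotuu1 u; have e1 : ((-1) ^+ s : R) ^+ 2 = 1 by rewrite sqrr_sign.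
have uy' : dot u (rsubmx y) = - ((-1) ^+ s) * coord0 y * (dot u u - 1) / 2.
  have -> : dot u (rsubmx y) = (dot u u + 1) / 2 * (2 / (dot u u + 1) * dot u (rsubmx y)).
    by field.
  rewrite -[X in _ * X](addKr ((-1) ^+ s * ((dot u u - 1) / (dot u u + 1)) * coord0 y)).
  by rewrite uy; field.
have dw : dot u (dproj s (stereo_inv s u) y) =
    (-1) ^+ s * coord0 y * (dot u u + 1) ^+ 2 / 4.
  rewrite /dproj sub1_x0_stereo rsubmx_stereo dotDr !dotZr uy'.
  by field.
rewrite [RHS]row_x0 /dstereo dw; congr row_mx.
  congr const_mx; transitivity (((-1) ^+ s) ^+ 2 * coord0 y); last by rewrite e1 mul1r.
  by field.
rewrite /dproj sub1_x0_stereo rsubmx_stereo scalerDr !scalerA -addrA -scaleNr -scalerDl.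
rewrite (_ : 2 / _ * _ = 1) ?scale1r; last by field.
by rewrite (_ : _ - _ = 0) ?scale0r ?addr0 //; field.
Qed.

End stereographic.

Section sphere_charts.
Variables (R : realType) (d : nat).
Local Notation S := (sphere_charted R d).

Lemma sphere_dot (x : S) : dot (sphere_val x) (sphere_val x) = 1.
Proof. by rewrite -sqnormE; have := set_mem (valP x). Qed.

Lemma sphere_in (x : 'rV[R]_(1 + d)) : dot x x = 1 -> (x : 'rV[R]_(d.+1)) \in @sphere R d.
Proof. by move=> xx; apply/mem_set; rewrite /sphere /= -[LHS](sqnormE x). Qed.

Lemma sphere_val_inj : injective (@sphere_val R d).
Proof. by move=> x y xy; apply/val_inj. Qed.

Lemma sphere_val_continuous : continuous (@sphere_val R d).
Proof. exact: set_val_continuous. Qed.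

Lemma continuous_to_sphere (T : topologicalType) (f : T -> S) (t : T) :
  {for t, continuous (fun p => sphere_val (f p))} -> {for t, continuous f}.
Proof. by move=> cf; apply: continuous_set_val. Qed.

Lemma open_x0_neq (a : R) : open [set x : 'rV[R]_(1 + d) | coord0 x != a].
Proof.
apply: (@open_comp _ _ (@coord0 R d) [set t | t != a]); last exact: open_neq.
by move=> x _; exact: coord_continuous.
Qed.

Lemma rat_proj m (U : set 'rV[R]_m) (s : bool) (F : 'rV[R]_m -> 'rV[R]_(1 + d)) :
  rat_mx U F -> (forall u, U u -> coord0 (F u) != (-1) ^+ s) ->
  rat_mx U (fun u => stproj s (F u)).
Proof.
move=> rF F0; apply: rat_mx_scale; last exact: rat_rsubmx.
apply: rat_inv => [|u /F0/x0_sub_neq0 //].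
apply: rat_sub; first exact: rat_cst.
by apply: rat_mul; [exact: rat_cst|exact: rF].
Qed.

Lemma rat_stereo m (U : set 'rV[R]_m) (s : bool) (F : 'rV[R]_m -> 'rV[R]_d) :
  rat_mx U F -> rat_mx U (fun u => stereo_inv s (F u)).
Proof.
move=> rF; have rq := rat_sqnorm rF.
have rq1 : rat_on U (fun u => (sqnorm (F u) + 1)^-1).
  apply: rat_inv => [|u _]; last by rewrite sqnormE dotuu1.
  by apply: rat_add => //; exact: rat_cst.
apply: rat_row_mx.
  apply: rat_mx_const; apply: rat_mul; first exact: rat_cst.
  by apply: rat_mul => //; apply: rat_sub => //; exact: rat_cst.
by apply: rat_mx_scale => //; apply: rat_mul => //; exact: rat_cst.
Qed.

Lemma stereo_chart_full s : full_chart (stereo_chart R d s).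
Proof.
split => /=.
- apply: (@open_comp (@sphere R d) _ (@sphere_val R d) [set x | coord0 x != (-1) ^+ s]).
    by move=> x _; exact: sphere_val_continuous.
  exact: open_x0_neq.
- move=> u; split; last exact: (proj_stereo s u).
  change (coord0 (stereo_inv s u) != (-1) ^+ s).
  apply/eqP => e; have := sub1_x0_stereo s u.
  rewrite e -expr2 sqrr_sign subrr => /esym/eqP.
  by rewrite mulf_eq0 invr_eq0 (negbTE (dotuu1 u)) pnatr_eq0.
- by move=> x xs; apply: sphere_val_inj; exact: stereo_proj (sphere_dot x) xs.
- move=> x /set_mem /= xs.
  have rp : rat_mx [set x : 'rV[R]_(1 + d) | coord0 x != (-1) ^+ s] (@stproj R d s).
    by apply: rat_proj => //; exact: rat_mx_id.
  have cp : {for sphere_val x, continuous (@stproj R d s)}.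
    exact: (rat_mx_continuous (@open_x0_neq _) rp xs).
  exact: (cvg_comp _ _ (@sphere_val_continuous x) cp).
- move=> u; apply: continuous_to_sphere.
  exact: (rat_mx_continuous openT (rat_stereo _ (rat_mx_id _)) I).
Qed.

Lemma sphere_atlas_full c : @atlas R S c -> full_chart c.
Proof. by move=> [s ->]; exact: stereo_chart_full. Qed.

Lemma sphere_chart_at (x : S) : atlas (chart_at x) /\ cdom (chart_at x) x.
Proof.
split; first by eexists.
suff : sphere_val x 0 0 != (-1) ^+ (sphere_val x 0 0 == 1) by [].
have [->|] := eqVneq (sphere_val x 0 0) 1; last by [].
by rewrite expr1; apply/eqP; lra.
Qed.

End sphere_charts.

Section linear_isometries.
Variables (R : realType) (d : nat) (D : 'M[R]_(1 + d)).
Local Notation S := (sphere_charted R d).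
Local Notation G := (og_lie_group D).

Lemma dot_og (A : ogroup D) (x y : 'rV[R]_(1 + d)) :
  dot (x *m (\val A)^T) (y *m (\val A)^T) = dot x y.
Proof.
by rewrite dot_mulmx trmxK -mulmxA (mulmx1C (og_in A).1) mulmx1.
Qed.

Lemma og_act_in (A : G) (x : S) :
  (sphere_val x *m (\val A)^T : 'rV[R]_(d.+1)) \in @sphere R d.
Proof. by apply: sphere_in; rewrite dot_og sphere_dot. Qed.

(** Points are row vectors, so the transpose is what makes multiplication from the right a left
    action. *)
Definition og_act (A : G) (x : S) : S :=
  exist _ (sphere_val x *m (\val A)^T : 'rV[R]_(d.+1)) (og_act_in A x).

Lemma og_act_smooth : smooth_action og_act.
Proof.
split.
- by move=> x; apply/val_inj; rewrite /= trmx1 mulmx1.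
- by move=> a b x; apply/val_inj; rewrite /= trmx_mul mulmxA.
apply: full_smooth_map.
- move=> [A x]; apply: continuous_to_sphere.
  apply: (@cvg_mulmx _ _ (nbhs (A, x)) _ _ _ _ (fun p => sphere_val p.2) (fun p => (\val p.1)^T)).
    exact: (cvg_comp (@snd G S) _ (@cvg_snd _ _ (nbhs A) (nbhs x) _)
      (@sphere_val_continuous _ _ x)).
  apply: (cvg_comp (@fst G S) (fun p => (\val p)^T) (@cvg_fst _ _ (nbhs A) (nbhs x) _)).
  apply: (@cvg_mx _ _ _ _ (nbhs A) _) => i j /=.
  under eq_fun do rewrite mxE; rewrite mxE.
  exact: (cvg_comp _ _ (@og_val_continuous _ _ _ A) (@coord_continuous R _ _ j i _)).
- exact: prod_atlas_full (@og_atlas_full _ _ D) (@sphere_atlas_full _ _).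
- exact: sphere_atlas_full.
- move=> c c' ac [s' ->].
  rewrite (full_local_dom _ _ (prod_atlas_full (@og_atlas_full _ _ D) (@sphere_atlas_full _ _) ac)).
  case: ac => [_ [_ [[A _ <-] [s ->] ->]]].
  apply: (@rat_proj _ _ _ _ s' 
    (fun u => stereo_inv s (rsubmx u) *m (og_inv (\val A) (lsubmx u))^T)); last by [].
  apply: rat_mx_mul.
    by apply: rat_stereo; apply: rat_rsubmx; exact: rat_mx_id.
  apply: rat_mx_tr; apply: rat_og_inv.
  by apply: rat_lsubmx; exact: rat_mx_id.
Qed.

End linear_isometries.

(** * The metric *)

Lemma is_derive_mulmxr (R : realType) m n (V : normedModType R) (f : V -> 'rV[R]_m)
    (df : 'rV[R]_m) (t z : V) (A : 'M[R]_(m, n)) :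
  is_derive t z f df -> is_derive t z (fun p => f p *m A) (df *m A).
Proof.
move=> fd; apply: is_derive_mx => i j; rewrite (ord1 i) mxE.
have -> : (fun p => (f p *m A) 0 j) = \sum_k (fun p => A k j *: f p 0 k).
  apply/funext => p; rewrite fct_sumE mxE; apply: eq_bigr => k _.
  by rewrite /GRing.scale /= mulrC.
apply: is_derive_eq (@is_derive_sum _ _ _ _ _ _ _
  (fun k => A k j *: df 0 k) _) _.
  by move=> k; apply: is_deriveZ; exact: is_derive_coord fd.
by apply: eq_bigr => k _; rewrite /GRing.scale /= mulrC.
Qed.

Section metric.
Variables (R : realType) (d : nat) (c : 'rV[R]_d) (k : R).
Hypotheses (cc : dot c c = 1) (k0 : 0 <= k).
Local Notation S := (sphere_charted R d).
Implicit Types (u v w : 'rV[R]_d) (x y : 'rV[R]_(1 + d)).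

(* The vectors pole and axis span the first complex line, and height is the
   squared norm |z_1|^2 of the projection onto it. *)
Definition pole : 'rV[R]_(1 + d) := row_mx (const_mx 1) 0.
Definition axis : 'rV[R]_(1 + d) := row_mx 0 c.
Definition polar_proj : 'M[R]_(1 + d) := pole^T *m pole + axis^T *m axis.
Local Notation P1 := polar_proj.
Definition height x : R := coord0 x ^+ 2 + dot (rsubmx x) c ^+ 2.

(* (q + 1)^2 times the squared length of the Killing field; see metric_den_stereo. *)
Definition metric_den u : R := (dot u u + 1) ^+ 2 + 4 * k * (dot u u - dot u c ^+ 2).
Local Notation Q := metric_den.

(** The chart argument is ignored: changing the centre of projection only flips the sign of
    [coord0], and [height] depends on its square. *)
Definition gmetric : metric S := fun _ u => (4 / Q u)%:M.

Lemma mulmx_dot (m n : nat) (x : 'rV[R]_m) (p : 'rV[R]_m) (q : 'rV[R]_n) :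
  x *m (p^T *m q) = dot x p *: q.
Proof.
by rewrite mulmxA; apply/rowP => i; rewrite mxE big_ord1 -dotE mxE.
Qed.

Lemma dot_pole x : dot x pole = coord0 x.
Proof. by rewrite dot_x0 /pole x0_row row_mxKr dot0r mulr1 addr0. Qed.

Lemma x0_axis : coord0 axis = 0.
Proof.
by rewrite /axis (_ : 0 = const_mx 0 :> 'rV_1) ?x0_row //;
  apply/rowP => i; rewrite !mxE.
Qed.

Lemma dot_axis x : dot x axis = dot (rsubmx x) c.
Proof. by rewrite dot_x0 x0_axis mulr0 add0r /axis row_mxKr. Qed.

Lemma dot_pole_pole : dot pole pole = 1.
Proof. by rewrite dot_pole /pole x0_row. Qed.

Lemma dot_axis_axis : dot axis axis = 1.
Proof. by rewrite dot_axis /axis row_mxKr. Qed.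

Lemma dot_axis_pole : dot axis pole = 0.
Proof. by rewrite dot_pole x0_axis. Qed.

Lemma mulP1 x : x *m P1 = coord0 x *: pole + dot (rsubmx x) c *: axis.
Proof. by rewrite /polar_proj mulmxDr !mulmx_dot dot_pole dot_axis. Qed.

Lemma heightE x : height x = dot (x *m P1) (x *m P1).
Proof.
rewrite mulP1 !(dotDl, dotDr, dotZl, dotZr) dot_pole_pole dot_axis_axis.
by rewrite (dotC pole) dot_axis_pole /height; ring.
Qed.

Lemma height_og (A : ogroup P1) x : height (x *m (\val A)^T) = height x.
Proof.
by rewrite !heightE -mulmxA (ogroupV (og_in A)).2 mulmxA dot_og.
Qed.

Lemma cauchy_schwarz n (u v : 'rV[R]_n) : dot u v ^+ 2 <= dot u u * dot v v.
Proof.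
have [->|v0] := eqVneq v 0; first by rewrite !dot0r expr0n mulr0.
have vv := dot_gt0 v0.
have := dot_ge0 (dot v v *: u - dot u v *: v).
rewrite !(dotDl, dotDr, dotNl, dotNr, dotZl, dotZr) (dotC v u) => h.
rewrite -(ler_pM2l vv) -subr_ge0; congr (0 <= _): h; ring.
Qed.

Lemma height_bound x : dot x x = 1 -> 0 <= height x <= 1.
Proof.
move=> xx; rewrite /height addr_ge0 ?sqr_ge0 //= -xx dot_x0 -expr2 lerD2l.
by have := cauchy_schwarz (rsubmx x) c; rewrite cc mulr1.
Qed.

(** The last factor is F of the overview once [k] is [b ^+ 2 - 1], so [4 / Q u] is the round
    conformal factor divided by F. *)
Lemma metric_den_stereo s u :
  Q u = (dot u u + 1) ^+ 2 * (1 + k * (1 - height (stereo_inv s u))).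
Proof.
rewrite /height x0_stereo rsubmx_stereo dotZl exprMn sqrr_sign mul1r /Q.
by have := dotuu1 u => ?; field.
Qed.

Lemma Q_ge u : (dot u u + 1) ^+ 2 <= Q u.
Proof.
rewrite /Q lerDl !mulr_ge0 // subr_ge0.
by have := cauchy_schwarz u c; rewrite cc mulr1.
Qed.

Lemma Q_gt0 u : 0 < Q u.
Proof.
apply: lt_le_trans (Q_ge u); rewrite lt_def sqr_ge0 andbT.
by rewrite expf_neq0 // dotuu1.
Qed.

Lemma dot_stereo_dstereo s u v : dot (stereo_inv s u) (dstereo s u v) = 0.
Proof.
rewrite stereo_invE /dstereo dot_row_mx dot_const_mx1.
rewrite !(dotDr, dotNr, dotZl, dotZr).
rewrite mulrACA -expr2 sqrr_sign mul1r.
by have := dotuu1 u => ?; field.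
Qed.

(** Lifted to the ambient space, both the action and its differential are multiplication by
    [(\val A)^T]; the differential is transported through the explicit [dproj] and [dstereo]. *)
Lemma og_act_is_derive (A : ogroup P1) s s' u v :
  let F := local_rep (@og_act R d P1 A) (stereo_chart R d s) (stereo_chart R d s') in
  local_dom (@og_act R d P1 A) (stereo_chart R d s) (stereo_chart R d s') u ->
  [/\ is_derive u v F ('D_v F u),
      stereo_inv s' (F u) = stereo_inv s u *m (\val A)^T &
      dstereo s' (F u) ('D_v F u) = dstereo s u v *m (\val A)^T].
Proof.
move=> F; rewrite (@full_local_dom R S S _ _ _ (stereo_chart_full R d s)) => Uu.
have xx : dot (stereo_inv s u *m (\val A)^T) (stereo_inv s u *m (\val A)^T) = 1.
  by rewrite dot_og; exact: (sphere_dot (cinv (stereo_chart R d s) u)).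
have FE : F = fun u => stproj s' (stereo_inv s u *m (\val A)^T) by [].
have Fx : stereo_inv s' (F u) = stereo_inv s u *m (\val A)^T.
  by rewrite FE stereo_proj.
have dS := stereo_is_derive s (is_derive_id u v).
have dF : is_derive u v F
    (dproj s' (stereo_inv s u *m (\val A)^T) (dstereo s u v *m (\val A)^T)).
  by rewrite FE; apply: proj_is_derive; [exact: is_derive_mulmxr dS|exact: Uu].
have [d1 dE] := dF; split; [exact: derivableP d1|exact: Fx|].
rewrite dE -Fx dstereo_dproj // Fx dot_og.
exact: dot_stereo_dstereo.
Qed.

(** The action preserves ambient scalar products, hence the round metric, and it preserves [height],
    hence the factor F. *)
Lemma og_act_preserves (A : ogroup P1) : preserves gmetric (@og_act R d P1 A).
Proof.
move=> _ _ [s ->] [s' ->] u Uu /= v w.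
have [_ Fx dFv] := og_act_is_derive v Uu.
have [_ _ dFw] := og_act_is_derive w Uu.
rewrite /gmetric !inner_scalar.
have key (a b x : R) : 4 / (a * b) * x = 4 / a * x / b by rewrite invfM; ring.
rewrite (metric_den_stereo s') (metric_den_stereo s u) Fx height_og [LHS]key [RHS]key.
congr (_ / _); rewrite -(dot_dstereo s u) -(dot_og A) -dFv -dFw.
exact: esym (dot_dstereo _ _ _ _).
Qed.

(** A change of charts is the coordinate expression of the action of the identity matrix, so the
    transformation rule is a case of invariance. *)
Lemma gmetric_id : preserves gmetric (@id S).
Proof.
have -> : @id S = @og_act R d P1 (og_one P1).
  by apply/funext => x; apply/val_inj; rewrite /= trmx1 mulmx1.
exact: og_act_preserves.
Qed.

Lemma rat_Q U : rat_on U Q.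
Proof.
have rd : rat_on U (fun u => dot u u).
  by apply: rat_ext (rat_sqnorm (@rat_mx_id R d U)) => u _; rewrite sqnormE.
have rc : rat_on U (fun u => dot u c).
  apply: (@rat_sum _ _ U _ _ xpredT) => i.
  by apply: rat_mul; [exact: rat_coord|exact: rat_cst].
have rd1 := rat_add rd (rat_cst U 1).
apply: rat_add; first by apply: rat_ext (rat_mul rd1 rd1) => u _; rewrite expr2.
apply: rat_mul; first exact: rat_cst.
apply: rat_sub => //; apply: rat_ext (rat_mul rc rc) => u _; by rewrite expr2.
Qed.

Lemma polyf_Q a : polyf a Q.
Proof.
have rd : polyf a (fun u => dot u u).
  by apply: (@polyf_sum _ _ a _ _ xpredT) => i; apply: polyf_mul; exact: polyf_coord.
have rc : polyf a (fun u => dot u c).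
  apply: (@polyf_sum _ _ a _ _ xpredT) => i.
  by apply: polyf_mul; [exact: polyf_coord|exact: polyf_cst].
have rd1 := polyf_add rd (polyf_cst a 1).
have -> : Q = fun u => (dot u u + 1) * (dot u u + 1) +
    4 * k * (dot u u + (-1) * (dot u c * dot u c)).
  by apply/funext => u; rewrite /Q !expr2 mulN1r.
apply: polyf_add; first exact: polyf_mul.
apply: polyf_mul; first exact: polyf_cst.
by apply: polyf_add => //; apply: polyf_mul; [exact: polyf_cst|exact: polyf_mul].
Qed.

Lemma gmetric_riemannian : riemannian_metric gmetric.
Proof.
split.
- exact: gmetric_id.
- move=> _ [s ->]; rewrite (full_chart_cimg (@stereo_chart_full R d s)).
  apply: rat_mx_smooth => [|i j]; first exact: openT.
  apply: rat_ext (rat_mul (rat_cst _ ((i == j)%:R * 4)) (rat_inv (rat_Q setT) _)).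
    by move=> u _; rewrite /gmetric mxE -mulrA mulr_natl.
  by move=> u _; rewrite gt_eqF ?Q_gt0.
- by move=> ch u _ _; rewrite /gmetric tr_scalar_mx.
- move=> ch u _ _ v v0; rewrite /gmetric inner_scalar.
  by rewrite mulr_gt0 ?divr_gt0 ?Q_gt0 ?dot_gt0.
Qed.

Lemma gmetric_analytic : analytic_metric gmetric.
Proof.
split; first exact: gmetric_riemannian.
move=> ch _ i j u _; have [->|ij] := eqVneq i j; last first.
  rewrite (_ : (fun u => _) = fun=> 0); first exact/polyf_analytic/polyf_cst.
  by apply/funext => y; rewrite /gmetric mxE (negbTE ij).
rewrite (_ : (fun u => _) = fun w => (Q w * 4^-1)^-1).
  apply: (@polyf_inv_analytic _ _ _ (fun w => Q w * 4^-1)).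
    by apply: polyf_mul; [exact: polyf_Q|exact: polyf_cst].
  by rewrite mulf_neq0 ?gt_eqF ?Q_gt0 // invr_gt0.
by apply/funext => y; rewrite /gmetric mxE eqxx mulr1n invfM invrK mulrC.
Qed.

End metric.

(** * The flow and its Killing field *)

Section flow.
Variables (R : realType) (d : nat) (c : 'rV[R]_d) (N : 'M[R]_d) (b : R).
Hypotheses (cc : dot c c = 1) (cN : c *m N = 0) (Nt : N^T = - N)
  (NN : N *m N = c^T *m c - 1%:M).
Implicit Types (u v w : 'rV[R]_d) (x y : 'rV[R]_(1 + d)) (t : R).
Local Notation P1 := (polar_proj c).
Local Notation pole := (pole R d).
Local Notation axis := (axis c).
Local Notation height := (height c).

(* N is the complex structure of the complement of the first complex line,
   extended by zero to the axis. *)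
Definition polar_rot : 'M[R]_(1 + d) := pole^T *m axis - axis^T *m pole.
Local Notation J1 := polar_rot.
Definition coaxial_rot : 'M[R]_(1 + d) := block_mx 0 0 0 N.
Local Notation J2 := coaxial_rot.
Definition coaxial_proj : 'M[R]_(1 + d) := 1%:M - P1.
Local Notation P2 := coaxial_proj.
Definition rot_gen : 'M[R]_(1 + d) := J1 + b *: J2.
Local Notation J := rot_gen.
(** The closed form of exp(t J), available because [J1] and [J2] are complex structures on the
    ranges of [P1] and [P2]. *)
Definition rot t : 'M[R]_(1 + d) :=
  cos t *: P1 + sin t *: J1 + (cos (b * t) *: P2 + sin (b * t) *: J2).
Local Notation E := rot.

Lemma mx_eq_row m n (A B : 'M[R]_(m, n)) : (forall x : 'rV_m, x *m A = x *m B) -> A = B.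
Proof. by move=> AB; apply/row_matrixP => i; rewrite !rowE AB. Qed.

Lemma x0D x y : coord0 (x + y) = coord0 x + coord0 y. Proof. by rewrite /coord0 mxE. Qed.
Lemma x0N x : coord0 (- x) = - coord0 x. Proof. by rewrite /coord0 mxE. Qed.
Lemma x0Z a x : coord0 (a *: x) = a * coord0 x. Proof. by rewrite /coord0 mxE. Qed.
Lemma x0_pole : coord0 pole = 1. Proof. by rewrite /pole x0_row. Qed.
Lemma rsubmx_pole : rsubmx pole = 0. Proof. by rewrite /pole row_mxKr. Qed.
Lemma rsubmx_axis : rsubmx axis = c. Proof. by rewrite /axis row_mxKr. Qed.

Lemma mulJ1 x : x *m J1 = coord0 x *: axis - dot (rsubmx x) c *: pole.
Proof. by rewrite /J1 mulmxBr !mulmx_dot dot_pole dot_axis. Qed.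

Lemma mulJ2 x : x *m J2 = row_mx 0 (rsubmx x *m N).
Proof.
by rewrite {1}(row_x0 x) /J2 mul_row_block !mulmx0 addr0 add0r.
Qed.

Lemma x0_row0 w : coord0 (row_mx 0 w) = 0.
Proof.
by rewrite (_ : 0 = const_mx 0 :> 'rV_1) ?x0_row //; apply/rowP => i; rewrite !mxE.
Qed.

Lemma dotN_c u : dot (u *m N) c = 0.
Proof. by rewrite dot_mulmx Nt mulmxN cN oppr0 dot0r. Qed.

Lemma dotNu u : dot (u *m N) u = 0.
Proof.
have : dot (u *m N) u = - dot (u *m N) u.
  by rewrite {1}dot_mulmx Nt mulmxN dotNr dotC.
by move=> h; lra.
Qed.

Lemma dotNN u : dot (u *m N) (u *m N) = dot u u - dot u c ^+ 2.
Proof.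
rewrite dot_mulmx Nt mulmxN -mulmxA NN mulmxBr mulmx1 mulmx_dot opprB.
by rewrite dotDr dotNr dotZr expr2.
Qed.

Lemma row_ext x y : coord0 x = coord0 y -> rsubmx x = rsubmx y -> x = y.
Proof. by move=> xy xy'; rewrite (row_x0 x) xy xy' -row_x0. Qed.

Lemma rsubmxD x y : rsubmx (x + y) = rsubmx x + rsubmx y.
Proof. by apply/rowP => i; rewrite !mxE. Qed.
Lemma rsubmxN x : rsubmx (- x) = - rsubmx x.
Proof. by apply/rowP => i; rewrite !mxE. Qed.
Lemma rsubmxZ a x : rsubmx (a *: x) = a *: rsubmx x.
Proof. by apply/rowP => i; rewrite !mxE. Qed.

Let sE := (x0D, x0N, x0Z, x0_pole, x0_axis, rsubmx_pole,
  rsubmx_axis, x0_row0, @row_mxKr, dotDl, dotNl, dotZl, dot0l, cc, dotN_c,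
  rsubmxD, rsubmxN, rsubmxZ).
Let simpr := (mulr0, mulr1, add0r, addr0, subr0, sub0r, oppr0, scale0r, scaler0).

Lemma P1P1 : P1 *m P1 = P1.
Proof.
by apply: mx_eq_row => x; rewrite mulmxA !mulP1 !sE !simpr.
Qed.

Lemma P1J1 : P1 *m J1 = J1.
Proof.
by apply: mx_eq_row => x; rewrite mulmxA !mulJ1 !mulP1 !sE !simpr.
Qed.

Lemma J1P1 : J1 *m P1 = J1.
Proof.
by apply: mx_eq_row => x; rewrite mulmxA !mulJ1 !mulP1 !sE !simpr scaleNr addrC.
Qed.

Lemma J1J1 : J1 *m J1 = - P1.
Proof.
apply: mx_eq_row => x; rewrite mulmxN mulmxA !mulJ1 !mulP1 !sE !simpr.
by rewrite scaleNr opprD addrC.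
Qed.

Lemma P1J2 : P1 *m J2 = 0.
Proof.
apply: mx_eq_row => x; rewrite mulmxA mulmx0 !mulJ2 !mulP1 !sE !simpr.
by rewrite -scalemxAl cN scaler0 row_mx0.
Qed.

Lemma J2P1 : J2 *m P1 = 0.
Proof.
by apply: mx_eq_row => x; rewrite mulmxA mulmx0 !mulJ2 !mulP1 !sE !simpr.
Qed.

Lemma J1J2 : J1 *m J2 = 0.
Proof. by rewrite -J1P1 -mulmxA P1J2 mulmx0. Qed.

Lemma J2J1 : J2 *m J1 = 0.
Proof. by rewrite -P1J1 mulmxA J2P1 mul0mx. Qed.

Lemma J2J2 : J2 *m J2 = - P2.
Proof.
apply: mx_eq_row => x; rewrite /P2 opprB mulmxBr mulmx1 mulmxA !mulJ2 mulP1 row_mxKr.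
rewrite -mulmxA NN mulmxBr mulmx1 mulmx_dot.
by apply: row_ext; rewrite !sE !simpr ?opprD ?addNKr //; ring.
Qed.

Lemma P1t : P1^T = P1.
Proof. by rewrite /polar_proj linearD /= !trmx_mul !trmxK. Qed.

Lemma J1t : J1^T = - J1.
Proof. by rewrite /J1 linearB /= !trmx_mul !trmxK opprB. Qed.

Lemma J2t : J2^T = - J2.
Proof. by rewrite /J2 tr_block_mx !trmx0 Nt opp_block_mx !oppr0. Qed.

Lemma P2P2 : P2 *m P2 = P2.
Proof. by rewrite /P2 mulmxBr mulmx1 mulmxBl mul1mx P1P1 subrr subr0. Qed.
Lemma P1P2 : P1 *m P2 = 0.
Proof. by rewrite /P2 mulmxBr mulmx1 P1P1 subrr. Qed.
Lemma P2P1 : P2 *m P1 = 0.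
Proof. by rewrite /P2 mulmxBl mul1mx P1P1 subrr. Qed.
Lemma P2J1 : P2 *m J1 = 0.
Proof. by rewrite /P2 mulmxBl mul1mx P1J1 subrr. Qed.
Lemma J1P2 : J1 *m P2 = 0.
Proof. by rewrite /P2 mulmxBr mulmx1 J1P1 subrr. Qed.
Lemma P2J2 : P2 *m J2 = J2.
Proof. by rewrite /P2 mulmxBl mul1mx P1J2 subr0. Qed.
Lemma J2P2 : J2 *m P2 = J2.
Proof. by rewrite /P2 mulmxBr mulmx1 J2P1 subr0. Qed.
Lemma P2t : P2^T = P2.
Proof. by rewrite /P2 linearB /= trmx1 P1t. Qed.

(** The multiplication table: [P1], [J1] and [P2], [J2] behave like 1, i in two copies of the
    complex numbers whose mutual products vanish. *)
Let tabE := (P1P1, P1J1, J1P1, J1J1, P1J2, J2P1, J1J2, J2J1, J2J2, P2P2, P1P2,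
  P2P1, P2J1, J1P2, P2J2, J2P2).

Lemma E_add s t : E (s + t) = E s *m E t.
Proof.
rewrite /E mulrDr !cosD !sinD !(mulmxDl, mulmxDr).
rewrite -!scalemxAl -!scalemxAr !tabE !scaler0 !addr0 !add0r.
move: P1 J1 P2 J2 => A1 B1 A2 B2; mxring.
Qed.

Lemma E0 : E 0 = 1%:M.
Proof.
by rewrite /E mulr0 cos0 sin0 !scale1r !scale0r !addr0 /P2 addrC subrK.
Qed.

Lemma Et t : (E t)^T = E (- t).
Proof.
have trE (a1 a2 a3 a4 : R) (A1 A2 A3 A4 : 'M[R]_(1 + d)) :
    (a1 *: A1 + a2 *: A2 + (a3 *: A3 + a4 *: A4))^T =
    a1 *: A1^T + a2 *: A2^T + (a3 *: A3^T + a4 *: A4^T) by mxring.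
by rewrite /E trE P1t P2t J1t J2t mulrN !cosN !sinN !scalerN !scaleNr.
Qed.

Lemma EN t : E t *m E (- t) = 1%:M.
Proof. by rewrite -E_add subrr E0. Qed.

Lemma E_J t : E t *m J = cos t *: J1 - sin t *: P1 +
    b *: (cos (b * t) *: J2 - sin (b * t) *: P2) /\ J *m E t = E t *m J.
Proof.
(* The relations are restated for arbitrary matrices, so that the entrywise ring computation meets
   opaque entries only. *)
have aux (A1 B1 A2 B2 : 'M[R]_(1 + d)) (e1 e2 e3 e4 : R) :
    A1 *m B1 = B1 -> B1 *m A1 = B1 -> B1 *m B1 = - A1 -> A1 *m B2 = 0 ->
    B2 *m A1 = 0 -> B1 *m B2 = 0 -> B2 *m B1 = 0 -> A2 *m B1 = 0 ->
    B1 *m A2 = 0 -> A2 *m B2 = B2 -> B2 *m A2 = B2 -> B2 *m B2 = - A2 ->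
    (e1 *: A1 + e2 *: B1 + (e3 *: A2 + e4 *: B2)) *m (B1 + b *: B2) =
      e1 *: B1 - e2 *: A1 + b *: (e3 *: B2 - e4 *: A2) /\
    (B1 + b *: B2) *m (e1 *: A1 + e2 *: B1 + (e3 *: A2 + e4 *: B2)) =
    (e1 *: A1 + e2 *: B1 + (e3 *: A2 + e4 *: B2)) *m (B1 + b *: B2).
  move=> h1 h2 h3 h4 h5 h6 h7 h8 h9 h10 h11 h12.
  rewrite !(mulmxDl, mulmxDr) -!scalemxAl -!scalemxAr.
  rewrite h1 h2 h3 h4 h5 h6 h7 h8 h9 h10 h11 h12 !scaler0.
  by split; mxring.
apply: aux; rewrite ?tabE //.
Qed.

Lemma E_commJ t : E t *m J = J *m E t. Proof. by have [] := E_J t. Qed.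

Lemma E_is_derive t : is_derive t (1 : R) E (E t *m J).
Proof.
rewrite (E_J t).1 /E.
move: P1 J1 P2 J2 => A1 B1 A2 B2; apply: is_derive_mx => i j; rewrite !mxE.
under eq_fun do rewrite !mxE.
have db : is_derive t (1 : R) (fun s => b * s) b.
  by apply: is_derive_eq (is_deriveZ b (is_derive_id t 1)) _; rewrite /GRing.scale /= mulr1.
have dcb : is_derive t (1 : R) (fun s => cos (b * s)) (- (b * sin (b * t))).
  by apply: is_derive_eq (is_derive1_comp (is_derive_cos (b * t)) db) _;
    rewrite /GRing.scale /=; ring.
have dsb : is_derive t (1 : R) (fun s => sin (b * s)) (b * cos (b * t)).
  by apply: is_derive_eq (is_derive1_comp (is_derive_sin (b * t)) db) _;
    rewrite /GRing.scale /=; ring.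
have -> : (fun s => cos s * A1 i j + sin s * B1 i j +
    (cos (b * s) * A2 i j + sin (b * s) * B2 i j)) =
  (fun s => A1 i j *: cos s + B1 i j *: sin s +
    (A2 i j *: cos (b * s) + B2 i j *: sin (b * s))).
  by apply/funext => s; rewrite /GRing.scale /=; ring.
apply: is_derive_eq (is_deriveD
  (is_deriveD (is_deriveZ (A1 i j) (is_derive_cos t)) (is_deriveZ (B1 i j) (is_derive_sin t)))
  (is_deriveD (is_deriveZ (A2 i j) dcb) (is_deriveZ (B2 i j) dsb))) _.
by rewrite /GRing.scale /=; ring.
Qed.

End flow.

Section killing_field.
Variables (R : realType) (d : nat) (c : 'rV[R]_d) (N : 'M[R]_d) (b : R).
Hypotheses (cc : dot c c = 1) (cN : c *m N = 0) (Nt : N^T = - N)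
  (NN : N *m N = c^T *m c - 1%:M) (b1 : 1 <= b).
Implicit Types (u v w : 'rV[R]_d) (x y : 'rV[R]_(1 + d)) (t : R) (s : bool).
Local Notation S := (sphere_charted R d).
Local Notation k := (b ^+ 2 - 1).
Local Notation J := (rot_gen c N b).
Local Notation E := (rot c N b).
Local Notation Q := (metric_den c k).
Local Notation g := (gmetric c k).
Local Notation height := (height c).

Let sE := (x0D, x0N, x0Z, x0_pole, x0_axis, rsubmx_pole,
  rsubmx_axis, x0_row0, @row_mxKr, dotDl, dotNl, dotZl, dot0l, cc, dotN_c cN Nt,
  rsubmxD, rsubmxN, rsubmxZ).

Lemma k_ge0 : 0 <= k.
Proof. by rewrite subr_ge0 -[leLHS](expr1n _ 2) lerXn2r ?nnegrE // (le_trans _ b1). Qed.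

Lemma dot_E t x y : dot (x *m E t) (y *m E t) = dot x y.
Proof. by rewrite dot_mulmx (Et _ b Nt) -mulmxA EN // mulmx1. Qed.

Lemma Jt : J^T = - J.
Proof.
rewrite linearD /= linearZ /= J1t J2t //.
by rewrite scalerN -opprD.
Qed.

Lemma dot_xJ x : dot x (x *m J) = 0.
Proof.
have h : dot x (x *m J) = - dot x (x *m J).
  by rewrite {1}dotC dot_mulmx Jt mulmxN dotNr.
lra.
Qed.

Lemma mulJ x : x *m J = coord0 x *: axis c - dot (rsubmx x) c *: pole R d +
  b *: row_mx 0 (rsubmx x *m N).
Proof. by rewrite mulmxDr -scalemxAr mulJ1 mulJ2. Qed.

(** The squared round length of the field is the function F of the overview. The norm condition
    removes the coordinates outside the first complex line. *)
Lemma dot_xJxJ x : dot x x = 1 -> dot (x *m J) (x *m J) = 1 + k * (1 - height x).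
Proof.
move=> xx; rewrite mulJ dot_x0 !sE.
rewrite !(dotDr, dotNr, dotZr, dotNN Nt NN, dot0r, mulr0, addr0, sub0r, oppr0).
rewrite (dotC c (_ *m N)) (dotN_c cN Nt) !cc.
rewrite (_ : height x = coord0 x ^+ 2 + dot (rsubmx x) c ^+ 2) //; rewrite dot_x0 in xx.
have -> : dot (rsubmx x) (rsubmx x) = 1 - coord0 x * coord0 x by rewrite -xx addrC addKr.
ring.
Qed.

Lemma flow_in t (x : S) : (sphere_val x *m E t : 'rV[R]_(d.+1)) \in @sphere R d.
Proof. by apply: sphere_in; rewrite dot_E sphere_dot. Qed.

Definition flow t (x : S) : S :=
  exist _ (sphere_val x *m E t : 'rV[R]_(d.+1)) (flow_in t x).

(** Defined as the velocity of the flow, so that one expression makes sense in every chart; [velE]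
    identifies it with [vel_at]. *)
Definition vel : vfield S := fun ch u =>
  'D_(1 : R) (fun t => cmap ch (flow t (cinv ch u))) 0.

Lemma flow_is_derive s t x : coord0 (x *m E t) != (-1) ^+ s ->
  is_derive t (1 : R) (fun p => stproj s (x *m E p))
    (dproj s (x *m E t) (x *m E t *m J)).
Proof.
move=> xs; apply: proj_is_derive => //.
rewrite -mulmxA; apply: is_derive_mx => i j; rewrite (ord1 i) mxE.
have -> : (fun p => (x *m E p) 0 j) = \sum_l (fun p => x 0 l *: E p l j).
  by apply/funext => p; rewrite fct_sumE mxE.
apply: is_derive_sum => l; apply: is_deriveZ.
exact: is_derive_coord (E_is_derive b cc cN Nt NN t).
Qed.

(** Obtained by pushing [x *m J] through [dproj]. It is polynomial in [u], which is what makes the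
    field analytic. *)
Definition vel_at (s : bool) u : 'rV[R]_d :=
  ((-1) ^+ s * (dot u u - 1) / 2) *: c + b *: (u *m N) - ((-1) ^+ s * dot u c) *: u.

Lemma dproj_J s u : dproj s (stereo_inv s u) (stereo_inv s u *m J) = vel_at s u.
Proof.
rewrite mulJ /dproj sub1_x0_stereo rsubmx_stereo x0_stereo !sE.
rewrite !(mulr0, addr0, scaler0, subr0, mulr1, sub0r, oppr0).
have nz := dotuu1 u; have e1 : ((-1) ^+ s : R) ^+ 2 = 1 by rewrite sqrr_sign.
rewrite -scalemxAl scalerDr !scalerA /vel_at -[X in _ = _ + X]scaleNr.
congr (_ *: _ + _ *: _ + _ *: _); field => //.
Qed.

Lemma velE s : vel (stereo_chart R d s) = vel_at s.
Proof.
apply/funext => u; rewrite -dproj_J /vel.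
have [cu uE] : cdom (stereo_chart R d s) (cinv (stereo_chart R d s) u) /\ _ :=
  let: And5 _ h _ _ _ := stereo_chart_full R d s in h u.
have xs : coord0 (stereo_inv s u *m E 0) != (-1) ^+ s by rewrite E0 mulmx1.
have [_ dE] := flow_is_derive xs.
by move: dE; rewrite E0 mulmx1.
Qed.

Lemma dstereo_vel s u : dstereo s u (vel_at s u) = stereo_inv s u *m J.
Proof. by rewrite -dproj_J dstereo_dproj // dot_xJ. Qed.

Lemma vel_vector_field : vector_field vel.
Proof.
move=> _ _ [s ->] [s' ->] u Uu tau; rewrite !velE.
have idE : @id S = @og_act R d (polar_proj c) (og_one (polar_proj c)).
  by apply/funext => x; apply/val_inj; rewrite /= trmx1 mulmx1.
move: @tau Uu; rewrite idE => tau Uu.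
have [_ Fx dF] := og_act_is_derive (vel_at s u) Uu.
apply: (@dstereo_inj _ _ s' (tau u)).
rewrite dF !dstereo_vel [stereo_inv s' (tau u)]Fx /= trmx1 !mulmx1 //.
Qed.

Lemma rat_vel_at (U : set 'rV[R]_d) s : rat_mx U (vel_at s).
Proof.
have rd : rat_on U (fun u => dot u u).
  by apply: rat_ext (rat_sqnorm (@rat_mx_id R d U)) => u _; rewrite sqnormE.
have rc : rat_on U (fun u => dot u c).
  apply: (@rat_sum _ _ U _ _ xpredT) => i.
  by apply: rat_mul; [exact: rat_coord|exact: rat_cst].
apply: rat_mx_sub.
  apply: rat_mx_add; apply: rat_mx_scale.
  - apply: rat_mul; last exact: rat_cst.
    by apply: rat_mul; [exact: rat_cst|apply: rat_sub => //; exact: rat_cst].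
  - exact: rat_mx_cst.
  - exact: rat_cst.
  - by apply: rat_mx_mul; [exact: rat_mx_id|exact: rat_mx_cst].
apply: rat_mx_scale; last exact: rat_mx_id.
by apply: rat_mul => //; exact: rat_cst.
Qed.

Lemma vel_smooth : smooth_vector_field vel.
Proof.
split; first exact: vel_vector_field.
move=> _ [s ->]; rewrite velE (full_chart_cimg (stereo_chart_full R d s)).
by apply: rat_mx_smooth; [exact: openT|exact: rat_vel_at].
Qed.

Lemma vel_analytic : analytic_vector_field vel.
Proof.
split; first exact: vel_vector_field.
move=> _ [s ->] i a _; rewrite velE; apply: polyf_analytic.
have rd : polyf a (fun u => dot u u).
  by apply: (@polyf_sum _ _ a _ _ xpredT) => j; apply: polyf_mul; exact: polyf_coord.
have rc : polyf a (fun u => dot u c).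
  apply: (@polyf_sum _ _ a _ _ xpredT) => j.
  by apply: polyf_mul; [exact: polyf_coord|exact: polyf_cst].
have -> : (fun u => vel_at s u 0 i) = fun u =>
    ((-1) ^+ s / 2 * c 0 i) * (dot u u + (-1)) +
    (b * (\sum_j u 0 j * N j i) + (- (-1) ^+ s) * (dot u c * u 0 i)).
  by apply/funext => u; rewrite !mxE; ring.
apply: polyf_add.
  apply: polyf_mul; first exact: polyf_cst.
  by apply: polyf_add => //; exact: polyf_cst.
apply: polyf_add; apply: polyf_mul; try exact: polyf_cst.
  apply: (@polyf_sum _ _ a _ _ xpredT) => j.
  by apply: polyf_mul; [exact: polyf_coord|exact: polyf_cst].
by apply: polyf_mul => //; exact: polyf_coord.
Qed.

Definition gradQ u : 'rV[R]_d :=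
  (4 * (dot u u + 1)) *: u + (8 * k) *: (u - dot u c *: c).

Lemma Q_is_derive u v : is_derive u v Q (dot v (gradQ u)).
Proof.
have du := dot_is_derive (is_derive_id u v) (is_derive_id u v).
have dc := dot_is_derive (is_derive_id u v) (is_derive_cst c u v).
have du1 : is_derive u v (fun w => dot w w + 1) (dot u v + dot v u + 0).
  exact: (is_deriveD du (is_derive_cst (1 : R) u v)).
have -> : Q = (fun w => (dot w w + 1) * (dot w w + 1) +
    (4 * k) *: (dot w w - dot w c * dot w c)).
  by apply/funext => w; rewrite /Q !expr2.
apply: is_derive_eq (is_deriveD (is_deriveM du1 du1)
  (is_deriveZ (4 * k) (is_deriveB du (is_deriveM dc dc)))) _.
rewrite /gradQ /GRing.scale /= !(dotDr, dotNr, dotZr, dot0r) /cst /= (dotC u v).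
by ring.
Qed.

Lemma vel_gradQ s u : dot (vel_at s u) (gradQ u) = - 2 * (-1) ^+ s * dot u c * Q u.
Proof.
rewrite /gradQ /vel_at !(dotDl, dotDr, dotNl, dotNr, dotZl, dotZr).
rewrite (dotNu Nt) (dotN_c cN Nt) cc (dotC c u) /Q.
by field.
Qed.

Lemma vel_at_is_derive s u v : is_derive u v (vel_at s)
  (((-1) ^+ s * dot u v) *: c + b *: (v *m N)
   - ((-1) ^+ s) *: (dot v c *: u + dot u c *: v)).
Proof.
have du := dot_is_derive (is_derive_id u v) (is_derive_id u v).
have dc := dot_is_derive (is_derive_id u v) (is_derive_cst c u v).
have dN := is_derive_mulmxr N (is_derive_id u v).
apply: is_derive_mx => i j; rewrite (ord1 i) !mxE.
have -> : (fun w => vel_at s w 0 j) = (fun w =>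
   ((-1) ^+ s / 2 * c 0 j) *: (dot w w - 1) + b *: (w *m N) 0 j
   - ((-1) ^+ s) *: (dot w c * w 0 j)).
  by apply/funext => w; rewrite !mxE /GRing.scale /=; ring.
apply: is_derive_eq (is_deriveB (is_deriveD
  (is_deriveZ ((-1) ^+ s / 2 * c 0 j) (is_deriveB du (is_derive_cst (1 : R) u v)))
  (is_deriveZ b (is_derive_coord 0 j dN)))
  (is_deriveZ ((-1) ^+ s) (is_deriveM dc (is_derive_coord 0 j (is_derive_id u v))))) _.
rewrite /GRing.scale /= !mxE dot0r (dotC v u) /cst /=.
by field.
Qed.

Lemma dot_delta u i : dot u (delta_mx 0 i) = u 0 i.
Proof.
rewrite /dot (bigD1 i) //= mxE !eqxx mulr1 big1 ?addr0 // => j /negbTE ji.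
by rewrite mxE ji andbF mulr0.
Qed.

Lemma gmetric_is_derive u v i j : is_derive u v (fun w => ((4 / Q w)%:M : 'M[R]_d) i j)
  ((i == j)%:R * (- 4 * dot v (gradQ u) / Q u ^+ 2)).
Proof.
have Qn : Q u != 0 by rewrite gt_eqF // Q_gt0 // k_ge0.
have Vd : is_derive u v (fun w => (Q w)^-1) (- dot v (gradQ u) / Q u ^+ 2).
  have [d1 dE] := Q_is_derive u v; split; first exact: derivableV.
  by rewrite deriveV // dE /GRing.scale /=; field.
have -> : (fun w => ((4 / Q w)%:M : 'M[R]_d) i j) = (fun w => ((i == j)%:R * 4) *: (Q w)^-1).
  by apply/funext => w; rewrite mxE /GRing.scale /= -mulrA [RHS]mulr_natl.
apply: is_derive_eq (is_deriveZ _ Vd) _.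
by rewrite /GRing.scale /=; ring.
Qed.

(** The field is conformal for the Euclidean metric: [N] is skew and the terms in [u] and [c]
    cancel, so the symmetrised Jacobian is a multiple of the identity, namely
    [- 2 * (-1) ^+ s * dot u c]. By [vel_gradQ] the derivative of [4 / Q] along the field
    compensates it exactly. *)
Lemma vel_killing : killing g vel.
Proof.
split; first exact: vel_smooth.
move=> _ [s ->] u _ i j; rewrite velE /lie_derivative !big_split /=.
have Qn : Q u != 0 by rewrite gt_eqF // Q_gt0 // k_ge0.
have pg (l : 'I_d) : partial l (fun w => g (stereo_chart R d s) w i j) u =
    (i == j)%:R * (- 4 * gradQ u 0 l / Q u ^+ 2).
  rewrite /partial (@derive_val _ _ _ _ _ _ _ (gmetric_is_derive u (delta_mx 0 l) i j)).
  by rewrite dotC dot_delta.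
have pX (l m : 'I_d) : partial l (fun w => vel_at s w 0 m) u =
    (-1) ^+ s * u 0 l * c 0 m + b * N l m
    - (-1) ^+ s * (c 0 l * u 0 m + dot u c * (l == m)%:R).
  rewrite /partial (@derive_val _ _ _ _ _ _ _
    (is_derive_coord 0 m (vel_at_is_derive s u (delta_mx 0 l)))).
  rewrite dot_delta dotC dot_delta -rowE !mxE eqxx /=.
  by rewrite (eq_sym m) -mulrA.
rewrite (_ : \sum_l _ = (i == j)%:R * (- 4 / Q u ^+ 2) * dot (vel_at s u) (gradQ u)); last first.
  by rewrite /dot big_distrr /=; apply: eq_bigr => l _; rewrite pg; ring.
rewrite vel_gradQ.
have gE (l m : 'I_d) : g (stereo_chart R d s) u l m = (l == m)%:R * (4 / Q u).
  by rewrite /gmetric mxE [RHS]mulr_natl.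
have sumg l (F : 'I_d -> R) (e : R) : \sum_(m < d) (m == l)%:R * e * F m = e * F l.
  rewrite (bigD1 l) //= eqxx mul1r big1 ?addr0 // => m /negbTE ml.
  by rewrite ml !mul0r.
pose dX (l q : 'I_d) := (-1) ^+ s * u 0 l * c 0 q + b * N l q
  - (-1) ^+ s * (c 0 l * u 0 q + dot u c * (l == q)%:R).
transitivity ((i == j)%:R * (- 4 / Q u ^+ 2) * (- 2 * (-1) ^+ s * dot u c * Q u)
    + 4 / Q u * dX i j + 4 / Q u * dX j i).
  congr (_ + _ + _).
    transitivity (\sum_(l < d) (l == j)%:R * (4 / Q u) * dX i l).
      by apply: eq_bigr => l _; congr (_ * _); [exact: gE|exact: pX].
    exact: sumg.
  transitivity (\sum_(l < d) (l == i)%:R * (4 / Q u) * dX j l).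
    apply: eq_bigr => l _; congr (_ * _); last exact: pX.
    by rewrite eq_sym; exact: gE.
  exact: sumg.
rewrite /dX (eq_sym j i).
have -> : N j i = - N i j by have /matrixP/(_ i j) := Nt; rewrite !mxE.
by field.
Qed.

Lemma vel_unit : unit_length g vel.
Proof.
move=> _ [s ->] u _; rewrite velE /gmetric inner_scalar.
have := dot_dstereo s u (vel_at s u) (vel_at s u).
have xx : dot (stereo_inv s u) (stereo_inv s u) = 1.
  exact: (sphere_dot (cinv (stereo_chart R d s) u)).
rewrite dstereo_vel dot_xJxJ // (metric_den_stereo c k s) => e.
have nz := dotuu1 u.
have k0 := k_ge0; have /andP[_ h1] := height_bound cc xx.
have F0 : 1 + k * (1 - height (stereo_inv s u)) != 0.
  by rewrite gt_eqF // ltr_pwDl // mulr_ge0 // subr_ge0.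
rewrite invfM mulrA mulrAC -e mulfV //.
Qed.

End killing_field.

(** * Periods, and the integral curves of the field *)

Lemma is_derive_mulmx (R : realType) m n (f : R -> 'rV[R]_m) (df : 'rV[R]_m)
    (M : R -> 'M[R]_(m, n)) (dM : 'M[R]_(m, n)) (t : R) :
  is_derive t (1 : R) f df -> is_derive t (1 : R) M dM ->
  is_derive t (1 : R) (fun p => f p *m M p) (df *m M t + f t *m dM).
Proof.
move=> fd Md; apply: is_derive_mx => i j; rewrite (ord1 i) !mxE -big_split /=.
have -> : (fun p => (f p *m M p) 0 j) = \sum_k (fun p => f p 0 k * M p k j).
  by apply/funext => p; rewrite fct_sumE mxE.
apply: is_derive_sum => k.
apply: is_derive_eq (is_deriveM (is_derive_coord 0 k fd) (is_derive_coord k j Md)) _.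
by rewrite /GRing.scale /=; ring.
Qed.

Section periods.
Variable R : realType.
Implicit Types t : R.
Local Notation pi2 := (pi *+ 2 : R).

Lemma pi2_gt0 : 0 < pi2. Proof. by rewrite mulrn_wgt0 // pi_gt0. Qed.

Lemma cos_neq1 t : 0 < t < pi2 -> cos t != 1.
Proof.
move=> /andP[t0 t2]; have s0 : 0 < sin (t / 2).
  apply: sin_gt0_pi; rewrite divr_gt0 //= ltr_pdivrMr // mulr_natr //.
have -> : t = (t / 2) *+ 2 by rewrite -mulr_natr divfK // pnatr_eq0.
rewrite cos_mulr2n cos2sin2 lt_eqF //.
have : 0 < sin (t / 2) ^+ 2 by rewrite exprn_gt0.
lra.
Qed.

Lemma cosD2pin t (j : nat) : cos (t + pi2 *+ j) = cos t.
Proof. exact: (periodicn (@cosD2pi R)). Qed.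

Lemma cos2pin (j : nat) : cos (pi2 *+ j) = 1.
Proof. by rewrite -[X in cos X]add0r cosD2pin cos0. Qed.

Lemma cos_eq1 t : 0 <= t -> cos t = 1 -> exists j : nat, t = pi2 *+ j.
Proof.
move=> t0 ct; have p0 := pi2_gt0; pose j := Num.truncn (t / pi2).
have /andP[j1 j2] : j%:R <= t / pi2 < j.+1%:R.
  by apply: truncn_itv; rewrite divr_ge0 // ltW.
exists j; apply/eqP; rewrite -subr_eq0.
move: j1 j2; rewrite ler_pdivlMr // ltr_pdivrMr // !mulr_natl (mulrS pi2 j) => j1 j2.
have r0 : 0 <= t - pi2 *+ j by rewrite subr_ge0.
rewrite eq_le r0 andbT leNgt; apply/negP => r1.
have : cos (t - pi2 *+ j) != 1.
  by apply: cos_neq1; rewrite r1 ltrBlDr.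
by rewrite -(cosD2pin _ j) subrK ct eqxx.
Qed.

Lemma cos_eq1_le t : 0 < t -> cos t = 1 -> pi2 <= t.
Proof.
move=> t0 ct; rewrite leNgt; apply/negP => t2.
by have := @cos_neq1 t; rewrite t0 t2 ct eqxx => /(_ isT).
Qed.

Lemma cos1_sin0 t : cos t = 1 -> sin t = 0.
Proof. by move=> ct; apply: cos1sin0; rewrite ct normr1. Qed.

(** Writing [t = pi2 *+ j] and the other angle as [pi2 *+ i] gives [m.+1 * j = m * i]. Consecutive
    integers are coprime, so [m] divides [j], which is positive. *)
Lemma cos_eq1_both (m : nat) t : (0 < m)%N -> 0 < t -> cos t = 1 ->
  cos (m.+1%:R / m%:R * t) = 1 -> pi2 *+ m <= t.
Proof.
move=> m0 t0 /(cos_eq1 (ltW t0))[j tj] /cos_eq1[|i ti].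
  by apply: mulr_ge0; [exact: divr_ge0|exact: ltW].
have p0 := pi2_gt0; have pn : pi2 != 0 by rewrite gt_eqF.
have mn : (m%:R : R) != 0 by rewrite pnatr_eq0 -lt0n.
have : (m.+1 * j = m * i)%N.
  apply/eqP; rewrite -(eqr_nat R) !natrM; apply/eqP/(mulIf pn).
  move: ti; rewrite tj -[pi2 *+ j]mulr_natl -[pi2 *+ i]mulr_natl => ti.
  by rewrite -!mulrA -ti; field.
move=> mj; have /dvdn_leq : (m %| j)%N.
  rewrite -(@Gauss_dvdr m m.+1); first by rewrite mj dvdn_mulr.
  exact: coprimenS.
rewrite tj => mlj; rewrite ler_pMn2l // mlj //.
by move: t0; rewrite tj lt0n; apply: contraTneq => ->; rewrite mulr0n ltxx.
Qed.

End periods.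

Section integral_curves.
Variables (R : realType) (d : nat) (c : 'rV[R]_d) (N : 'M[R]_d) (b : R).
Hypotheses (cc : dot c c = 1) (cN : c *m N = 0) (Nt : N^T = - N)
  (NN : N *m N = c^T *m c - 1%:M) (b1 : 1 <= b).
Implicit Types (u v w : 'rV[R]_d) (x y : 'rV[R]_(1 + d)) (t : R) (s : bool).
Local Notation S := (sphere_charted R d).
Local Notation k := (b ^+ 2 - 1).
Local Notation J := (rot_gen c N b).
Local Notation E := (rot c N b).
Local Notation g := (gmetric c k).
Local Notation height := (height c).
Local Notation vel := (@vel R d c N b cc cN Nt NN).
Local Notation flow := (@flow R d c N b cc cN Nt NN).

Lemma mulE_is_derive x t : is_derive t (1 : R) (fun p => x *m E p) (x *m E t *m J).
Proof.
have := is_derive_mulmx (is_derive_cst x t (1 : R)) (E_is_derive b cc cN Nt NN t).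
by rewrite mul0mx add0r mulmxA.
Qed.

Lemma flow_integral_curve (x : S) : integral_curve vel (fun t => flow t x).
Proof.
split.
  move=> t; apply: continuous_to_sphere.
  apply: differentiable_continuous; apply/derivable1_diffP.
  by have [] := mulE_is_derive (sphere_val x) t.
move=> t _ [s ->] xs; rewrite velE -dproj_J //.
have -> : stereo_inv s (cmap (stereo_chart R d s) (flow t x)) = sphere_val x *m E t.
  exact: stereo_proj (sphere_dot (flow t x)) xs.
exact: flow_is_derive.
Qed.

Lemma flow0 (x : S) : flow 0 x = x.
Proof. by apply: sphere_val_inj; rewrite /sphere_val /= E0 mulmx1. Qed.

(** Lifting by [stereo_inv] removes the charts: in the ambient space an integral curve solves a
    linear equation with constant coefficients. *)
Lemma integral_curve_is_derive gamma t : integral_curve vel gamma ->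
  is_derive t (1 : R) (fun p => sphere_val (gamma p)) (sphere_val (gamma t) *m J).
Proof.
move=> [cg dg]; have [ac cx] := sphere_chart_at (gamma t).
have := dg t _ ac cx; case: ac cx => s ->; rewrite velE => cx du.
have inv p : cdom (stereo_chart R d s) (gamma p) ->
    stereo_inv s (cmap (stereo_chart R d s) (gamma p)) = sphere_val (gamma p).
  by move=> ps; exact: stereo_proj (sphere_dot (gamma p)) ps.
have := stereo_is_derive s du; rewrite dstereo_vel // inv //.
apply: near_eq_is_derive.
have [oc _ _ _ _] := stereo_chart_full R d s.
apply: (@filterS _ (nbhs t) _ (gamma @^-1` cdom (stereo_chart R d s))).
  by move=> p; exact: inv.
exact: (cg t _ (open_nbhs_nbhs (conj oc cx))).
Qed.

(** Since [J] commutes with [E], the product of the curve with [E (- t)] has zero derivative. Claims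
    about all integral curves thereby become claims about the flow. *)
Lemma integral_curve_unique gamma t : integral_curve vel gamma ->
  sphere_val (gamma t) = sphere_val (gamma 0) *m E t.
Proof.
move=> ig; pose W p := sphere_val (gamma p) *m E (- p).
have Wd p : is_derive p (1 : R) W 0.
  have Ed : is_derive p (1 : R) (fun q => E (- q)) (- (E (- p) *m J)).
    apply: is_derive_mx => i j; rewrite mxE.
    have := is_derive_coord i j (E_is_derive b cc cN Nt NN (- p)) => e.
    apply: is_derive_eq (is_derive1_comp e (is_deriveNid p (1 : R))) _.
    by rewrite mulrN1.
  have := is_derive_mulmx (integral_curve_is_derive p ig) Ed.
  by rewrite mulmxN -mulmxA -E_commJ // mulmxA -mulmxA subrr.
have Wc : W t = W 0.
  apply/matrixP => i j; apply: (@is_derive_0_is_cst R (fun p => W p i j)) => p.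
  by have := is_derive_coord i j (Wd p); rewrite mxE.
have : W t *m E t = W 0 *m E t by rewrite Wc.
by rewrite /W oppr0 E0 mulmx1 -mulmxA -E_add // addNr E0 mulmx1.
Qed.

Lemma speed_eq1 gamma t : integral_curve vel gamma -> speed g gamma t = 1.
Proof.
move=> [cg dg]; have [ac cx] := sphere_chart_at (gamma t).
have [_ dE] := dg t _ ac cx.
rewrite /speed dE (vel_unit cc cN Nt NN b1) ?sqrtr1 //.
by exists (gamma t).
Qed.

Lemma integral_curve_length gamma (T : R) : integral_curve vel gamma -> 0 <= T ->
  curve_length g gamma 0 T = T.
Proof.
move=> ig T0; rewrite /curve_length.
under eq_Rintegral do rewrite speed_eq1 //.
rewrite Rintegral_cst // mul1r.
have := @lebesgue_measure_itv R `[0, T]; rewrite /= lte_fin.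
move: T0; rewrite le_eqVlt => /orP[/eqP <-|T0].
  by rewrite ltxx => ->.
by rewrite T0 -EFinB subr0 => ->.
Qed.

(** Pair the fixed point equation with the two components of [x]. The skew parts contribute nothing,
    leaving h = cos t h and 1 - h = cos(b t) (1 - h) for h the height of [x]. *)
Lemma fixed_cos x t : dot x x = 1 -> x *m E t = x ->
  (height x != 0 -> cos t = 1) /\ (height x != 1 -> cos (b * t) = 1).
Proof.
move=> xx xt.
have xP1 : dot (x *m polar_proj c) x = height x.
  by rewrite -{1}(P1P1 cc) mulmxA dot_mulmx P1t -heightE.
have xJ1 : dot (x *m polar_rot c) x = 0.
  have := dot_mulmx x x (polar_rot c); rewrite J1t mulmxN dotNr (dotC x) => h; lra.
have xJ2 : dot (x *m coaxial_rot N) x = 0.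
  have := dot_mulmx x x (coaxial_rot N); rewrite (J2t Nt) mulmxN dotNr (dotC x) => h; lra.
have xP2 : dot (x *m coaxial_proj c) x = 1 - height x.
  by rewrite /coaxial_proj mulmxBr mulmx1 dotDl dotNl xP1 xx.
have e1 : E t *m polar_proj c = cos t *: polar_proj c + sin t *: polar_rot c.
  rewrite /E !mulmxDl -!scalemxAl P1P1 // J1P1 // P2P1 // (J2P1 cN Nt) //.
  by rewrite !scaler0 !addr0.
have e2 : E t *m coaxial_proj c = cos (b * t) *: coaxial_proj c + sin (b * t) *: coaxial_rot N.
  rewrite /E !mulmxDl -!scalemxAl P1P2 // J1P2 // P2P2 // (J2P2 cN Nt) //.
  by rewrite !scaler0 !add0r.
have f1 : height x = cos t * height x.
  rewrite -{1}xP1 -{1}xt -mulmxA e1 mulmxDr -!scalemxAr dotDl !dotZl xP1 xJ1.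
  by rewrite mulr0 addr0.
have f2 : 1 - height x = cos (b * t) * (1 - height x).
  rewrite -{1}xP2 -{1}xt -mulmxA e2 mulmxDr -!scalemxAr dotDl !dotZl xP2 xJ2.
  by rewrite mulr0 addr0.
split=> h; first by apply: (mulIf h); rewrite mul1r.
have h' : 1 - height x != 0 by rewrite subr_eq0 eq_sym.
by apply: (mulIf h'); rewrite mul1r.
Qed.

Lemma fixed_height0 x t : height x = 0 -> cos (b * t) = 1 -> x *m E t = x.
Proof.
rewrite heightE // => /dot_eq0 x1 ct.
rewrite /E !mulmxDr -!scalemxAr ct (cos1_sin0 ct) scale1r scale0r addr0.
rewrite -(P1J1 cc) mulmxA x1 mul0mx !scaler0 !add0r.
by rewrite /coaxial_proj mulmxBr mulmx1 x1 subr0.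
Qed.

Lemma fixed_height1 x t : dot x x = 1 -> height x = 1 -> cos t = 1 -> x *m E t = x.
Proof.
move=> xx h ct; have x2 : x *m coaxial_proj c = 0.
  apply: dot_eq0; rewrite dot_mulmx P2t -mulmxA P2P2 // /coaxial_proj mulmxBr mulmx1 dotDr dotNr xx.
  by rewrite -{1}(P1P1 cc) mulmxA dotC dot_mulmx P1t -heightE // h subrr.
rewrite /E !mulmxDr -!scalemxAr ct (cos1_sin0 ct) scale1r scale0r addr0.
rewrite -(P2J2 cN) mulmxA x2 mul0mx !scaler0 !addr0.
by move: x2; rewrite /coaxial_proj mulmxBr mulmx1 => /eqP; rewrite subr_eq0 => /eqP.
Qed.

(** Uniqueness turns a coincidence of the curve at times [s < t] into a return to the starting point
    at time [t - s], which lies strictly between 0 and [T]. *)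
Lemma simple_closed_curve gamma (T : R) : integral_curve vel gamma -> 0 < T ->
  sphere_val (gamma 0) *m E T = sphere_val (gamma 0) ->
  (forall t, 0 < t < T -> sphere_val (gamma 0) *m E t != sphere_val (gamma 0)) ->
  simple_closed gamma T.
Proof.
move=> ig T0 fT nT; split => //.
  move=> t; apply: sphere_val_inj.
  rewrite (integral_curve_unique (t + T) ig) (integral_curve_unique t ig).
  by rewrite addrC E_add // mulmxA fT.
have aux (s t : R) : 0 <= s < T -> 0 <= t < T -> gamma s = gamma t -> s < t -> False.
  move=> /andP[s0 sT] /andP[t0 tT] st lst.
  have ts : 0 < t - s < T by rewrite subr_gt0 lst (le_lt_trans _ tT) // gerBl.
  have /eqP := nT _ ts; apply.
  have : sphere_val (gamma t) *m E (- s) = sphere_val (gamma s) *m E (- s) by rewrite st.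
  rewrite (integral_curve_unique t ig) (integral_curve_unique s ig).
  rewrite -!mulmxA -!E_add // subrr E0 mulmx1.
  by move=> ->.
move=> s t hs ht st; case: (ltgtP s t) => // lt.
  by have := aux _ _ hs ht st lt.
by have := aux _ _ ht hs (esym st) lt.
Qed.

End integral_curves.

(** * Curvature *)

Section conformally_flat.
Variables (R : realType) (d : nat) (phi : 'rV[R]_d -> R) (p : 'rV[R]_d -> 'rV[R]_d)
  (H : 'rV[R]_d -> 'M[R]_d).
Implicit Types (u v w a e z : 'rV[R]_d).
Hypotheses (phi0 : forall u, phi u != 0)
  (dphi : forall u v, is_derive u v phi (2 * phi u * dot (p u) v))
  (dp : forall u v, is_derive u v p (v *m H u))
  (Ht : forall u, (H u)^T = H u).

Local Notation g := (fun u => (phi u)%:M : 'M[R]_d).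

(* gam and curv are the Christoffel symbols and the curvature tensor as
   multilinear maps on vectors; p is half the gradient of ln phi and H its
   derivative. *)
Definition gam u a e : 'rV[R]_d :=
  dot (p u) a *: e + dot (p u) e *: a - dot a e *: p u.

Definition dgam u z a e : 'rV[R]_d :=
  dot (z *m H u) a *: e + dot (z *m H u) e *: a - dot a e *: (z *m H u).

Definition curv u a e z : 'rV[R]_d :=
  dgam u a e z - dgam u e a z + (gam u a (gam u e z) - gam u e (gam u a z)).

Lemma linear_expand (f : 'rV[R]_d -> R) v :
  (forall (t : R) a e, f (t *: a + e) = t * f a + f e) ->
  f v = \sum_i f (delta_mx 0 i) * v 0 i.
Proof.
move=> lf; have f0 : f 0 = 0.
  by have := lf (-1) 0 0; rewrite scaler0 addr0 mulN1r addNr.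
rewrite {1}(row_sum_delta v); elim/big_rec2: _ => // i y1 y2 _ <-.
by rewrite lf mulrC.
Qed.

Lemma christoffelE k i j u :
  christoffel g k i j u = gam u (delta_mx 0 i) (delta_mx 0 j) 0 k.
Proof.
have pg (l i' j' : 'I_d) : partial l (fun w => ((phi w)%:M : 'M[R]_d) i' j') u =
    (i' == j')%:R * (2 * phi u * p u 0 l).
  rewrite /partial (_ : (fun w => _) = (fun w => (i' == j')%:R *: phi w)).
    rewrite (@derive_val _ _ _ _ _ _ _ (is_deriveZ ((i' == j')%:R) (dphi u (delta_mx 0 l)))).
    by rewrite dot_delta.
  by apply/funext => w; rewrite mxE /GRing.scale /= [RHS]mulr_natl.
rewrite /christoffel (bigD1 k) //= big1 ?addr0 => [|l lk]; last first.
  by rewrite invmx_scalar mxE eq_sym (negbTE lk) mul0r.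
rewrite !pg invmx_scalar mxE eqxx mulr1n /gam !dot_delta !mxE !eqxx /=.
rewrite !(eq_sym k) (eq_sym _ i); have := phi0 u => h.
by field.
Qed.

Lemma gam_is_derive u z a e : is_derive u z (fun w => gam w a e) (dgam u z a e).
Proof.
have da := dot_is_derive (dp u z) (is_derive_cst a u z).
have de := dot_is_derive (dp u z) (is_derive_cst e u z).
apply: is_derive_mx => i j; rewrite (ord1 i) !mxE.
have -> : (fun w => gam w a e 0 j) = (fun w => e 0 j *: dot (p w) a +
    a 0 j *: dot (p w) e - dot a e *: p w 0 j).
  by apply/funext => w; rewrite !mxE /GRing.scale /=; ring.
apply: is_derive_eq (is_deriveB (is_deriveD (is_deriveZ (e 0 j) da)
  (is_deriveZ (a 0 j) de)) (is_deriveZ (dot a e) (is_derive_coord 0 j (dp u z)))) _.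
by rewrite /GRing.scale /= !mxE !dot0r; ring.
Qed.

Let dotE' := (dotDl, dotDr, dotZl, dotZr, dotNl, dotNr).

Lemma gam_linr u a (t : R) e z j :
  gam u a (t *: e + z) 0 j = t * gam u a e 0 j + gam u a z 0 j.
Proof. by rewrite /gam !dotE' !mxE; ring. Qed.

Lemma riemannE l k i j u : riemann g l k i j u =
  curv u (delta_mx 0 i) (delta_mx 0 j) (delta_mx 0 k) 0 l.
Proof.
have pc (a b' e' : 'I_d) : partial a (christoffel g l b' e') u =
    dgam u (delta_mx 0 a) (delta_mx 0 b') (delta_mx 0 e') 0 l.
  rewrite (_ : christoffel g l b' e' =
    fun w => gam w (delta_mx 0 b') (delta_mx 0 e') 0 l); last first.
    by apply/funext => w; rewrite christoffelE.
  rewrite /partial; exact: (@derive_val _ _ _ _ _ _ _ (is_derive_coord 0 l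
    (gam_is_derive u (delta_mx 0 a) (delta_mx 0 b') (delta_mx 0 e')))).
rewrite /riemann !pc sumrB /curv [RHS]mxE [X in X + _ = _]/=.
rewrite [X in _ = X + _]mxE [X in _ = _ + X]mxE.
rewrite [X in _ = _ + X + _]mxE [X in _ = _ + (_ + X)]mxE.
congr (_ + (_ - _)).
  rewrite [RHS](@linear_expand (fun y => gam u (delta_mx 0 i) y 0 l)).
    by apply: eq_bigr => m _; rewrite !christoffelE.
  by move=> t a e; exact: gam_linr.
rewrite [RHS](@linear_expand (fun y => gam u (delta_mx 0 j) y 0 l)).
  by apply: eq_bigr => m _; rewrite !christoffelE.
by move=> t a e; exact: gam_linr.
Qed.

Lemma riemann_vecE u v w : riemann_vec g u v w = curv u v w w.
Proof.
apply/rowP => l; rewrite mxE.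
have lin1 e z (t : R) a a' : curv u (t *: a + a') e z 0 l =
    t * curv u a e z 0 l + curv u a' e z 0 l.
  by rewrite /curv /gam /dgam !(mulmxDl, =^~ scalemxAl, dotE') !mxE; ring.
have lin2 e z (t : R) a a' : curv u e (t *: a + a') z 0 l =
    t * curv u e a z 0 l + curv u e a' z 0 l.
  by rewrite /curv /gam /dgam !(mulmxDl, =^~ scalemxAl, dotE') !mxE; ring.
have lin3 e z (t : R) a a' : curv u e z (t *: a + a') 0 l =
    t * curv u e z a 0 l + curv u e z a' 0 l.
  by rewrite /curv /gam /dgam !(mulmxDl, =^~ scalemxAl, dotE') !mxE; ring.
rewrite [RHS](linear_expand (f := fun y => curv u y w w 0 l)) //.
apply: eq_bigr => i _.
rewrite (linear_expand (f := fun y => curv u _ y w 0 l)) // big_distrl /=.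
apply: eq_bigr => j _.
rewrite (linear_expand (f := fun y => curv u _ _ y 0 l)) // !big_distrl /=.
by apply: eq_bigr => k _; rewrite riemannE; ring.
Qed.

(* Kulkarni-Nomizu product of x (x) y with the Euclidean metric, on the plane
   spanned by v and w; for an orthonormal pair it is the trace of x (x) y. *)
Definition hat (x y v w : 'rV[R]_d) : R :=
  dot x v * dot y v * dot w w + dot x w * dot y w * dot v v
  - (dot x v * dot y w + dot x w * dot y v) * dot v w.

Definition gram v w : R := dot v v * dot w w - dot v w ^+ 2.

(** For [phi] = exp(2f), so that [p] is the gradient of f, and for an orthonormal pair, this is the
    classical formula K = exp(-2f) (f_v^2 + f_w^2 - |grad f|^2 - f_vv - f_ww). *)
Lemma sectionalE u v w : sectional g u v w =
  (hat (p u) (p u) v w - dot (p u) (p u) * gram v w -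
   (dot (v *m H u) v * dot w w + dot (w *m H u) w * dot v v
    - 2 * dot (v *m H u) w * dot v w)) / (phi u * gram v w).
Proof.
rewrite /sectional !inner_scalar riemann_vecE /gram.
have hs : dot (w *m H u) v = dot (v *m H u) w by rewrite dot_mulmx Ht dotC.
have -> : phi u * dot v v * (phi u * dot w w) - (phi u * dot v w) ^+ 2 =
  phi u * (phi u * (dot v v * dot w w - dot v w ^+ 2)) by ring.
rewrite -mulf_div divff // mul1r; congr (_ / _).
rewrite /curv /gam /dgam /hat !dotE' hs (dotC w v) (dotC v (p u)) (dotC w (p u)).
by ring.
Qed.

(** Equality in the Cauchy-Schwarz inequality would give the linear relation
    [dot w w *: v - dot v w *: w = 0] with a nonzero first coefficient. *)
Lemma gram_gt0 v w : free [:: v; w] -> 0 < gram v w.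
Proof.
move=> fvw; have w0 : w != 0 by apply: (free_not0 (v := w) fvw); rewrite !inE eqxx orbT.
have ww := dot_gt0 w0.
rewrite lt_def /gram subr_ge0 cauchy_schwarz andbT.
apply/eqP => D0; have : dot w w *: v - dot v w *: w = 0.
  apply: dot_eq0; rewrite !dotE' (dotC w v).
  transitivity (dot w w * (dot v v * dot w w - dot v w ^+ 2)); first by ring.
  by rewrite D0 mulr0.
move=> e; have /freeP/(_ (fun i : 'I_2 => if i == 0 then dot w w else - dot v w)) := fvw.
rewrite !big_ord_recl big_ord0 /= addr0 scaleNr e => /(_ erefl 0) /= /eqP.
by rewrite (gt_eqF ww).
Qed.

(** The quantity is the squared norm of [dot x v *: w - dot x w *: v]. *)
Lemma hat_ge0 x v w : 0 <= hat x x v w.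
Proof.
have := dot_ge0 (dot x v *: w - dot x w *: v); rewrite !dotE' (dotC w v) => h.
by congr (0 <= _): h; rewrite /hat; ring.
Qed.

(** Bessel's inequality: [y] is [gram v w] times the orthogonal projection of [x] to the plane of
    [v] and [w], and the squared norm of [gram v w *: x - y] is [gram v w] times the difference of
    the two sides. *)
Lemma hat_le x v w : 0 < gram v w -> hat x x v w <= dot x x * gram v w.
Proof.
move=> D0; pose y := (dot x v * dot w w - dot x w * dot v w) *: v
  + (dot x w * dot v v - dot x v * dot v w) *: w.
have := dot_ge0 (gram v w *: x - y); rewrite /y !dotE' (dotC w v) (dotC v x) (dotC w x) => h.
rewrite -(ler_pM2l D0) -subr_ge0; congr (0 <= _): h; rewrite /hat /gram; ring.
Qed.

End conformally_flat.

Section curvature_bound.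
Variables (R : realType) (d : nat) (c : 'rV[R]_d) (b : R).
Hypotheses (cc : dot c c = 1) (b1 : 1 <= b).
Implicit Types (u v w : 'rV[R]_d).
Local Notation k := (b ^+ 2 - 1).
Local Notation Q := (metric_den c k).
Local Notation gradQ := (gradQ c b).
Let k0 : 0 <= k := k_ge0 b1.
Let Qn u : Q u != 0. Proof. by rewrite gt_eqF // Q_gt0. Qed.

Definition hessQ u : 'M[R]_d := 8 *: (u^T *m u) + (4 * (dot u u + 1))%:M
  + (8 * k) *: (1%:M - c^T *m c).

Lemma mul_hessQ u v : v *m hessQ u = (8 * dot v u) *: u + (4 * (dot u u + 1)) *: v
  + (8 * k) *: (v - dot v c *: c).
Proof.
rewrite /hessQ !mulmxDr -!scalemxAr mulmx_dot mul_mx_scalar mulmxBr mulmx1 mulmx_dot.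
by rewrite scalerA.
Qed.

Lemma gradQ_is_derive u v : is_derive u v gradQ (v *m hessQ u).
Proof.
have di := is_derive_id u v.
have du := dot_is_derive di di.
have dc := dot_is_derive di (is_derive_cst c u v).
apply: is_derive_mx => i j; rewrite (ord1 i) mul_hessQ !mxE.
have dj := is_derive_coord 0 j di.
have du1 : is_derive u v (fun w => dot w w + 1) (dot u v + dot v u + 0).
  exact: (is_deriveD du (is_derive_cst (1 : R) u v)).
have -> : (fun w => gradQ w 0 j) = (fun w => 4 *: ((dot w w + 1) * w 0 j) +
    (8 * k) *: (w 0 j - c 0 j *: dot w c)).
  by apply/funext => w; rewrite !mxE /GRing.scale /=; ring.
apply: is_derive_eq (is_deriveD (is_deriveZ 4 (is_deriveM du1 dj))
  (is_deriveZ (8 * k) (is_deriveB dj (is_deriveZ (c 0 j) dc)))) _.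
by rewrite /GRing.scale /= dot0r (dotC u v); ring.
Qed.

(** Half the gradient of ln(4/Q), with [HQ] below as its derivative: the data that the conformal
    curvature formula asks for. *)
Definition pQ u : 'rV[R]_d := - (2 * Q u)^-1 *: gradQ u.

Definition HQ u : 'M[R]_d := - (2 * Q u)^-1 *: hessQ u
  + (2 * Q u ^+ 2)^-1 *: ((gradQ u)^T *m gradQ u).

Lemma mul_HQ u v : v *m HQ u = - (2 * Q u)^-1 *: (v *m hessQ u)
  + (dot v (gradQ u) / (2 * Q u ^+ 2)) *: gradQ u.
Proof.
by rewrite /HQ mulmxDr -!scalemxAr mulmx_dot scalerA (mulrC (dot v _)).
Qed.

Lemma Qinv_is_derive u v :
  is_derive u v (fun w => (Q w)^-1) (- dot v (gradQ u) / Q u ^+ 2).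
Proof.
have [d1 dE] := Q_is_derive c b u v; split; first exact: derivableV.
by rewrite deriveV // dE /GRing.scale /=; field; rewrite Qn.
Qed.

Lemma phi_is_derive u v : is_derive u v (fun w => 4 / Q w)
  (2 * (4 / Q u) * dot (pQ u) v).
Proof.
apply: is_derive_eq (is_deriveZ 4 (Qinv_is_derive u v)) _.
by rewrite /pQ dotZl (dotC v) /GRing.scale /=; field; rewrite Qn.
Qed.

Lemma pQ_is_derive u v : is_derive u v pQ (v *m HQ u).
Proof.
apply: is_derive_mx => i j; rewrite (ord1 i) mul_HQ.
have -> : (fun w => pQ w 0 j) = (fun w => - 2^-1 *: ((Q w)^-1 * gradQ w 0 j)).
  by apply/funext => w; rewrite /pQ mxE invfM /GRing.scale /=; ring.
apply: is_derive_eq (is_deriveZ (- 2^-1) (is_deriveM (Qinv_is_derive u v)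
  (is_derive_coord 0 j (gradQ_is_derive u v)))) _.
rewrite /GRing.scale /= [RHS]mxE [X in _ = X + _]mxE [X in _ = _ + X]mxE.
by field; rewrite Qn.
Qed.

Lemma HQ_sym u : (HQ u)^T = HQ u.
Proof.
have st (a : 'rV[R]_d) : (a^T *m a)^T = a^T *m a by rewrite trmx_mul trmxK.
have tl (e1 e2 e3 : R) (A B : 'M[R]_d) : (e1 *: A + e2%:M + e3 *: (1%:M - B))^T =
    e1 *: A^T + e2%:M + e3 *: (1%:M - B^T).
  by apply/matrixP => i j; rewrite !mxE (eq_sym j).
have tl' (e1 e2 : R) (A B : 'M[R]_d) : (e1 *: A + e2 *: B)^T = e1 *: A^T + e2 *: B^T.
  by apply/matrixP => i j; rewrite !mxE.
by rewrite /HQ tl' st /hessQ tl !st.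
Qed.

Lemma hat_sqrD (x y v w : 'rV[R]_d) :
  hat (x + y) (x + y) v w = hat x x v w + 2 * hat x y v w + hat y y v w.
Proof. by rewrite /hat !dotDl; ring. Qed.

Lemma hat_sqrB (x y v w : 'rV[R]_d) :
  hat (x - y) (x - y) v w = hat x x v w - 2 * hat x y v w + hat y y v w.
Proof. by rewrite /hat !dotDl !dotNl; ring. Qed.

Lemma hat_scalel (t : R) (x y v w : 'rV[R]_d) : hat (t *: x) y v w = t * hat x y v w.
Proof. by rewrite /hat !dotZl; ring. Qed.

Lemma hat_scaler (t : R) (x y v w : 'rV[R]_d) : hat x (t *: y) v w = t * hat x y v w.
Proof. by rewrite /hat !dotZl; ring. Qed.

(** Multiplied by [Q u], the difference from 1 becomes [k] times an expression bounded by
    [20 * Q u], since [Q u] dominates [(q + 1) ^+ 2]. The estimate is therefore uniform over the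
    unbounded chart. The assumption on [b] means [k <= 1] and absorbs the term quadratic in [k]. *)
Lemma sectional_near1 u v w : b ^+ 2 <= 2 -> free [:: v; w] ->
  `|sectional (fun x => (4 / Q x)%:M) u v w - 1| <= 20 * k.
Proof.
move=> b2 /gram_gt0 D0.
have phn x : 4 / Q x != 0 by rewrite mulf_neq0 ?invr_eq0 ?Qn // pnatr_eq0.
rewrite (sectionalE phn phi_is_derive pQ_is_derive HQ_sym).
(* [r] is the part of [u] orthogonal to [c]. The gradient of [Q] is a combination of [u] and [r], so
   traces built from [u], [r] and [c] express the curvature. *)
pose r := u - dot u c *: c; set q := dot u u; pose rho := dot r r.
have rE : rho = q - dot u c ^+ 2.
  by rewrite /rho /r /q !(dotDl, dotDr, dotNl, dotNr, dotZl, dotZr) cc (dotC c u); ring.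
have ur : dot u r = rho.
  by rewrite rE /r /q !(dotDr, dotNr, dotZr); ring.
have cr : dot c r = 0.
  by rewrite /r !(dotDr, dotNr, dotZr) cc (dotC c u); ring.
have gE : gradQ u = (4 * (q + 1)) *: u + (8 * k) *: r by [].
clearbody r.
have QE : Q u = (q + 1) ^+ 2 + 4 * k * rho by rewrite rE.
set D := gram v w in D0 *.
have q0 : 0 <= q := dot_ge0 u.
have rho0 : 0 <= rho := dot_ge0 r.
have rq : rho <= q by rewrite rE gerBl sqr_ge0.
(* The traces over the tangent plane of u (x) u, r (x) r, c (x) c and, in [M], of u (x) r. They
   depend on the plane only, and the first three are bounded by Bessel's inequality. *)
pose A := hat u u v w / D; pose Rr := hat r r v w / D; pose C := hat c c v w / D.
pose M := hat u r v w / D.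
have Dn : D != 0 by rewrite gt_eqF.
have A01 : 0 <= A <= q by rewrite divr_ge0 ?hat_ge0 ?ler_pdivrMr ?hat_le // ltW.
have R01 : 0 <= Rr <= rho by rewrite divr_ge0 ?hat_ge0 ?ler_pdivrMr ?hat_le // ltW.
have C01 : 0 <= C <= 1.
  by rewrite divr_ge0 ?hat_ge0 ?ler_pdivrMr -?cc ?hat_le // ltW.
(* Positivity for [u + r] and [u - r] bounds the mixed trace: [2 * M] is at most [A + Rr] in
   absolute value. *)
have M1 : 0 <= A + 2 * M + Rr.
  have -> : A + 2 * M + Rr = hat (u + r) (u + r) v w / D.
    by rewrite hat_sqrD /A /M /Rr; field.
  by rewrite divr_ge0 ?hat_ge0 // ltW.
have M2 : 0 <= A - 2 * M + Rr.
  have -> : A - 2 * M + Rr = hat (u - r) (u - r) v w / D.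
    by rewrite hat_sqrB /A /M /Rr; field.
  by rewrite divr_ge0 ?hat_ge0 // ltW.
set K := (X in `|X - 1|).
have Q0 : 0 < Q u by rewrite Q_gt0.
(* The denominators are cleared. Every term carries a factor [k], as it must because [k = 0] is the
   round metric. *)
have KE : (K - 1) * Q u = 4 * k * rho * (A + q) + k * (2 - C) * Q u
    - 4 * k * (q + 1) * (M + rho) - 4 * k ^+ 2 * (Rr + rho).
  pose h (x y : 'rV[R]_d) := 8 * dot u x * dot u y + 4 * (q + 1) * dot x y
    + 8 * k * (dot x y - dot c x * dot c y).
  have hE (x y : 'rV[R]_d) : dot (x *m hessQ u) y = h x y.
    rewrite mul_hessQ /h /q !(dotDl, dotNl, dotZl) (dotC x u) (dotC x c).
    by ring.
  have HE (x y : 'rV[R]_d) : dot (x *m HQ u) y =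
      - (2 * Q u)^-1 * h x y + dot (gradQ u) x * dot (gradQ u) y / (2 * Q u ^+ 2).
    rewrite mul_HQ dotDl !dotZl hE (dotC x (gradQ u)); ring.
  have pp : dot (pQ u) (pQ u) = dot (gradQ u) (gradQ u) / (2 * Q u) ^+ 2.
    by rewrite /pQ dotZl dotZr; field; rewrite Qn.
  have hp : hat (pQ u) (pQ u) v w = hat (gradQ u) (gradQ u) v w / (2 * Q u) ^+ 2.
    by rewrite /pQ /hat !dotZl; field; rewrite Qn.
  have gg : dot (gradQ u) (gradQ u) = 16 * (q + 1) ^+ 2 * q
      + 64 * k * (q + 1) * rho + 64 * k ^+ 2 * rho.
    rewrite gE !(dotDl, dotDr, dotZl, dotZr) -/q -/rho ur (dotC r u) ur; ring.
  have hg : hat (gradQ u) (gradQ u) v w = (16 * (q + 1) ^+ 2 * A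
      + 64 * k * (q + 1) * M + 64 * k ^+ 2 * Rr) * D.
    rewrite gE hat_sqrD !hat_scalel !hat_scaler /A /M /Rr.
    by field.
  have hh : h v v * dot w w + h w w * dot v v - 2 * h v w * dot v w =
      8 * A * D + 8 * (q + 1) * D + 8 * k * (2 - C) * D.
    transitivity (8 * (A * D) + 8 * (q + 1) * D + 8 * k * (2 * D - C * D)).
      by rewrite /A /C !divfK // /h /hat /D /gram; ring.
    by ring.
  have -> : K = (hat (gradQ u) (gradQ u) v w / (2 * Q u) ^+ 2
      - dot (gradQ u) (gradQ u) / (2 * Q u) ^+ 2 * D
      + (h v v * dot w w + h w w * dot v v - 2 * h v w * dot v w) / (2 * Q u)
      - hat (gradQ u) (gradQ u) v w / (2 * Q u ^+ 2)) / (4 / Q u * D).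
    rewrite /K pp hp !HE /hat; field.
    by rewrite Dn Qn.
  rewrite hg hh gg; field: QE.
  by rewrite Qn Dn.
have k1 : k <= 1 by lra.
have Qge : (q + 1) ^+ 2 <= Q u by exact: Q_ge.
have e1 : q * rho <= (q + 1) ^+ 2 by nra.
rewrite -(ler_pM2r Q0) -{1}(gtr0_norm Q0) -normrM KE ler_norml.
have /andP[a0 a1] := A01; have /andP[r0 r1] := R01; have /andP[c0 c1] := C01.
have h1 : 0 <= rho * (A + q) <= 2 * Q u.
  apply/andP; split; first by rewrite mulr_ge0 // addr_ge0.
  apply: le_trans (_ : rho * (2 * q) <= _); first by rewrite ler_wpM2l //; lra.
  by apply: le_trans (_ : 2 * (q + 1) ^+ 2 <= _); [nra|rewrite ler_pM2l].
have h2 : 0 <= (2 - C) * Q u <= 2 * Q u.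
  by apply/andP; split; [rewrite mulr_ge0 ?(ltW Q0) //; lra|rewrite ler_pM2r //; lra].
have h3 : - (2 * Q u) <= (q + 1) * (M + rho) <= 2 * Q u.
  have hM : `|M + rho| <= 2 * q by rewrite ler_norml; lra.
  rewrite -ler_norml normrM ger0_norm; last lra.
  apply: le_trans (_ : (q + 1) * (2 * q) <= _); first by rewrite ler_wpM2l //; lra.
  by apply: le_trans (_ : 2 * (q + 1) ^+ 2 <= _); [nra|rewrite ler_pM2l].
have h4 : 0 <= k * (Rr + rho) <= 2^-1 * Q u.
  apply/andP; split; first by rewrite mulr_ge0 // addr_ge0.
  apply: le_trans (_ : 2 * q <= _).
    by apply: le_trans (_ : 1 * (Rr + rho) <= _); [rewrite ler_wpM2r //; lra|lra].
  apply: le_trans (_ : 2^-1 * (q + 1) ^+ 2 <= _); last by rewrite ler_pM2l.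
  rewrite -subr_ge0 (_ : _ - _ = 2^-1 * (q - 1) ^+ 2); last by field.
  by rewrite mulr_ge0 // sqr_ge0.
(* With the weights of the four terms, the bounds [h1] to [h4] add up to 8 + 2 + 8 + 2 = 20 times
   [Q u]. *)
have -> : 4 * k * rho * (A + q) + k * (2 - C) * Q u
    - 4 * k * (q + 1) * (M + rho) - 4 * k ^+ 2 * (Rr + rho) =
  k * (4 * (rho * (A + q)) + (2 - C) * Q u - 4 * ((q + 1) * (M + rho))
    - 4 * (k * (Rr + rho))) by ring.
have -> : 20 * k * Q u = k * (20 * Q u) by ring.
rewrite -mulrN !ler_wpM2l //; lra.
Qed.

End curvature_bound.

(** * The orbit space *)

Section interval_dimension.
Variables (R : realType) (X : topologicalType) (h : X -> R) (s : R -> X).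
Hypotheses (ch : continuous h) (cs : continuous s)
  (h01 : forall z, 0 <= h z <= 1) (shK : forall z, s (h z) = z)
  (hsK : forall t, 0 <= t <= 1 -> h (s t) = t).

(** Compactness of the segment, applied to preimages under [s]. The radius is halved so that a ball
    around a point near [t] stays in the ball found at [t]. *)
Lemma lebesgue_number (U : set (set X)) : open_cover U ->
  exists2 e : R, 0 < e & forall t, 0 <= t <= 1 ->
    exists2 A, U A & forall t', `|t' - t| < e -> A (s t').
Proof.
move=> [oU cU].
pose P (e : R) t := exists2 A, U A & forall t', `|t' - t| < e -> A (s t').
have : \forall e \near 0^'+, `[0, 1]%classic `<=` P e.
  apply: (compact_near_coveringP _).1; first exact: segment_compact.
  move=> t _; have [A UA At] : (\bigcup_(A in U) A) (s t) by rewrite cU.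
  have : nbhs t (s @^-1` A) by apply: cs; apply: open_nbhs_nbhs; split => //; exact: oU.
  move=> /nbhs_ballP[r /= r0 rA].
  exists (ball t (r / 2), [set e : R | e < r / 2]).
    split => /=; first by apply: nbhsx_ballx; rewrite divr_gt0.
    by apply: nbhs_right_lt; rewrite divr_gt0.
  move=> [t1 e] [/= t1t er]; exists A => // t' t't1; apply: rA.
  move: t1t t't1; rewrite /ball /= => h1 h2.
  rewrite (_ : t - t' = (t - t1) - (t' - t1)); last by ring.
  apply: le_lt_trans (ler_normB _ _) _; lra.
move=> nP; have [e [e0 eP]] : exists e, 0 < e /\ `[0, 1]%classic `<=` P e.
  near ((0 : R)^'+) => e; exists e; split; last by near: e.
  by near: e; exact: nbhs_right_gt.
by exists e => // t t01; apply: eP; rewrite /= in_itv.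
Unshelve. all: by end_near. Qed.

(** With 1/n below a Lebesgue number, the sets where [n%:R * h z] is at distance less than 1 from an
    integer [i <= n] refine the cover. A point lies in at most two of them: [i] is the integer part
    of [n%:R * h z] or its successor. *)
Lemma covering_dim_le1 : covering_dim_le X 1.
Proof.
move=> U cU; have [e e0 eU] := lebesgue_number cU.
pose n := (Num.truncn e^-1).+1.
have n0 : 0 < n%:R :> R by rewrite ltr0n.
have ne : n%:R^-1 < e.
  have ei : 0 <= e^-1 by rewrite invr_ge0 ltW.
  by have /andP[_ en] := truncn_itv ei; rewrite invf_plt ?posrE.
pose V (i : nat) : set X := [set z | `|n%:R * h z - i%:R| < 1].
have Vj z i : V i z -> let j := Num.truncn (n%:R * h z) in i = j \/ i = j.+1.
  move=> Vi j; have /andP[hz0 _] := h01 z.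
  have /andP[j0 j1] := truncn_itv (mulr_ge0 (ltW n0) hz0).
  move: Vi; rewrite /V /= ltr_norml => /andP[v1 v2].
  have : (i < j.+2)%N by rewrite -(ltr_nat R) -addn1 natrD -/j; lra.
  have : (j < i.+1)%N by rewrite -(ltr_nat R) -(addn1 i) natrD -/j; lra.
  rewrite !ltnS => ji; rewrite leq_eqVlt => /orP[/eqP ->|]; first by right.
  by rewrite ltnS => ij; left; apply/eqP; rewrite eqn_leq ij ji.
exists [set V i | i in [set i | (i <= n)%N]]; split.
- split.
    move=> _ [i _ <-]; apply: (@open_comp _ _ (fun z => n%:R * h z - i%:R) [set t | `|t| < 1]).
      move=> z _; apply: cvgB; last exact: cvg_cst.
      by apply: cvgMl_tmp; exact: ch.
    rewrite (_ : [set t | _] = ball 0 1); first exact: ball_open.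
    by apply/seteqP; split => t; rewrite /ball /= sub0r normrN.
  apply/seteqP; split => // z _.
  have /andP[hz0 hz1] := h01 z.
  have nh0 := mulr_ge0 (ltW n0) hz0.
  have /andP[j0 j1] := truncn_itv nh0.
  exists (V (Num.truncn (n%:R * h z))).
    exists (Num.truncn (n%:R * h z)) => //=.
    by rewrite -(ler_nat R) (le_trans j0) // ger_pMr.
  rewrite /V /= ger0_norm ?subr_ge0 // ltrBlDr.
  by move: j1; rewrite -addn1 natrD addrC.
- move=> _ [i /= il <-].
  have i01 : 0 <= (i%:R / n%:R : R) <= 1.
    by rewrite divr_ge0 //= ler_pdivrMr // mul1r ler_nat.
  have [A UA At] := eU _ i01; exists A => // z Vi.
  rewrite -(shK z); apply: At; apply: lt_trans ne.
  rewrite -(ltr_pM2l n0) mulfV ?gt_eqF // -{1}(gtr0_norm n0) -normrM.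
  by rewrite mulrBr mulrCA mulfV ?gt_eqF // mulr1.
- move=> z; pose j := Num.truncn (n%:R * h z).
  apply: (@card_le_trans _ _ _ ((fun i => V (j + i)%N) @` `I_2)).
    apply: subset_card_le => _ [[i _ <-] Vi].
    have [->|->] := Vj _ _ Vi; first by exists 0%N; rewrite ?addn0.
    by exists 1%N; rewrite ?addn1.
  exact: card_image_le.
Qed.

(** The members of a refinement of order 0 are pairwise disjoint open sets covering the space, hence
    clopen. The connected image of [s] then stays in one member, which contains both ends, whereas
    neither [h < 3/4] nor [h > 1/4] holds at both ends. *)
Lemma not_covering_dim_le0 : ~ covering_dim_le X 0.
Proof.
have f1 : (1 < 2^-1 + 4^-1 :> R) = false by apply/negbTE; rewrite -leNgt; lra.
have f2 : (4^-1 < 0 :> R) = false by apply/negbTE; rewrite -leNgt; lra.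
pose U : set (set X) := [set [set z | h z < 2^-1 + 4^-1]; [set z | 4^-1 < h z]].
have cU : open_cover U.
  split.
    move=> _ [->|->].
      apply: (@open_comp X R h [set t | t < 2^-1 + 4^-1]) => [z _|]; [exact: ch|exact: open_lt].
    apply: (@open_comp X R h [set t | 4^-1 < t]) => [z _|]; [exact: ch|exact: open_gt].
  apply/seteqP; split => // z _.
  have [hz|hz] := ltP (h z) (2^-1 + 4^-1).
    by exists [set z | h z < 2^-1 + 4^-1]; [left|].
  by exists [set z | 4^-1 < h z]; [right|rewrite /=; lra].
move=> /(_ _ cU)[V [[oV cV] VU V1]].
have V_uniq B B' z : V B -> V B' -> B z -> B' z -> B = B'.
  move=> VB VB' Bz B'z; have /card_leP[f] := V1 z.
  have inB : B \in [set B | V B /\ B z] by rewrite inE.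
  have inB' : B' \in [set B | V B /\ B z] by rewrite inE.
  have I1 (i j : `I_1) : i = j.
    apply/val_inj; have := set_mem (valP i); have := set_mem (valP j).
    by rewrite /= !ltnS !leqn0 => /eqP -> /eqP ->.
  have /(_ (I1 _ _)) := 'inj_f (mem_setT (exist _ B inB)) (mem_setT (exist _ B' inB')).
  by case.
have [B VB Bs0] : (\bigcup_(B in V) B) (s 0) by rewrite cV.
have Bs : s @^-1` B = setT.
  have cT : connected [set: R] by apply/connected_intervalP.
  apply: cT; first by exists 0.
    exists (s @^-1` B); last by rewrite setTI.
    by apply: open_comp => [t _|]; [exact: cs|exact: oV].
  exists (s @^-1` B); last by rewrite setTI.
  rewrite -openC preimage_setC; apply: open_comp => [t _|]; first exact: cs.
  rewrite (_ : ~` B = \bigcup_(B' in [set B' | V B' /\ B' <> B]) B').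
    by apply: bigcup_open => B' [VB' _]; exact: oV.
  apply/seteqP; split => z /=.
    move=> nBz; have [B' VB' B'z] : (\bigcup_(B in V) B) z by rewrite cV.
    by exists B' => //; split => // BB; apply: nBz; rewrite -BB.
  by move=> [B' [VB' BB'] B'z] Bz; apply: BB'; exact: V_uniq B'z Bz.
have Bs1 : B (s 1) by have : (s @^-1` B) 1 by rewrite Bs.
have [A UA BA] := VU _ VB.
have h0 : h (s 0) = 0 by rewrite hsK // lexx ler01.
have h1 : h (s 1) = 1 by rewrite hsK // lexx ler01.
have := BA _ Bs0; have := BA _ Bs1.
by case: UA => -> /=; rewrite h0 h1 ?f1 ?f2.
Qed.

Lemma covering_dim1 : covering_dim X 1.
Proof.
split; first exact: covering_dim_le1.
by case=> // _; exact: not_covering_dim_le0.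
Qed.

End interval_dimension.

(** * Reflections, and the orbits as level sets of the height *)

Section householder.
Variables (R : realType) (m : nat).
Implicit Types (x y a : 'rV[R]_m).

(* For a = 0 the division by zero makes this the identity. *)
Definition householder a : 'M[R]_m := 1%:M - (2 / dot a a) *: (a^T *m a).

Lemma mul_householder x a : x *m householder a = x - (2 * dot x a / dot a a) *: a.
Proof.
by rewrite mulmxBr mulmx1 -scalemxAr mulmx_dot scalerA mulrAC.
Qed.

Lemma householder_sym a : (householder a)^T = householder a.
Proof. by rewrite /householder linearB /= trmx1 linearZ /= trmx_mul trmxK. Qed.

Lemma householderK a : householder a *m householder a = 1%:M.
Proof.
apply: mx_eq_row => x; rewrite mulmxA !mul_householder mulmx1.
have [->|a0] := eqVneq a 0; first by rewrite !scaler0 !subr0.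
have aa : dot a a != 0 by rewrite gt_eqF // dot_gt0.
rewrite -addrA -opprD -scalerDl dotDl dotNl dotZl.
by rewrite [X in _ - X *: _](_ : _ = 0) ?scale0r ?subr0 //; field.
Qed.

(** Vectors of equal norm are exchanged by the reflection in their bisecting hyperplane; the
    degenerate case [x = y] is covered by the convention for [a = 0]. *)
Lemma householder_swap x y : dot x x = dot y y -> x *m householder (x - y) = y.
Proof.
move=> xy; rewrite mul_householder.
have [xy0|a0] := eqVneq (x - y) 0.
  by rewrite xy0 scaler0 subr0; apply/eqP; rewrite -subr_eq0 xy0.
have aa : dot (x - y) (x - y) != 0 by rewrite gt_eqF // dot_gt0.
have -> : 2 * dot x (x - y) = dot (x - y) (x - y).
  by rewrite !(dotDl, dotDr, dotNl, dotNr) -xy (dotC y x); ring.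
by rewrite divff // scale1r opprB addrC subrK.
Qed.

Lemma householder_fix x a : dot x a = 0 -> x *m householder a = x.
Proof. by move=> xa; rewrite mul_householder xa mulr0 mul0r scale0r subr0. Qed.

(** Both [D *m a^T *m a] and [a^T *m a *m D] equal [t *: (a^T *m a)]. *)
Lemma ogroup_householder (D : 'M[R]_m) a (t : R) : D^T = D -> a *m D = t *: a ->
  ogroup D (householder a).
Proof.
move=> Dt aD; split; first by rewrite householder_sym householderK.
rewrite /householder mulmxBl mulmxBr mul1mx mulmx1 -scalemxAl -scalemxAr.
congr (_ - _ *: _); rewrite -mulmxA aD mulmxA.
have -> : D *m a^T = (a *m D)^T by rewrite trmx_mul Dt.
by rewrite aD -scalemxAr [(t *: a)^T]linearZ /= -scalemxAl.
Qed.

End householder.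

Section orbits.
Variables (R : realType) (d : nat) (c f : 'rV[R]_d).
Hypotheses (cc : dot c c = 1) (ff : dot f f = 1) (fc : dot f c = 0).
Local Notation S := (sphere_charted R d).
Local Notation D := (polar_proj c).
Local Notation act := (@og_act R d D).
Local Notation G := (og_lie_group D).
Local Notation height := (height c).

(** Equal heights and equal norms mean that the components in the first complex line have equal
    norms, and so have those in its complement. One reflection matches each pair of components and
    fixes the other summand; both commute with [D], their axes being eigenvectors for 1 and 0. *)
Lemma og_act_transitive (x y : S) :
  height (sphere_val x) = height (sphere_val y) -> exists A : G, act A x = y.
Proof.
move: (sphere_dot x) (sphere_dot y) => xx yy; set X := sphere_val x; set Y := sphere_val y.
rewrite !heightE // => hxy.
have part z : dot (z *m coaxial_proj c) (z *m coaxial_proj c) = dot z z - dot (z *m D) (z *m D).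
  have -> : dot (z *m D) (z *m D) = dot z (z *m D).
    by rewrite dot_mulmx P1t -mulmxA P1P1.
  by rewrite dot_mulmx P2t -mulmxA P2P2 // /coaxial_proj mulmxBr mulmx1 dotDr dotNr.
have orth z z' : dot (z *m coaxial_proj c) (z' *m D) = 0.
  by rewrite dotC dot_mulmx P1t -mulmxA P2P1 // mulmx0 dot0r.
pose a1 := X *m D - Y *m D; pose a2 := X *m coaxial_proj c - Y *m coaxial_proj c.
have a1D : a1 *m D = 1 *: a1 by rewrite /a1 -mulmxBl -mulmxA P1P1 // scale1r.
have a2D : a2 *m D = 0 *: a2 by rewrite /a2 -mulmxBl -mulmxA P2P1 // mulmx0 scale0r.
pose H := householder a1 *m householder a2.
have GH : ogroup D H.
  by apply: ogroupM; [apply: ogroup_householder a1D|apply: ogroup_householder a2D]; exact: P1t.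
(* The action multiplies by the transpose, hence [H^T] rather than [H]. *)
exists (exist _ H^T (mem_set (ogroupV GH))); apply: sphere_val_inj.
rewrite {1}/sphere_val /= trmxK -/X -/Y /H mulmxA.
have XE (z : 'rV[R]_(1 + d)) : z = z *m D + z *m coaxial_proj c.
  by rewrite /coaxial_proj mulmxBr mulmx1 addrC subrK.
have e1 : (X *m D + X *m coaxial_proj c) *m householder a1 = Y *m D + X *m coaxial_proj c.
  rewrite mulmxDl /a1 householder_swap // householder_fix //.
  by rewrite dotDr dotNr !orth subr0.
have e2 : (Y *m D + X *m coaxial_proj c) *m householder a2 = Y *m D + Y *m coaxial_proj c.
  rewrite mulmxDl householder_fix; last first.
    by rewrite /a2 dotDr dotNr !(dotC (Y *m D)) !orth subr0.
  by rewrite /a2 householder_swap // !part xx yy hxy.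
by rewrite -XE in e1; rewrite e1 e2 -XE.
Qed.

Lemma same_orbitP (x y : S) :
  reflect (height (sphere_val x) = height (sphere_val y)) (same_orbit act x y).
Proof.
have [act1 actM _] := @og_act_smooth R d D.
have actV (A : G) z : act (lie_inv A) (act A z) = z by rewrite -actM lie_mulV act1.
apply: (iffP idP) => [/asboolP xy|/og_act_transitive[A Ax]].
  have : Defs.orbit act x x by exists (lie_one G) => //; exact: act1.
  rewrite xy => -[A _ <-]; exact: height_og.
apply/asboolP; rewrite -Ax; apply/seteqP; split => _ [B _ <-].
  exists (lie_mul B (lie_inv A)) => //; by rewrite actM actV.
by exists (lie_mul B A) => //; rewrite actM.
Qed.

Local Notation O := (orbit_space act).
Local Notation Qo := {eq_quot same_orbit_rel act}.

Definition orbit_height (z : O) : R := height (sphere_val (repr (z : Qo))).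

Lemma orbit_height_pi (x : S) :
  orbit_height (\pi_Qo x) = height (sphere_val x).
Proof.
apply/same_orbitP; have := reprK (\pi_Qo x) => /eqmodP; exact.
Qed.

Lemma height_continuous : continuous height.
Proof.
move=> x; apply: (rat_continuous openT _ I); apply: rat_add.
  apply: rat_ext (rat_mul (rat_coord _ 0) (rat_coord _ 0)) => u _; exact: expr2.
have rc : rat_on setT (fun u : 'rV[R]_(1 + d) => dot (rsubmx u) c).
  apply: (@rat_sum _ _ setT _ _ xpredT) => i; apply: rat_mul; last exact: rat_cst.
  exact: (rat_rsubmx (@rat_mx_id _ _ setT)).
apply: rat_ext (rat_mul rc rc) => u _; exact: expr2.
Qed.

Lemma orbit_height_continuous : continuous orbit_height.
Proof.
apply/quotient_continuous => x.
rewrite (_ : _ \o _ = height \o @sphere_val R d); last first.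
  by apply/funext => z; exact: orbit_height_pi.
exact: (cvg_comp _ _ (@sphere_val_continuous R d x) (@height_continuous _)).
Qed.

(** The section in [covering_dim1] is a continuous map on all of R, so the parameter is first
    retracted to [0, 1]. *)
Definition clamp (t : R) : R := Num.max 0 (Num.min 1 t).

Lemma clamp01 t : 0 <= clamp t <= 1.
Proof. by rewrite /clamp le_max lexx /= ge_max ler01 ge_min lexx. Qed.

Lemma clamp_id t : 0 <= t <= 1 -> clamp t = t.
Proof. by move=> /andP[t0 t1]; rewrite /clamp min_r // max_r. Qed.

Lemma clamp_continuous : continuous clamp.
Proof.
move=> t; have c1 : {for t, continuous ((fun=> 1 : R) \min (id : R -> R))}.
  by apply: continuous_min; [exact: cst_continuous|exact: cvg_id].
have : {for t, continuous ((fun=> 0 : R) \max ((fun=> 1 : R) \min (id : R -> R)))}.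
  by apply: continuous_max c1; exact: cst_continuous.
exact.
Qed.

(** A quarter circle from [row_mx 0 f], of height 0, to the pole, of height 1. The square roots make
    the height equal to the parameter on [0, 1]. *)
Definition meridian_val (t : R) : 'rV[R]_(1 + d) :=
  Num.sqrt (clamp t) *: pole R d + Num.sqrt (1 - clamp t) *: row_mx 0 f.

Lemma x0_meridian t : coord0 (meridian_val t) = Num.sqrt (clamp t).
Proof. by rewrite x0D !x0Z x0_pole x0_row0 mulr1 mulr0 addr0. Qed.

Lemma rsubmx_meridian t : rsubmx (meridian_val t) = Num.sqrt (1 - clamp t) *: f.
Proof. by rewrite rsubmxD !rsubmxZ rsubmx_pole scaler0 add0r row_mxKr. Qed.

Lemma meridian_in t : (meridian_val t : 'rV[R]_(d.+1)) \in @sphere R d.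
Proof.
apply: sphere_in; have /andP[t0 t1] := clamp01 t.
rewrite dot_x0 x0_meridian rsubmx_meridian dotZl dotZr ff mulr1 -!expr2.
by rewrite !sqr_sqrtr ?subr_ge0 // addrC subrK.
Qed.

Definition meridian (t : R) : S := exist _ (meridian_val t : 'rV[R]_(d.+1)) (meridian_in t).

Lemma height_meridian t : height (sphere_val (meridian t)) = clamp t.
Proof.
have /andP[t0 t1] := clamp01 t.
rewrite /sphere_val /= (_ : height _ = coord0 (meridian_val t) ^+ 2
  + dot (rsubmx (meridian_val t)) c ^+ 2) // x0_meridian rsubmx_meridian dotZl fc mulr0.
by rewrite expr0n addr0 sqr_sqrtr.
Qed.

Lemma meridian_continuous : continuous meridian.
Proof.
move=> t; apply: continuous_to_sphere.
have c1 := cvg_comp _ _ (@clamp_continuous t) (@sqrt_continuous R (clamp t)).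
have c2 : Num.sqrt (1 - clamp s) @[s --> t] --> Num.sqrt (1 - clamp t).
  have c3 : 1 - clamp s @[s --> t] --> 1 - clamp t.
    by apply: cvgB; [exact: cvg_cst|exact: clamp_continuous].
  exact: (cvg_comp _ _ c3 (@sqrt_continuous R _)).
apply: (@cvg_mx _ _ _ _ (nbhs t) _) => i j; rewrite (ord1 i) !mxE.
under eq_fun do rewrite !mxE.
by apply: cvgD; apply: cvgMr_tmp.
Qed.

Lemma orbit_space_dim : covering_dim O 1.
Proof.
apply: (@covering_dim1 R O orbit_height (fun t => \pi_Qo (meridian t))).
- exact: orbit_height_continuous.
- move=> t; apply: (cvg_comp _ _ (@meridian_continuous t)).
  exact: (@pi_continuous S Qo).
- by move=> z; apply: height_bound => //; exact: sphere_dot.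
- move=> z; rewrite -[RHS](reprK (z : Qo)); apply/eqmodP/same_orbitP.
  rewrite height_meridian clamp_id //.
  by apply: height_bound => //; exact: sphere_dot.
- by move=> t t01; rewrite orbit_height_pi height_meridian clamp_id.
Qed.

Lemma gmetric_cohomogeneity_one (k : R) : 0 <= k -> cohomogeneity_one (gmetric c k).
Proof.
move=> k0; exists G, act; split.
- exact: og_compact.
- exact: og_act_smooth.
- by move=> A; exact: og_act_preserves.
- exact: orbit_space_dim.
Qed.

End orbits.

(** * Lengths of the orbits *)

Section model.
Variables (R : realType) (d : nat) (c f : 'rV[R]_d) (N : 'M[R]_d) (m : nat).
Hypotheses (cc : dot c c = 1) (ff : dot f f = 1) (fc : dot f c = 0)
  (cN : c *m N = 0) (Nt : N^T = - N) (NN : N *m N = c^T *m c - 1%:M) (m0 : (0 < m)%N).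
Local Notation S := (sphere_charted R d).
Local Notation b := (m.+1%:R / m%:R : R).
Local Notation k := (b ^+ 2 - 1).
Local Notation E := (rot c N b).
Local Notation g := (gmetric c k).
Local Notation height := (height c).
Local Notation vel := (@vel R d c N b cc cN Nt NN).
Local Notation flow := (@flow R d c N b cc cN Nt NN).
Local Notation pi2 := (pi *+ 2 : R).

Let mn : (m%:R : R) != 0. Proof. by rewrite pnatr_eq0 -lt0n. Qed.
Let mgt : 0 < m%:R :> R. Proof. by rewrite ltr0n. Qed.

Lemma speed_ge1 : 1 <= b.
Proof. by rewrite ler_pdivlMr // mul1r ler_nat. Qed.

Let bgt : 0 < b. Proof. exact: lt_le_trans ltr01 speed_ge1. Qed.

Lemma cos_period : cos (pi2 *+ m) = 1 /\ cos (b * (pi2 *+ m)) = 1.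
Proof.
split; first exact: cos2pin.
by rewrite -[pi2 *+ m]mulr_natl mulrA divfK // mulr_natl cos2pin.
Qed.

Lemma E_period : E (pi2 *+ m) = 1%:M.
Proof.
have [c1 c2] := cos_period.
rewrite /rot c1 c2 (cos1_sin0 c1) (cos1_sin0 c2) !scale0r !scale1r !addr0.
by rewrite /coaxial_proj addrC subrK.
Qed.

Lemma simple_closed_height0 gamma : integral_curve vel gamma ->
  height (sphere_val (gamma 0)) = 0 -> simple_closed gamma (pi2 / b).
Proof.
move=> ig h0; have p0 := pi2_gt0 R.
apply: (simple_closed_curve ig); first by rewrite divr_gt0.
  by apply: fixed_height0 => //; rewrite mulrCA divff ?gt_eqF // mulr1 cos2pi.
move=> t /andP[t0 t1]; apply/eqP => /(fixed_cos cc cN Nt (sphere_dot _))[_].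
rewrite h0 eq_sym oner_eq0 => /(_ isT) /eqP; apply/negP/cos_neq1.
by rewrite mulr_gt0 //= mulrC -ltr_pdivlMr.
Qed.

(** The circle in the first complex line is a third kind of orbit. Its period lies between the other
    two, so neither extreme of the lengths changes. *)
Lemma simple_closed_height1 gamma : integral_curve vel gamma ->
  height (sphere_val (gamma 0)) = 1 -> simple_closed gamma pi2.
Proof.
move=> ig h1; have p0 := pi2_gt0 R.
apply: (simple_closed_curve ig) => //.
  by apply: fixed_height1 => //; [exact: sphere_dot|exact: cos2pi].
move=> t t01; apply/eqP => /(fixed_cos cc cN Nt (sphere_dot _))[+ _].
by rewrite h1 oner_eq0 => /(_ isT) /eqP; apply/negP/cos_neq1.
Qed.

Lemma simple_closed_generic gamma : integral_curve vel gamma ->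
  height (sphere_val (gamma 0)) != 0 -> height (sphere_val (gamma 0)) != 1 ->
  simple_closed gamma (pi2 *+ m).
Proof.
move=> ig h0 h1; have p0 := pi2_gt0 R.
apply: (simple_closed_curve ig); first by rewrite pmulrn_lgt0.
  by rewrite E_period mulmx1.
move=> t /andP[t0 tT]; apply/eqP => /(fixed_cos cc cN Nt (sphere_dot _))[c1 c2].
by have := cos_eq1_both m0 t0 (c1 h0) (c2 h1); rewrite leNgt tT.
Qed.

Lemma vel_closed : closed_integral_curves vel.
Proof.
split=> [x|gamma ig].
  by exists (fun t => flow t x); [exact: flow_integral_curve|exact: flow0].
have [h0|h0] := eqVneq (height (sphere_val (gamma 0))) 0.
  by eexists; exact: simple_closed_height0.
have [h1|h1] := eqVneq (height (sphere_val (gamma 0))) 1.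
  by eexists; exact: simple_closed_height1.
by eexists; exact: simple_closed_generic.
Qed.

(** Every curve has returned after [pi2 *+ m], so a longer [T] contradicts injectivity. Conversely a
    return at time [T] forces a full turn in one of the two summands, that is [b * T >= pi2] or
    [T >= pi2], and [b >= 1]. *)
Lemma simple_closed_bounds gamma (T : R) : integral_curve vel gamma ->
  simple_closed gamma T -> pi2 / b <= T <= pi2 *+ m.
Proof.
move=> ig [T0 TP Tinj]; have p0 := pi2_gt0 R; apply/andP; split; last first.
  rewrite leNgt; apply/negP => mT; have pm0 : 0 < pi2 *+ m by rewrite pmulrn_lgt0.
  have : 0 = pi2 *+ m :> R.
    apply: Tinj; rewrite ?lexx ?T0 ?(ltW pm0) ?mT //.
    by apply: sphere_val_inj; rewrite (integral_curve_unique (pi2 *+ m) ig) E_period mulmx1.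
  by move=> e; move: pm0; rewrite -e ltxx.
have := fixed_cos cc cN Nt (sphere_dot (gamma 0)).
move=> /(_ b T)[|c1 c2].
  by rewrite -(integral_curve_unique T ig) -[T]add0r TP.
have [h0|h0] := eqVneq (height (sphere_val (gamma 0))) 0.
  rewrite ler_pdivrMr // mulrC; apply: cos_eq1_le; first by rewrite mulr_gt0.
  by apply: c2; rewrite h0 eq_sym oner_eq0.
apply: le_trans (cos_eq1_le T0 (c1 h0)).
by rewrite ler_pdivrMr // ler_peMr ?(ltW p0) // speed_ge1.
Qed.

Lemma length_bounds : ubound (integral_curve_lengths g vel) (pi2 *+ m) /\
  lbound (integral_curve_lengths g vel) (pi2 / b).
Proof.
split=> _ [gamma [T [ig sT ->]]]; have [T0 _ _] := sT;
  have /andP[T1 T2] := simple_closed_bounds ig sT;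
  by rewrite (integral_curve_length speed_ge1 ig (ltW T0)).
Qed.

Lemma length_attained : integral_curve_lengths g vel (pi2 *+ m) /\
  integral_curve_lengths g vel (pi2 / b).
Proof.
have p0 := pi2_gt0 R.
have hm (t : R) : 0 <= t <= 1 ->
    height (sphere_val (flow 0 (meridian ff t))) = t.
  by move=> t01; rewrite flow0 height_meridian // clamp_id.
split.
  (* Height 1/2 is a generic orbit, of maximal length; the starting point at height 0 in the second
     half gives the minimal length. *)
  exists (fun t => flow t (meridian ff 2^-1)), (pi2 *+ m).
  have ig := flow_integral_curve b cc cN Nt NN (meridian ff 2^-1).
  have t01 : 0 <= (2^-1 : R) <= 1 by lra.
  split => //; last first.
    by rewrite (integral_curve_length speed_ge1 ig) // mulrn_wge0 // ltW.
  by apply: simple_closed_generic => //; rewrite hm //; apply/eqP; lra.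
exists (fun t => flow t (meridian ff 0)), (pi2 / b).
have ig := flow_integral_curve b cc cN Nt NN (meridian ff 0).
split => //; last first.
  by rewrite (integral_curve_length speed_ge1 ig) // divr_ge0 // ltW.
by apply: simple_closed_height0 => //; rewrite hm // lexx ler01.
Qed.

Lemma length_ratio : (pi2 *+ m) / (pi2 / b) = m.+1%:R.
Proof.
have := pi2_gt0 R; move: (pi *+ 2) => p p0.
rewrite -(mulr_natl p m); field.
by rewrite mn (gt_eqF p0) /= addrC natr1 pnatr_eq0.
Qed.

(** Here [k] is (2m + 1)/m^2, and [m >= 1]. *)
Lemma k_le : k <= 3 / m%:R.
Proof.
have -> : k = (2 + m%:R^-1) / m%:R by rewrite -addn1 natrD; field.
rewrite ler_pM2r ?invr_gt0 //.
have : m%:R^-1 <= 1 :> R by rewrite invf_le1 // ler1n.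
lra.
Qed.

End model.

(** * The choice of the parameters *)

Lemma model_sphere (R : realType) (h : nat) (eps : R) : (0 < h)%N -> 0 < eps ->
  exists (g : metric (sphere_charted R (1 + (h + h))))
         (X : vfield (sphere_charted R (1 + (h + h)))),
    (analytic_metric g /\ cohomogeneity_one g) /\
    [/\ analytic_vector_field X, killing g X, unit_length g X
      & closed_integral_curves X] /\
    (forall K : R, is_sectional_curvature g K -> `|K - 1| <= eps) /\
    (exists L l : R,
      [/\ integral_curve_lengths g X L /\ ubound (integral_curve_lengths g X) L,
          integral_curve_lengths g X l /\ lbound (integral_curve_lengths g X) l
        & eps^-1 < L / l]).
Proof.
case: h => // h _ eps0.
(* The ambient space splits as 1 + 1 + 2 [h.+1]: the pole, the axis [c], and a complement on which
   [K0] is multiplication by i up to sign. The unit vector [f] in the complement exists because the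
   latter is nonzero. *)
pose c : 'rV[R]_(1 + (h.+1 + h.+1)) := row_mx (const_mx 1) 0.
pose f : 'rV[R]_(1 + (h.+1 + h.+1)) := row_mx 0 (row_mx (delta_mx 0 0) 0).
pose K0 : 'M[R]_(h.+1 + h.+1) := block_mx 0 1%:M (- 1%:M) 0.
have cc : dot c c = 1 by rewrite dot_row_mx dot_const_mx1 dot0r mulr1 addr0.
have ff : dot f f = 1.
  by rewrite !dot_row_mx !dot0r add0r addr0 dot_delta mxE !eqxx.
have fc : dot f c = 0 by rewrite dot_row_mx dot0l dot0r addr0.
have K0t : K0^T = - K0.
  by rewrite tr_block_mx !trmx0 linearN /= !trmx1 opp_block_mx !oppr0 opprK.
have K0K0 : K0 *m K0 = - 1%:M.
  rewrite mulmx_block !mulmx0 !mul0mx !addr0 !add0r mulmxN mulNmx !mulmx1.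
  by rewrite scalar_mx_block opp_block_mx !oppr0.
clearbody K0.
pose N : 'M[R]_(1 + (h.+1 + h.+1)) := block_mx 0 0 0 K0.
have cN : c *m N = 0.
  by rewrite mul_row_block !mulmx0 !mul0mx !addr0 row_mx0.
have Nt : N^T = - N by rewrite /N tr_block_mx !trmx0 K0t opp_block_mx !oppr0.
have NN : N *m N = c^T *m c - 1%:M.
  rewrite mulmx_block !mulmx0 !mul0mx !addr0 !add0r K0K0 /c tr_row_mx mul_col_row.
  rewrite [X in _ = _ - X]scalar_mx_block opp_block_mx add_block_mx trmx0.
  rewrite !mulmx0 !mul0mx !oppr0 !addr0 add0r.
  congr block_mx; apply/matrixP => i j; rewrite !mxE big_ord1 !mxE !ord1 eqxx.
  by rewrite mulr1 subrr.
(* As [k <= 3 / m%:R], the curvature bound [20 * k] is at most [eps] once m > 60/eps. The shift by 3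
   also gives [m >= 3], hence [k <= 1], which [sectional_near1] requires. *)
pose m := (Num.truncn (60 / eps)).+3.
have m0 : (0 < m)%N by [].
have mgt : 60 / eps < m%:R.
  have e60 : 0 <= 60 / eps by rewrite divr_ge0 // ltW.
  have /andP[_ h2] := truncn_itv e60.
  by apply: lt_le_trans h2 _; rewrite ler_nat; exact: leq_trans (leqnSn _) (leqnSn _).
have m3 : 3 <= m%:R :> R by rewrite ler_nat.
have mpos : 0 < m%:R :> R by lra.
have kle := @k_le R m m0.
have k3 : 3 / m%:R <= 1 :> R by rewrite ler_pdivrMr // mul1r.
have keps : 20 * (3 / m%:R) <= eps.
  rewrite mulrA ler_pdivrMr //; move: mgt; rewrite ltr_pdivrMr // mulrC => mgt.
  by apply: le_trans (ltW mgt); lra.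
have b1 := @speed_ge1 R m m0.
have k0 := k_ge0 b1.
exists (gmetric c ((m.+1%:R / m%:R) ^+ 2 - 1)),
  (@vel R _ c N (m.+1%:R / m%:R) cc cN Nt NN); split; [split|split; [split|split]].
- exact: gmetric_analytic.
- exact (gmetric_cohomogeneity_one cc ff fc k0).
- exact: vel_analytic.
- exact: vel_killing.
- exact: vel_unit.
- exact: vel_closed.
- move=> K [ch [u [v [w [_ _ fvw ->]]]]].
  have b2 : (m.+1%:R / m%:R) ^+ 2 <= 2 :> R by lra.
  have near1 := @sectional_near1 R _ c _ cc b1 u v w b2 fvw.
  by apply: (le_trans near1); apply: le_trans keps; rewrite ler_pM2l.
- exists (pi *+ 2 *+ m), (pi *+ 2 / (m.+1%:R / m%:R)).
  have [L1 l1] := length_attained cc ff fc cN Nt NN m0.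
  have [L2 l2] := length_bounds cc cN Nt NN m0.
  split => //; rewrite length_ratio //.
  apply: lt_trans (_ : 60 / eps < _); first by rewrite ltr_pMl ?invr_gt0 // ltr1n.
  by apply: lt_trans mgt _; rewrite ltr_nat.
Qed.

Theorem theorem20 (R : realType) (n : nat) (hn : (2 <= n)%N)
    (eps : R) (heps : 0 < eps) :
  exists (g : metric (sphere_charted R (2 * n).-1))
         (X : vfield (sphere_charted R (2 * n).-1)),
    (analytic_metric g /\ cohomogeneity_one g) /\
    [/\ analytic_vector_field X, killing g X, unit_length g X
      & closed_integral_curves X] /\
    (forall K : R, is_sectional_curvature g K -> `|K - 1| <= eps) /\
    (exists L l : R,
      [/\ integral_curve_lengths g X L /\ ubound (integral_curve_lengths g X) L,
          integral_curve_lengths g X l /\ lbound (integral_curve_lengths g X) l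
        & eps^-1 < L / l]).
Proof.
have -> : (2 * n).-1 = (1 + (n.-1 + n.-1))%N.
  by case: n hn => [|n] // _; rewrite mul2n -addnn addSn add1n addnS.
by apply: model_sphere => //; case: n hn => [|[]].
Qed.
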